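(* Let $K\in\mathcal{K}_e^n$ be an origin-symmetric convex body in $\mathbb{R}^n$, let $q\geq n+1$ be a real number, and let $L\subset\mathbb{R}^n$ be a proper linear subspace of $\mathbb{R}^n$. Then $$\frac{\widetilde{\mathrm{C}}_q(K,\mathbb{S}^{n-1}\cap L)}{\widetilde{\mathrm{C}}_q(K,\mathbb{S}^{n-1})}<\frac{q-n+\dim L}{q}.$$
   Context: A convex body in $\mathbb{R}^n$ is a non-empty convex compact subset of $\mathbb{R}^n$. $\mathcal{K}_o^n$ is the set of convex bodies in $\mathbb{R}^n$ having the origin as an interior point, and $\mathcal{K}_e^n$ is the set of those $K\in\mathcal{K}_o^n$ with $K=-K$. $\langle\cdot,\cdot\rangle$ is the standard inner product, $|\cdot|$ the Euclidean norm, $\mathbb{S}^{n-1}$ the Euclidean unit sphere in $\mathbb{R}^n$, and $\mathcal{H}^{n-1}$ the $(n-1)$-dimensional Hausdorff measure. For $K\in\mathcal{K}_o^n$: the support function is $h_K(x)=\max_{y\in K}\langle x,y\rangle$; the radial function is $\rho_K(x)=\max\{\rho>0:\rho x\in K\}$ for $x\in\mathbb{R}^n\setminus\{0\}$; for $v\in\mathbb{S}^{n-1}$ the supporting hyperplane is $H_K(v)=\{x\in\mathbb{R}^n:\langle x,v\rangle=h_K(v)\}$. For $\eta\subseteq\mathbb{S}^{n-1}$ the reverse radial Gauss image is $$\alpha_K^*(\eta)=\{u\in\mathbb{S}^{n-1}:\rho_K(u)u\in H_K(v)\text{ for some }v\in\eta\}.$$ For $q\in\mathbb{R}$ the $q$th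 dual curvature measure of $K$ is defined for Borel sets $\eta\subseteq\mathbb{S}^{n-1}$ by $$\widetilde{\mathrm{C}}_q(K,\eta)=\frac1n\int_{\alpha_K^*(\eta)}\rho_K(u)^q\,d\mathcal{H}^{n-1}(u).$$ *)

(* Defs.v *)
From HB Require Import structures.
From mathcomp Require Import all_boot all_order all_algebra.
From mathcomp Require Import all_classical all_reals all_analysis.

Set Implicit Arguments.
Unset Strict Implicit.
Unset Printing Implicit Defensive.

Import Order.TTheory GRing.Theory Num.Theory.
Import numFieldNormedType.Exports.

Local Open Scope classical_set_scope.
Local Open Scope ring_scope.

(* The library norm on 'rV[R]_n is the sup norm, hence the Euclidean norm below.
   Both norms induce the topology of 'rV[R]_n. *)
Definition dotv (R : realType) (n : nat) (x y : 'rV[R]_n) : R :=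
  \sum_i x 0 i * y 0 i.

Definition enorm (R : realType) (n : nat) (x : 'rV[R]_n) : R :=
  Num.sqrt (dotv x x).

Definition usphere (R : realType) (n : nat) : set 'rV[R]_n :=
  [set u | enorm u = 1].

Definition convex_body (R : realType) (n : nat) (K : set 'rV[R]_n) : Prop :=
  [/\ K !=set0, convex_set (K : set (convex_lmodType 'rV[R]_n)) & compact K].

Definition convex_body_o (R : realType) (n : nat) (K : set 'rV[R]_n) : Prop :=
  convex_body K /\ K° 0.

Definition convex_body_e (R : realType) (n : nat) (K : set 'rV[R]_n) : Prop :=
  convex_body_o K /\ [set - x | x in K] = K.

Definition support_fun (R : realType) (n : nat) (K : set 'rV[R]_n)
    (x : 'rV[R]_n) : R :=
  sup [set dotv x y | y in K].

Definition radial_fun (R : realType) (n : nat) (K : set 'rV[R]_n)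
    (x : 'rV[R]_n) : R :=
  sup [set r | 0 < r /\ K (r *: x)].

Definition supporting_hyperplane (R : realType) (n : nat) (K : set 'rV[R]_n)
    (v : 'rV[R]_n) : set 'rV[R]_n :=
  [set x | dotv x v = support_fun K v].

Definition rev_radial_Gauss (R : realType) (n : nat) (K : set 'rV[R]_n)
    (eta : set 'rV[R]_n) : set 'rV[R]_n :=
  [set u | usphere u /\
    exists2 v, eta v & supporting_hyperplane K v (radial_fun K u *: u)].

(* Volume of the d-dimensional Euclidean unit ball, pi ^ (d/2) / Gamma(d/2 + 1),
   for which kappa_d = 2 pi / d * kappa_(d-2). *)
Fixpoint ball_volume (R : realType) (d : nat) : R :=
  match d with
  | 0 => 1
  | 1 => 2
  | d'.+2 => 2 * pi / d%:R * ball_volume R d'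
  end.

(* The diameter of set0 is -oo. *)
Definition ediam (R : realType) (n : nat) (U : set 'rV[R]_n) : \bar R :=
  ereal_sup [set (enorm (p.1 - p.2))%:E | p in U `*` U].

(* The factor makes the d-dimensional Hausdorff measure agree with the Lebesgue
   measure on R^d. A nonempty set has weight 1 when d = 0. *)
Definition hausdorff_weight (R : realType) (n d : nat) (U : set 'rV[R]_n) :
    \bar R :=
  if `[< U = set0 >] then 0%E
  else ((ball_volume R d / 2 ^+ d)%:E * ediam U ^+ d)%E.

Definition hausdorff_cover (R : realType) (n : nat) (delta : R)
    (A : set 'rV[R]_n) : set (nat -> set 'rV[R]_n) :=
  [set U | (forall k, ediam (U k) <= delta%:E)%E /\ A `<=` \bigcup_k U k].

Definition hausdorff_delta (R : realType) (n d : nat) (delta : R)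
    (A : set 'rV[R]_n) : \bar R :=
  ereal_inf [set (\sum_(k <oo) hausdorff_weight d (U k))%E
            | U in hausdorff_cover delta A].

Definition hausdorff (R : realType) (n d : nat) (A : set 'rV[R]_n) : \bar R :=
  ereal_sup [set hausdorff_delta d delta A | delta in [set delta | 0 < delta]].

Section hausdorff_outer_measure.
Local Open Scope ereal_scope.
Context (R : realType) (n d : nat).
Implicit Types (A : set 'rV[R]_n) (delta : R).

Lemma ball_volume_ge0 k : (0 <= ball_volume R k)%R.
Proof.
suff : (0 <= ball_volume R k)%R /\ (0 <= ball_volume R k.+1)%R by case.
elim: k => [|k [k0 k1]]; first by split.
by split=> //=; rewrite mulr_ge0 // divr_ge0 // mulr_ge0 // pi_ge0.
Qed.

Lemma hausdorff_weight0 : hausdorff_weight d (set0 : set 'rV[R]_n) = 0.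
Proof. by rewrite /hausdorff_weight; case: asboolP. Qed.

Lemma ediam_ge0 (U : set 'rV[R]_n) : U !=set0 -> 0 <= ediam U.
Proof.
move=> [x Ux]; apply: (@le_trans _ _ (enorm (x - x))%:E).
  by rewrite lee_fin sqrtr_ge0.
by apply: ereal_sup_ubound; exists (x, x).
Qed.

Lemma hausdorff_weight_ge0 (U : set 'rV[R]_n) : 0 <= hausdorff_weight d U.
Proof.
rewrite /hausdorff_weight; case: asboolP => // /eqP/set0P /ediam_ge0 U0.
by rewrite mule_ge0 ?expe_ge0 // lee_fin divr_ge0 ?ball_volume_ge0.
Qed.

Lemma hausdorff_delta_ge0 delta A : 0 <= hausdorff_delta d delta A.
Proof.
apply: le_ereal_inf_tmp => _ [U _ <-].
by apply: nneseries_ge0 => k _ _; exact: hausdorff_weight_ge0.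
Qed.

Lemma hausdorff_delta0 delta :
  hausdorff_delta d delta (set0 : set 'rV[R]_n) = 0.
Proof.
apply/eqP; rewrite eq_le hausdorff_delta_ge0 andbT.
apply: ereal_inf_lbound; exists (fun=> set0).
  split=> // k; apply: ge_ereal_sup => _ [p [[]]].
by rewrite eseries0 // => k _ _; exact: hausdorff_weight0.
Qed.

Lemma le_hausdorff_delta delta :
  {homo @hausdorff_delta R n d delta : A B / A `<=` B >-> A <= B}.
Proof.
move=> A B AB; apply: ereal_inf_le_tmp => _ [U [dU BU] <-].
by exists U => //; split => //; exact: subset_trans BU.
Qed.

Lemma hausdorff_delta_sigma_subadditive delta :
  sigma_subadditive (@hausdorff_delta R n d delta).
Proof.
move=> A; set mu := @hausdorff_weight R n d.
have [[i ioo]|] := pselect (exists i, hausdorff_delta d delta (A i) = +oo).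
  rewrite (eseries_pinfty _ _ ioo) ?leey// => k _.
  by rewrite -ltNye (lt_le_trans _ (hausdorff_delta_ge0 _ _)).
rewrite -forallNE => Aoo.
apply/lee_addgt0Pr => e e0.
rewrite (le_trans _ (epsilon_trick _ _ (ltW e0)))//; last first.
  by move=> k; exact: hausdorff_delta_ge0.
pose P k (B : (set 'rV[R]_n)^nat) := hausdorff_cover delta (A k) B /\
  \sum_(j <oo) mu (B j) <= hausdorff_delta d delta (A k) + (e / (2 ^ k.+1)%:R)%:E.
have [G PG] : {G : ((set 'rV[R]_n)^nat)^nat & forall k, P k (G k)}.
  apply: (@choice _ _ P) => k.
  have Afin : hausdorff_delta d delta (A k) \is a fin_num.
    by rewrite ge0_fin_numE ?hausdorff_delta_ge0// ltey; apply/eqP/Aoo.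
  have ek : (0 < e / (2 ^ k.+1)%:R)%R by rewrite divr_gt0 // ltr0n expn_gt0.
  have [_ [B BA <-] Blt] := lb_ereal_inf_adherent ek Afin.
  by exists B; split => //; exact/ltW.
have mu_ge0 U : 0 <= mu U by exact: hausdorff_weight_ge0.
have muG_ge0 x : 0 <= (mu \o uncurry G) x by exact: mu_ge0.
apply: (@le_trans _ _ (\esum_(i in setT) (mu \o uncurry G) i)).
  apply: ereal_inf_lbound => /=.
  have /card_esym/ppcard_eqP[f] := card_nat2.
  exists (uncurry G \o f).
    split => [i|].
      by rewrite /= /uncurry; case: (f i) => a b; exact: (PG a).1.1.
    apply: (@subset_trans _ (\bigcup_k \bigcup_j G k j)) => [t [i _]|].
      by move=> /(PG i).1.2 [j _ ?]; exists i => //; exists j.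
    move=> t [i _ [j _ Bijt]]; exists (f^-1%FUN (i, j)) => //=.
    by rewrite invK ?inE.
  rewrite -(esum_pred_image (mu \o uncurry G) _ xpredT) ?[fun=> _]set_true//.
  by rewrite image_eq.
rewrite (_ : esum _ _ = \sum_(i <oo) \sum_(j <oo ) mu (G i j)); last first.
  pose J : nat -> set (nat * nat) := fun i => [set (i, j) | j in setT].
  rewrite (_ : setT = \bigcup_k J k); last first.
    by rewrite predeqE => -[a b]; split => // _; exists a => //; exists b.
  rewrite esum_bigcupT //=; last first.
    apply/trivIsetP => i j _ _ ij.
    rewrite predeqE => -[k m] /=; split => //= -[] [_] _ [<-{k} _].
    by move=> [m' _] [] /esym/eqP; rewrite (negbTE ij).
  rewrite -(image_id [set: nat]) -fun_true esum_pred_image//; last first.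
    by move=> k _; apply: esum_ge0 => x _; exact: muG_ge0.
  apply: eq_eseriesr => /= j _.
  rewrite -(esum_pred_image (mu \o uncurry G) (pair j) predT)//=; last first.
    by move=> ? ? _ _; exact: (@can_inj _ _ _ snd).
  by congr esum; rewrite predeqE => -[a b]; split; move=> [i _ <-]; exists i.
apply: lee_nneseries => [k _ _|k _].
  by apply: nneseries_ge0 => j _ _; exact: (muG_ge0 (k, j)).
exact: (PG k).2.
Qed.

Lemma hausdorff0 : hausdorff d (set0 : set 'rV[R]_n) = 0.
Proof.
apply/eqP; rewrite eq_le; apply/andP; split.
  by apply: ge_ereal_sup => _ [delta _ <-]; rewrite hausdorff_delta0.
by apply: ereal_sup_ubound; exists 1%R; [exact: ltr01|exact: hausdorff_delta0].
Qed.

Lemma hausdorff_ge0 A : 0 <= hausdorff d A.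
Proof.
apply: (le_trans (hausdorff_delta_ge0 1 A)).
by apply: ereal_sup_ubound; exists 1%R; first exact: ltr01.
Qed.

Lemma le_hausdorff : {homo @hausdorff R n d : A B / A `<=` B >-> A <= B}.
Proof.
move=> A B AB; apply: ge_ereal_sup => _ [delta delta0 <-].
apply: (le_trans (le_hausdorff_delta delta AB)).
by apply: ereal_sup_ubound; exists delta.
Qed.

Lemma hausdorff_sigma_subadditive : sigma_subadditive (@hausdorff R n d).
Proof.
move=> A; apply: ge_ereal_sup => _ [delta delta0 <-].
apply: (le_trans (hausdorff_delta_sigma_subadditive delta A)).
apply: lee_nneseries => [k _ _|k _]; first exact: hausdorff_delta_ge0.
by apply: ereal_sup_ubound; exists delta.
Qed.

HB.instance Definition _ := isOuterMeasure.Build R 'rV[R]_n (@hausdorff R n d)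
  hausdorff0 hausdorff_ge0 le_hausdorff hausdorff_sigma_subadditive.

End hausdorff_outer_measure.

(* The outer measure [hausdorff d] on its Caratheodory-measurable sets, which
   include the Borel sets. *)
Definition hausdorff_measure (R : realType) (n d : nat) :
    set (caratheodory_type (@hausdorff R n d)) -> \bar R :=
  @hausdorff R n d.

HB.instance Definition _ (R : realType) (n d : nat) :=
  Measure.copy (@hausdorff_measure R n d)
    ((@hausdorff R n d : {outer_measure set 'rV[R]_n -> \bar R})
      : set (caratheodory_type (@hausdorff R n d)) -> \bar R).

Definition dual_curvature (R : realType) (n : nat) (q : R) (K : set 'rV[R]_n)
    (eta : set 'rV[R]_n) : \bar R :=
  ((n%:R^-1)%:E *
   \int[@hausdorff_measure R n n.-1]_(u in rev_radial_Gauss K eta)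
      (radial_fun K u `^ q)%:E)%E.

(* Main.v *)
(* Put n = dim L + l, k = dim L and p = q - n >= 1, and let N be the gauge of K. In
   polar coordinates the quotient becomes I_D / I_K, where I_K is the integral of
   |x|^p over K = {N < 1} and I_D the integral over the points of K in directions
   with an outer normal in L. At such a point x the gauge attains its minimum s(y)
   over the translate of the orthogonal complement of L through x, y being the
   projection of x to L. For fixed y with 0 < s = s(y) < 1, averaging points of the
   level set {N = 1} above y / s with the opposites of others, with weights
   (1 + s) / 2 and (1 - s) / 2, gives points of K above y. By the Hadwiger-Ohmann
   proof of the Brunn-Minkowski inequality and the convexity of r^p, this yields
   G(y) <= s^l F(y), where F(y) and G(y) are the integrals of |x|^p over the slice of
   K above y and over its part {N = s}. Since G is homogeneous of degree p + l,
   (p + n) I_D = (p + k) int s^(-l) G <= (p + k) I_K, strictly because s^(-l) G tends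
   to 0 at y = 0.

   The passage to polar coordinates uses that the Hausdorff measure of the sphere
   and the Lebesgue measure of cones are both invariant under reflections, hence
   uniformly distributed, hence proportional. *)
Require Import Defs.
From HB Require Import structures.
From mathcomp Require Import all_boot all_order all_algebra.
From mathcomp Require Import all_classical all_reals all_analysis.
From mathcomp Require Import measurable_realfun ring lra.

Set Implicit Arguments.
Unset Strict Implicit.
Unset Printing Implicit Defensive.

Import Order.TTheory GRing.Theory Num.Theory.
Import numFieldNormedType.Exports.

Local Open Scope classical_set_scope.
Local Open Scope ring_scope.

(** * Borel sets and Lebesgue measure on R^n *)

(** The averaging is carried out on an open set paired with its opposite. The two have equal volume,
    as the Hadwiger-Ohmann induction requires, and weights [t], [1 - t] with [2 t - 1 = s] send two
    points above [y] to a point above [s y]; this fixes [t = (1 + s) / 2]. The symmetry of [K] keeps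
    such averages in the body, and [q >= n + 1] is what makes the power [p = q - n] convex. Level
    sets are not open, so [{N = 1}] is first thickened to [{N < c}] with [c > 1], and then [c] tends
    to 1. The set of directions with an outer normal in [L] is only ever enlarged, to the Borel set
    where the gauge equals its minimum over a translate of the orthogonal complement; this bounds
    the numerator from above. Two constants are never evaluated: the ratio of spherical to conical
    measure, which cancels in the quotient, and the determinant of a general matrix, since the
    linear changes of variable are diagonal or orthogonal. *)

HB.instance Definition _ (R : realType) (n : nat) :=
  @isMeasurable.Build (sigma_display (@open 'rV[R]_n)) 'rV[R]_n
    <<s (@open 'rV[R]_n) >> (@sigma_algebra0 _ setT _) (@sigma_algebraC _ _)
    (@sigma_algebra_bigcup _ setT _).

Lemma open_measurable_rV (R : realType) n (U : set 'rV[R]_n) :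
  open U -> measurable U.
Proof. by move=> oU; exact: sub_sigma_algebra. Qed.

Lemma closed_measurable_rV (R : realType) n (U : set 'rV[R]_n) :
  closed U -> measurable U.
Proof.
by move=> /closed_openC /open_measurable_rV /measurableC; rewrite setCK.
Qed.

Lemma measurable_coord (R : realType) n (i : 'I_n) :
  measurable_fun [set: 'rV[R]_n] (fun x : 'rV[R]_n => x 0 i).
Proof.
apply: (measurability _ (RGenOpens.measurableE R)).
move=> _ [_ [a [b ->]] <-]; rewrite setTI; apply: open_measurable_rV.
by apply: open_comp; [move=> x _; exact: coord_continuous|exact: interval_open].
Qed.

Section borel_rV.
Context d (T : measurableType d) (R : realType).

(** Every open set is a countable union of cubes [B] with rational centre and radius, and the
    preimage of such a cube is a finite intersection of preimages of intervals under the
    coordinates. *)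
Lemma measurable_fun_rV n (f : T -> 'rV[R]_n) :
  (forall i, measurable_fun setT (fun t => f t 0 i)) -> measurable_fun setT f.
Proof.
move=> mf; apply: (@measurability _ _ _ _ _ _ (@open 'rV[R]_n)) => //.
move=> _ [U oU <-]; rewrite setTI.
pose B (cr : 'rV[rat]_n * rat) : set 'rV[R]_n :=
  [set v | forall i, `|v 0 i - ratr (cr.1 0 i)| < ratr cr.2].
have UE : U = \bigcup_cr (if `[< B cr `<=` U >] then B cr else set0).
  apply/seteqP; split=> [x Ux|x [cr _]]; last by case: asboolP => // + Bx; apply.
  have /nbhs_ballP[e /= e0 eU] : nbhs x U by exact: open_nbhs_nbhs.
  have [r] : exists r : rat, 0 < (ratr r : R) < e / 2.
    by have [r] := @rat_in_itvoo R 0 (e / 2) (divr_gt0 e0 (ltr0n _ 2)); exists r.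
  move=> /andP[r0 re].
  have /choice[c Hc] : forall i, exists c : rat, `|x 0 i - ratr c| < ratr r.
    move=> i; have xr : x 0 i - ratr r < x 0 i + ratr r by lra.
    have [c] := rat_in_itvoo xr; rewrite in_itv/= => /andP[? ?].
    by exists c; rewrite ltr_distlC; lra.
  exists (\row_i c i, r) => //; case: asboolP => [_ i|[]]; first by rewrite mxE.
  move=> y By; apply: eU; split=> // i j; rewrite (ord1 i) -ball_normE /=.
  have := By j; rewrite mxE /= => By'; have := Hc j => Hj.
  rewrite (le_lt_trans (ler_distD (ratr (c j)) _ _))//.
  rewrite [X in _ + X]distrC; lra.
rewrite UE preimage_bigcup; apply: countable_bigcupT_measurable => // cr.
case: asboolP => _; last by rewrite preimage_set0.
rewrite (_ : _ @^-1` _ = \bigcap_(i in [set: 'I_n])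
    ((fun t => f t 0 i) @^-1` `]ratr (cr.1 0 i) - ratr cr.2, ratr (cr.1 0 i) + ratr cr.2[%classic)).
  apply: fin_bigcap_measurable => // i _.
  by rewrite -[X in measurable X]setTI; exact: mf.
apply/seteqP; split => [t Bt i _|t Bt i].
  by rewrite /= in_itv/= -ltr_distlC distrC; exact: Bt.
by have := Bt i I; rewrite /= in_itv/= -ltr_distlC distrC.
Qed.

Lemma measurable_rV_coord n (f : T -> 'rV[R]_n) i : measurable_fun setT f ->
  measurable_fun setT (fun t => f t 0 i).
Proof. by move=> mf; exact: measurableT_comp (measurable_coord i) mf. Qed.

Lemma measurable_rVD n (f g : T -> 'rV[R]_n) : measurable_fun setT f -> measurable_fun setT g ->
  measurable_fun setT (fun t => f t + g t).
Proof.
move=> mf mg; apply: measurable_fun_rV => i.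
under eq_fun do rewrite mxE.
by apply: measurable_funD; exact: measurable_rV_coord.
Qed.

Lemma measurable_rVZ n (k : T -> R) (f : T -> 'rV[R]_n) : measurable_fun setT k ->
  measurable_fun setT f -> measurable_fun setT (fun t => k t *: f t).
Proof.
move=> mk mf; apply: measurable_fun_rV => i.
under eq_fun do rewrite mxE.
by apply: measurable_funM => //; exact: measurable_rV_coord.
Qed.

Lemma measurable_rVN n (f : T -> 'rV[R]_n) :
  measurable_fun setT f -> measurable_fun setT (fun t => - f t).
Proof.
move=> mf; apply: measurable_fun_rV => i.
under eq_fun do rewrite mxE.
exact/measurable_funN/measurable_rV_coord.
Qed.

Lemma measurable_rV_mulmx m n (g : T -> 'rV[R]_m) (A : 'M[R]_(m, n)) :
  measurable_fun setT g -> measurable_fun setT (fun t => g t *m A).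
Proof.
move=> mg; apply: measurable_fun_rV => i.
under eq_fun do rewrite mxE.
apply: measurable_sum => j; apply: measurable_funM => //.
exact: measurable_rV_coord.
Qed.

Lemma measurable_row_mx k l (f : T -> 'rV[R]_k) (g : T -> 'rV[R]_l) :
  measurable_fun setT f -> measurable_fun setT g ->
  measurable_fun setT (fun t => row_mx (f t) (g t)).
Proof.
move=> mf mg; apply: measurable_fun_rV => i; under eq_fun do rewrite mxE.
by case: split_ordP => j _; exact: measurable_rV_coord.
Qed.

End borel_rV.

Section measure_packing.
Context d d' (T : measurableType d) (T' : measurableType d') (R : realType).

(** The image measure is offered through its values only, so that later proofs need not carry [mf]
    inside the measure. *)
Lemma pushforward_measure (mu : {measure set T -> \bar R}) (f : T -> T') :
  measurable_fun setT f ->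
  exists nu : {measure set T' -> \bar R},
    forall A, nu A = mu (f @^-1` A).
Proof.
move=> mf.
by exists (measure_function_pushforward__canonical__measure_function_Measure mu mf).
Qed.

(** An alias of [mu] that mentions the proof [smu], so that a sigma-finite structure can be attached
    to it. *)
Definition sigma_finite_copy (mu : {measure set T -> \bar R})
  (smu : sigma_finite setT mu) : set T -> \bar R := mu.

HB.instance Definition _ mu smu := Measure.on (@sigma_finite_copy mu smu).
HB.instance Definition _ mu smu :=
  Measure_isSigmaFinite.Build d T R (@sigma_finite_copy mu smu) smu.

Lemma sigma_finite_packing (mu : {measure set T -> \bar R}) :
  sigma_finite setT mu ->
  exists nu : {sigma_finite_measure set T -> \bar R},
    forall A, nu A = mu A.
Proof. by move=> smu; exists (sigma_finite_copy smu). Qed.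

End measure_packing.

Lemma lebesgue_measure_translation (R : realType) (v : R) (A : set R) :
  measurable A -> lebesgue_measure [set x | A (x + v)] = lebesgue_measure A.
Proof.
move=> mA.
have mf : measurable_fun setT ((fun x => x + v) : measurableTypeR R -> measurableTypeR R).
  by apply: measurable_funD => //; exact: measurable_cst.
have [nu nuE] := pushforward_measure lebesgue_measure mf.
rewrite -[LHS]/(lebesgue_measure ((fun x : R => x + v) @^-1` A)) -nuE.
apply/esym/lebesgue_measure_unique => // _ [[a b]] _ <-.
rewrite nuE (_ : _ @^-1` _ = `]a - v, b - v]%classic); last first.
  by apply/seteqP; split => x /=; rewrite !in_itv /= lerBrDr ltrBlDr.
rewrite [LHS]lebesgue_measure_itv.
rewrite [RHS](lebesgue_measure_itv `]a - v, b - v]).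
rewrite /= !lte_fin ltrD2r; by case: ifPn => // _; rewrite -!EFinB; congr EFin; ring.
Qed.

Section lebesgue_rV.
Variable R : realType.

(** Half-open, so that a coordinate hyperplane cuts a box into two disjoint boxes of the same
    kind. *)
Definition vbox n (a b : 'rV[R]_n) : set 'rV[R]_n :=
  [set x | forall i, a 0 i <= x 0 i < b 0 i].

Lemma measurable_vbox n (a b : 'rV[R]_n) : measurable (vbox a b).
Proof.
rewrite (_ : vbox a b = \bigcap_(i in [set: 'I_n])
    ((fun x : 'rV[R]_n => x 0 i) @^-1` `[a 0 i, b 0 i[%classic)).
  apply: fin_bigcap_measurable => // i _.
  by rewrite -[X in measurable X]setTI; exact: measurable_coord.
apply/seteqP; split => [x Bx i _|x Bx i].
  by rewrite /= in_itv/=; exact: Bx.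
by have := Bx i I; rewrite /= in_itv/=.
Qed.

Lemma vbox_cover n :
  \bigcup_k vbox (const_mx (- k%:R)) (const_mx k%:R) = [set: 'rV[R]_n].
Proof.
apply/seteqP; split=> // x _; exists (Num.bound (\sum_i `|x 0 i|)) => // i.
have : `|x 0 i| < (Num.bound (\sum_i `|x 0 i|))%:R.
  rewrite (le_lt_trans _ (archi_boundP _)) ?sumr_ge0//.
  by rewrite (bigD1 i)//= lerDl sumr_ge0.
by rewrite !mxE ltr_norml => /andP[/ltW -> ->].
Qed.



Definition is_lebesgue n (mu : set 'rV[R]_n -> \bar R) :=
  (forall (v : 'rV[R]_n) (A : set 'rV[R]_n), measurable A ->
    mu [set x | A (x + v)] = mu A) /\
  (forall a b : 'rV[R]_n, (forall i, a 0 i <= b 0 i) ->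
    mu (vbox a b) = (\prod_i (b 0 i - a 0 i))%:E).

(** Induction on the dimension: the product of the measure on the line with the one in dimension [n]
    is carried over by [F], which prepends a coordinate. In dimension 0 the empty product forces
    mass 1 on the only point. *)
Lemma lebesgue_rV_exists n :
  exists mu : {sigma_finite_measure set 'rV[R]_n -> \bar R}, is_lebesgue mu.
Proof.
elim: n => [|n [mu [muT muB]]].
  exists (dirac (0 : 'rV[R]_0)); split=> [v A mA|a b _].
    by congr (dirac _ _); apply/seteqP; split=> x /=; rewrite (thinmx0 (x + v)) (thinmx0 x).
  by rewrite big_ord0 /= diracE mem_set// => -[].
pose T := (measurableTypeR R * 'rV[R]_n)%type.
pose F (p : T) : 'rV[R]_n.+1 :=
  \row_i oapp (fun j => p.2 0 j) (p.1 : R) (unlift ord0 i).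
have mF : measurable_fun setT F.
  apply: measurable_fun_rV => i; under eq_fun do rewrite mxE.
  case: unliftP => [j _|_] /=; last exact: measurable_fst.
  exact: (measurable_rV_coord (f := snd) j measurable_snd).
have [nu nuE] := pushforward_measure (lebesgue_measure \x mu)%E mF.
have nuB (a b : 'rV[R]_n.+1) : (forall i, a 0 i <= b 0 i) ->
    nu (vbox a b) = (\prod_i (b 0 i - a 0 i))%:E.
  move=> ab; rewrite nuE.
  pose a' := \row_j a 0 (lift ord0 j); pose b' := \row_j b 0 (lift ord0 j).
  rewrite (_ : _ @^-1` _ = `[a 0 ord0, b 0 ord0[%classic `*` vbox a' b').
    rewrite [LHS](product_measure1E lebesgue_measure mu)//; last exact: measurable_vbox.
    rewrite muB => [|j]; last by rewrite !mxE.
    rewrite [X in (X * _)%E](lebesgue_measure_itv `[a 0 ord0, b 0 ord0[).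
    rewrite /= lte_fin big_ord_recl EFinM.
    congr (_ * _)%E; last by congr EFin; apply: eq_bigr => j _; rewrite !mxE.
    by case: ltgtP (ab ord0) => // -> _; rewrite subrr.
  apply/seteqP; split => [[x v] /= H|[x v] /= [H1 H2] i].
    split; first by have := H ord0; rewrite in_itv/= mxE unlift_none.
    by move=> j; have := H (lift ord0 j); rewrite !mxE liftK.
  rewrite mxE; case: unliftP => [j ->|->] /=; last by move: H1; rewrite in_itv.
  by have := H2 j; rewrite !mxE.
have nuT (v : 'rV[R]_n.+1) A : measurable A -> nu [set x | A (x + v)] = nu A.
  move=> mA; rewrite !nuE.
  pose v' := \row_j v 0 (lift ord0 j).
  pose S (p : T) : T := ((p.1 : R) + v 0 ord0, p.2 + v').
  have mS : measurable_fun setT S.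
    apply/measurable_fun_pairP; split => /=.
      by apply: measurable_funD => //; exact: measurable_cst.
    by apply: measurable_rVD => //; exact: measurable_cst.
  have [m mE] := pushforward_measure (lebesgue_measure \x mu)%E mS.
  have mFA : measurable (F @^-1` A) by rewrite -[X in measurable X]setTI; exact: mF.
  transitivity (m (F @^-1` A)).
    rewrite mE; congr (product_measure1 _ _ _); apply/seteqP.
    have FS p : F p + v = F (S p).
      apply/rowP => i; rewrite !mxE; case: unliftP => [j ->|->] //=.
      by rewrite !mxE.
    by split => p /=; rewrite FS.
  (* The translated measure [m] has the values of the product measure on rectangles, hence equals
     it. *)
  apply/esym/product_measure_unique => // B C mB mC; rewrite mE.
  rewrite (_ : _ @^-1` _ = [set x | B (x + v 0 ord0)] `*` [set x | C (x + v')])//.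
  have mD1 : measurable [set x | B (x + v 0 ord0)].
    have mf : measurable_fun [set: R] (fun x : R => x + v 0 ord0).
      by apply: measurable_funD => //; exact: measurable_cst.
    by have := mf measurableT _ mB; rewrite setTI.
  have mD2 : measurable [set x | C (x + v')].
    have mf : measurable_fun [set: 'rV[R]_n] (fun x : 'rV[R]_n => x + v').
      by apply: measurable_rVD => //; exact: measurable_cst.
    by have := mf measurableT _ mC; rewrite setTI.
  by rewrite [LHS](product_measure1E lebesgue_measure mu)// muT//; congr (_ * _)%E; exact: lebesgue_measure_translation.
have sf : sigma_finite setT nu.
  exists (fun k => vbox (const_mx (- k%:R)) (const_mx k%:R)).
    by rewrite vbox_cover.
  move=> k; split; first exact: measurable_vbox.
  by rewrite nuB ?ltry// => i; rewrite !mxE; have := ler0n R k; lra.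
have [m mE] := sigma_finite_packing sf.
by exists m; split => [v A mA|a b ab]; rewrite !mE ?nuT ?nuB.
Qed.

Definition lebesgue_rV n : {sigma_finite_measure set 'rV[R]_n -> \bar R} :=
  projT1 (cid (lebesgue_rV_exists n)).

Lemma lebesgue_rV_translation n (v : 'rV[R]_n) (A : set 'rV[R]_n) :
  measurable A -> lebesgue_rV n [set x | A (x + v)] = lebesgue_rV n A.
Proof. exact: (projT2 (cid (lebesgue_rV_exists n))).1. Qed.

Lemma lebesgue_rV_vbox n (a b : 'rV[R]_n) : (forall i, a 0 i <= b 0 i) ->
  lebesgue_rV n (vbox a b) = (\prod_i (b 0 i - a 0 i))%:E.
Proof. exact: (projT2 (cid (lebesgue_rV_exists n))).2. Qed.

End lebesgue_rV.

Section preimages.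
Context d (T : measurableType d) (R : realType) (n : nat).

Lemma measurable_preim (f : T -> 'rV[R]_n) (A : set 'rV[R]_n) :
  measurable_fun setT f -> measurable A -> measurable [set t | A (f t)].
Proof. by move=> mf mA; have := mf measurableT _ mA; rewrite setTI. Qed.

End preimages.

(** * Uniqueness of translation-invariant measures, and linear images *)

Section haar_uniqueness.
Context (R : realType) (n : nat).
Local Notation V := 'rV[R]_n.

Definition translation_invariant (mu : set V -> \bar R) :=
  forall (v : V) (A : set V), measurable A -> mu [set x | A (x + v)] = mu A.

(** Uniqueness of Haar measure by Fubini. Integrating out [x] first, [E1] gets the left-hand side as
    its measure; in the other order, shifting [y] by [x] turns [E1] into [E2], whose measure is the
    right-hand side. *)
Lemma translation_invariant_unique (mu nu : {sigma_finite_measure set V -> \bar R}) :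
  translation_invariant mu -> translation_invariant nu ->
  forall A B : set V, measurable A -> measurable B ->
  (mu A * nu B = nu A * mu [set x | B (- x)%R])%E.
Proof.
move=> muT nuT A B mA mB.
have mf1 : measurable_fun setT (fst : V * V -> V) by exact: measurable_fst.
have mf2 : measurable_fun setT (snd : V * V -> V) by exact: measurable_snd.
pose E1 := [set p : V * V | A (p.1 + p.2)] `&` [set p | B p.2].
pose E2 := [set p : V * V | A p.2] `&` [set p | B (p.2 - p.1)].
have mE1 : measurable E1.
  apply: measurableI; apply: measurable_preim => //.
  exact: measurable_rVD.
have mE2 : measurable E2.
  apply: measurableI; apply: measurable_preim => //.
  by apply: measurable_rVD => //; exact: measurable_rVN.
have swap E : measurable E -> (mu \x nu)%E E = (mu \x^ nu)%E E.
  move=> mE; apply: product_measure_unique => // X Y mX mY.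
  exact: product_measure2E.
have mBN : measurable [set x | B (- x)%R].
  by apply: measurable_preim => //; exact/measurable_rVN/measurable_id.
transitivity ((mu \x^ nu)%E E1).
  rewrite /product_measure2.
  rewrite (eq_integral (fun y => mu A * (\1_B y)%:E)%E); last first.
    move=> y _ /=; rewrite indicE; case: (boolP (y \in B)) => yB.
      rewrite mule1 -[RHS](muT y)//; congr (mu _); apply/seteqP; split => x.
        by rewrite /ysection /= inE => -[].
      by rewrite /ysection /= inE => Axy; split => //; exact: set_mem.
    rewrite mule0 -[RHS](measure0 mu); congr (mu _).
    apply/seteqP; split => x //; rewrite /ysection /= inE => -[_ By].
    by move: yB; rewrite notin_setE.
  by rewrite ge0_integralZl ?integral_indic ?setIT//; exact: measurableT_comp.
rewrite -swap//; transitivity ((mu \x nu)%E E2).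
  apply: eq_integral => x _ /=.
  rewrite -[RHS](nuT x); last exact: measurable_xsection.
  congr (nu _); apply/seteqP; split => y; rewrite /xsection /= !inE /E1 /E2 /=.
    by rewrite addrK addrC.
  by rewrite addrK addrC.
rewrite swap// /product_measure2.
rewrite (eq_integral (fun y => (\1_A y)%:E * mu [set x | B (- x)%R])%E); last first.
  move=> y _ /=; rewrite indicE; case: (boolP (y \in A)) => yA.
    rewrite mul1e -[RHS](muT (- y))//; congr (mu _).
    apply/seteqP; split => x; rewrite /ysection /= inE /E2 /= opprB; first by case.
    by move=> Bxy; split=> //; exact: set_mem.
  rewrite mul0e -[RHS](measure0 mu); congr (mu _).
  apply/seteqP; split => x //; rewrite /ysection /= inE => -[Ay _].
  by move: yA; rewrite notin_setE.
by rewrite ge0_integralZr ?integral_indic ?setIT//; exact: measurableT_comp.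
Qed.

End haar_uniqueness.

Section linear_images.
Context (R : realType) (n : nat).
Local Notation V := 'rV[R]_n.
Local Notation lam := (lebesgue_rV R n).
Local Notation unitbox := (vbox (0 : V) (const_mx 1)).

Lemma lebesgue_rV_unitbox : lam unitbox = 1%E.
Proof.
rewrite lebesgue_rV_vbox => [|i]; last by rewrite !mxE.
by rewrite big1// => i _; rewrite !mxE subr0.
Qed.

Lemma lebesgue_rV_unique (mu : {sigma_finite_measure set V -> \bar R}) :
  translation_invariant mu ->
  forall A : set V, measurable A -> mu A = (mu unitbox * lam A)%E.
Proof.
move=> muT A mA; set Q := unitbox.
have lamT : translation_invariant lam by move=> v B; exact: lebesgue_rV_translation.
have mQ : measurable Q by exact: measurable_vbox.
have mQN : measurable [set x | Q (- x)%R].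
  by apply: measurable_preim => //; exact/measurable_rVN/measurable_id.
have lamQN : lam [set x | Q (- x)%R] = 1%E.
  have := translation_invariant_unique lamT lamT mQ mQ.
  by rewrite lebesgue_rV_unitbox !mul1e.
have muQN : mu [set x | Q (- x)%R] = mu Q.
  have := translation_invariant_unique lamT muT mQ mQ.
  rewrite lebesgue_rV_unitbox mul1e lamQN mule1 => _.
  have := translation_invariant_unique muT lamT mQ mQ.
  by rewrite lebesgue_rV_unitbox mul1e mule1.
have := translation_invariant_unique muT lamT mA mQ.
by rewrite lebesgue_rV_unitbox mule1 muQN => ->; rewrite muleC.
Qed.

(** [g] carries an exhaustion by sets of finite measure to the target, and [cancel f g] makes its
    pullback along [f] the original one. *)
Lemma sigma_finite_pushforward (f g : V -> V) : measurable_fun setT f ->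
  measurable_fun setT g -> cancel f g ->
  exists mu : {sigma_finite_measure set V -> \bar R},
    forall A : set V, mu A = lam [set x | A (f x)].
Proof.
move=> mf mg fg; have [nu nuE] := pushforward_measure lam mf.
have sf : sigma_finite setT nu.
  have [F FT Ffin] := sigma_finiteT lam.
  exists (fun k => [set y | F k (g y)]).
    apply/seteqP; split=> // y _; have : setT (g y) by [].
    by rewrite FT => -[k _ Fk]; exists k.
  move=> k; have [mFk Fk] := Ffin k; split; first exact: measurable_preim.
  rewrite nuE (_ : _ @^-1` _ = F k)//.
  by apply/seteqP; split => x /=; rewrite fg.
by have [m mE] := sigma_finite_packing sf; exists m => A; rewrite mE nuE.
Qed.

(** The left-hand side is a translation-invariant measure of [A]. Its factor is left as the measure
    of a parallelepiped, and is evaluated later for diagonal matrices through a box and for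
    orthogonal ones through the unit ball. *)
Lemma lebesgue_rV_linear (M N : 'M[R]_n) (A : set V) : M *m N = 1%:M ->
  measurable A ->
  lam [set x | A (x *m M)] = (lam [set x | unitbox (x *m M)] * lam A)%E.
Proof.
move=> MN mA.
have mM P : measurable_fun setT (fun x : V => x *m P).
  by apply: measurable_rV_mulmx; exact: measurable_id.
have [mu muE] : exists mu : {sigma_finite_measure set V -> \bar R},
    forall A : set V, mu A = lam [set x | A (x *m M)].
  apply: (@sigma_finite_pushforward _ (fun x => x *m N)) => //.
  by move=> x; rewrite -mulmxA MN mulmx1.
rewrite -!muE; apply: lebesgue_rV_unique => // v B mB; rewrite !muE.
rewrite -[RHS](lebesgue_rV_translation (v *m N)); last exact: measurable_preim.
congr (lam _); apply/seteqP; split => x /=; rewrite mulmxDl -(mulmxA v);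
  by rewrite (mulmx1C MN) mulmx1.
Qed.

Lemma lebesgue_rV_diag (d : 'rV[R]_n) (A : set V) : (forall i, 0 < d 0 i) ->
  measurable A ->
  lam [set x | A (x *m diag_mx d)] = ((\prod_i (d 0 i)^-1)%:E * lam A)%E.
Proof.
move=> d0 mA.
have dV : diag_mx d *m diag_mx (map_mx GRing.inv d) = 1%:M.
  rewrite mulmx_diag; apply/matrixP => i j; rewrite !mxE.
  by rewrite divff// gt_eqF.
rewrite (lebesgue_rV_linear dV)//; congr (_ * _)%E.
rewrite (_ : [set x | _] = vbox 0 (map_mx GRing.inv d)).
  rewrite lebesgue_rV_vbox => [|i]; last by rewrite !mxE invr_ge0 ltW.
  by congr EFin; apply: eq_bigr => i _; rewrite !mxE subr0.
apply/seteqP; split => x /= H i; have := H i; rewrite mul_mx_diag !mxE.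
  by rewrite pmulr_lge0// -ltr_pdivlMr// div1r.
by rewrite pmulr_lge0// -ltr_pdivlMr// div1r.
Qed.

Lemma lebesgue_rV_scale (t : R) (A : set V) : 0 < t -> measurable A ->
  lam [set x | A (t *: x)] = ((t ^- n)%R%:E * lam A)%E.
Proof.
move=> t0 mA.
have -> : [set x : V | A (t *: x)] = [set x | A (x *m diag_mx (const_mx t))].
  by apply/seteqP; split => x /=; rewrite diag_const_mx mul_mx_scalar.
rewrite lebesgue_rV_diag => [|i|]; rewrite ?mxE//.
by under eq_bigr do rewrite mxE; rewrite prodr_const card_ord exprVn.
Qed.

End linear_images.

(** * Euclidean structure *)

(** Change of variables for a map that multiplies the measure of preimages by a constant; dilations,
    orthogonal maps, concatenation of rows and the radial projection to the sphere are all handled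
    by it. *)
Lemma ge0_integral_scaled_pushforward d1 d2 (T1 : measurableType d1)
    (T2 : measurableType d2) (R : realType) (mu1 : {measure set T1 -> \bar R})
    (mu2 : {measure set T2 -> \bar R}) (g : T1 -> T2) (c : R) :
  measurable_fun setT g -> 0 <= c ->
  (forall A, measurable A -> mu1 (g @^-1` A) = (c%:E * mu2 A)%E) ->
  forall f : T2 -> \bar R, measurable_fun setT f -> (forall x, 0 <= f x)%E ->
  (\int[mu1]_x f (g x) = c%:E * \int[mu2]_x f x)%E.
Proof.
move=> mg c0 muE f mf f0.
transitivity (\int[pushforward mu1 g]_x f x)%E.
  by rewrite (ge0_integral_pushforward mg)//= preimage_setT.
rewrite -[c]/((NngNum c0)%:num) -ge0_integral_mscale//.
by apply: eq_measure_integral => A mA _; exact: muE.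
Qed.

Section euclid.
Context (R : realType).
Implicit Types n : nat.

Lemma dotvE n (x y : 'rV[R]_n) : dotv x y = (x *m y^T) 0 0.
Proof. by rewrite mxE; apply: eq_bigr => i _; rewrite mxE. Qed.

Lemma dotvC n (x y : 'rV[R]_n) : dotv x y = dotv y x.
Proof. by apply: eq_bigr => i _; rewrite mulrC. Qed.

Lemma dotvDl n (x y z : 'rV[R]_n) : dotv (x + y) z = dotv x z + dotv y z.
Proof. by rewrite !dotvE mulmxDl mxE. Qed.

Lemma dotvZl n t (x y : 'rV[R]_n) : dotv (t *: x) y = t * dotv x y.
Proof. by rewrite !dotvE -scalemxAl mxE. Qed.

Lemma dotvNl n (x y : 'rV[R]_n) : dotv (- x) y = - dotv x y.
Proof. by rewrite -scaleN1r dotvZl mulN1r. Qed.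

Lemma dotvDr n (x y z : 'rV[R]_n) : dotv x (y + z) = dotv x y + dotv x z.
Proof. by rewrite dotvC dotvDl !(dotvC x). Qed.

Lemma dotvZr n t (x y : 'rV[R]_n) : dotv x (t *: y) = t * dotv x y.
Proof. by rewrite dotvC dotvZl dotvC. Qed.

Lemma dotvNr n (x y : 'rV[R]_n) : dotv x (- y) = - dotv x y.
Proof. by rewrite dotvC dotvNl dotvC. Qed.

Lemma dotv0l n (x : 'rV[R]_n) : dotv 0 x = 0.
Proof. by rewrite -(scale0r (0 : 'rV[R]_n)) dotvZl mul0r. Qed.

Lemma dotv_ge0 n (x : 'rV[R]_n) : 0 <= dotv x x.
Proof. by apply: sumr_ge0 => i _; rewrite -expr2 sqr_ge0. Qed.

Lemma dotv_eq0 n (x : 'rV[R]_n) : (dotv x x == 0) = (x == 0).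
Proof.
apply/eqP/eqP => [x0|->]; last by rewrite dotv0l.
apply/rowP => i; rewrite mxE; apply/eqP; rewrite -sqrf_eq0 expr2.
have := psumr_eq0P (fun i _ => sqr_ge0 (x 0 i)) x0.
by move=> /(_ i isT); rewrite expr2 => ->.
Qed.

Lemma enorm_ge0 n (x : 'rV[R]_n) : 0 <= enorm x.
Proof. exact: sqrtr_ge0. Qed.

Lemma sqr_enorm n (x : 'rV[R]_n) : enorm x ^+ 2 = dotv x x.
Proof. by rewrite sqr_sqrtr// dotv_ge0. Qed.

Lemma enorm_eq0 n (x : 'rV[R]_n) : (enorm x == 0) = (x == 0).
Proof. by rewrite -sqrf_eq0 sqr_enorm dotv_eq0. Qed.

Lemma enorm0 n : enorm (0 : 'rV[R]_n) = 0.
Proof. by apply/eqP; rewrite enorm_eq0. Qed.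

Lemma enorm_gt0 n (x : 'rV[R]_n) : (0 < enorm x) = (x != 0).
Proof. by rewrite lt_def enorm_eq0 enorm_ge0 andbT. Qed.

Lemma enormZ n t (x : 'rV[R]_n) : enorm (t *: x) = `|t| * enorm x.
Proof.
by rewrite /enorm dotvZl dotvZr mulrA -expr2 sqrtrM ?sqr_ge0// sqrtr_sqr.
Qed.

Lemma enormN n (x : 'rV[R]_n) : enorm (- x) = enorm x.
Proof. by rewrite -scaleN1r enormZ normrN1 mul1r. Qed.

Lemma dotv_le_enorm n (x y : 'rV[R]_n) : dotv x y <= enorm x * enorm y.
Proof.
have [->|y0] := eqVneq y 0; first by rewrite dotvC dotv0l enorm0 mulr0.
have yy0 : 0 < dotv y y by rewrite lt_def dotv_eq0 y0 dotv_ge0.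
apply: (le_trans (ler_norm _)); rewrite -(@ler_pXn2r _ 2)// ?nnegrE//; last first.
  by rewrite mulr_ge0 ?enorm_ge0.
rewrite exprMn !sqr_enorm real_normK ?num_real//.
(* The square norm of this vector is [dotv y y] times the Gram determinant of [x] and [y]. *)
have := dotv_ge0 (dotv y y *: x - dotv x y *: y).
rewrite !(dotvDl, dotvDr, dotvNl, dotvNr, dotvZl, dotvZr) (dotvC y x) => H.
rewrite -subr_ge0 -(pmulr_rge0 _ yy0); apply: le_trans H _.
by rewrite le_eqVlt; apply/orP; left; apply/eqP; ring.
Qed.

Lemma enormD n (x y : 'rV[R]_n) : enorm (x + y) <= enorm x + enorm y.
Proof.
rewrite -(@ler_pXn2r _ 2)// ?nnegrE ?addr_ge0 ?enorm_ge0//.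
rewrite sqrrD !sqr_enorm !(dotvDl, dotvDr) (dotvC y x).
by have := dotv_le_enorm x y; lra.
Qed.

Lemma ler_norm_coord n (x : 'rV[R]_n) i : `|x 0 i| <= enorm x.
Proof.
rewrite -(@ler_pXn2r _ 2)// ?nnegrE ?enorm_ge0// sqr_enorm real_normK ?num_real//.
rewrite /dotv (bigD1 i)//= -expr2 lerDl.
by apply: sumr_ge0 => j _; rewrite -expr2 sqr_ge0.
Qed.

Lemma enorm_le_sum n (x : 'rV[R]_n) : enorm x <= \sum_i `|x 0 i|.
Proof.
rewrite -(@ler_pXn2r _ 2)// ?nnegrE ?enorm_ge0 ?sumr_ge0// sqr_enorm.
rewrite expr2 mulr_suml; apply: ler_sum => i _.
rewrite (le_trans (ler_norm _))// normrM ler_wpM2l// (bigD1 i)//= lerDl.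
exact: sumr_ge0.
Qed.

Lemma ler_norm_enorm n (x : 'rV[R]_n) : `|x| <= enorm x.
Proof.
rewrite /Num.Def.normr /= mx_normrE; apply: bigmax_le; first exact: enorm_ge0.
by move=> [i j] _ /=; rewrite (ord1 i) ler_norm_coord.
Qed.

Lemma ler_coord_norm n (x : 'rV[R]_n) i : `|x 0 i| <= `|x|.
Proof.
rewrite [leRHS]/Num.Def.normr /= mx_normrE.
by apply: (le_bigmax _ (fun ij : 'I_1 * 'I_n => `|x ij.1 ij.2|) (0, i)).
Qed.

Lemma enorm_le_norm n (x : 'rV[R]_n) : enorm x <= n%:R * `|x|.
Proof.
rewrite (le_trans (enorm_le_sum x))// mulr_natl.
apply: (le_trans (ler_sum _ (fun i _ => ler_coord_norm x i))).
by rewrite sumr_const card_ord.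
Qed.

Lemma enorm_mulmx m n (x : 'rV[R]_m) (O : 'M[R]_(m, n)) : O *m O^T = 1%:M ->
  enorm (x *m O) = enorm x.
Proof.
by move=> OO; rewrite /enorm !dotvE trmx_mul mulmxA -(mulmxA x) OO mulmx1.
Qed.

Lemma continuous_dotv_diag n : continuous (fun x : 'rV[R]_n => dotv x x).
Proof.
apply: (continuous_big (op := +%R)); first exact: add_continuous.
by move=> i _ x; apply: continuousM; exact: coord_continuous.
Qed.

Lemma continuous_enorm n : continuous (@enorm R n).
Proof.
move=> x; apply: (@continuous_comp _ _ _ (fun x : 'rV[R]_n => dotv x x) Num.sqrt).
  exact: continuous_dotv_diag.
exact: sqrt_continuous.
Qed.

Lemma continuous_measurable_rV n (f : 'rV[R]_n -> R) :
  continuous f -> measurable_fun setT f.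
Proof.
move=> cf; apply: (measurability _ (measurable_realfun.RGenOpens.measurableE R)).
move=> _ [_ [a [b ->]] <-]; rewrite setTI; apply: open_measurable_rV.
by apply: open_comp; [move=> x _; exact: cf|exact: interval_open].
Qed.

Lemma measurable_enorm n : measurable_fun setT (@enorm R n).
Proof. by apply: continuous_measurable_rV => x; exact: continuous_enorm. Qed.

End euclid.

Section lebesgue_isometry.
Context (R : realType).

Definition eball n (x : 'rV[R]_n) r : set 'rV[R]_n := [set y | enorm (y - x) < r].

Lemma open_eball n (x : 'rV[R]_n) r : open (eball x r).
Proof.
rewrite (_ : eball x r = (fun y => enorm (y - x)) @^-1` `]-oo, r[%classic).
  apply: open_comp; last exact: interval_open.
  move=> y _; apply: continuous_comp; last exact: continuous_enorm.
  by apply: continuousB; [exact: cvg_id|exact: cst_continuous].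
by apply/seteqP; split => y; rewrite /eball /= in_itv.
Qed.

Lemma measurable_eball n (x : 'rV[R]_n) r : measurable (eball x r).
Proof. by apply: open_measurable_rV; exact: open_eball. Qed.

Lemma lebesgue_rV_open_gt0 n (U : set 'rV[R]_n) (x : 'rV[R]_n) :
  open U -> U x -> (0 < lebesgue_rV R n U)%E.
Proof.
move=> oU Ux; have /nbhs_ballP[e /= e0 eU] : nbhs x U by exact: open_nbhs_nbhs.
apply: (@lt_le_trans _ _ (lebesgue_rV R n (vbox x (x + const_mx (e / 2))))).
  rewrite lebesgue_rV_vbox => [|i]; last by rewrite !mxE; lra.
  by rewrite lte_fin; apply: prodr_gt0 => i _; rewrite !mxE; lra.
apply: le_measure; rewrite ?inE; [exact: measurable_vbox|exact: open_measurable_rV|].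
move=> y xy; apply: eU; split=> // i j; rewrite (ord1 i) -ball_normE /=.
by have := xy j; rewrite mxE [X in _ + X]mxE ltr_distlC; lra.
Qed.

Lemma lebesgue_rV_bounded n (A : set 'rV[R]_n) r : measurable A ->
  (forall x i, A x -> `|x 0 i| <= r) -> (lebesgue_rV R n A < +oo)%E.
Proof.
move=> mA Ar; have [->|/set0P[x0 Ax0]] := eqVneq A set0; first by rewrite measure0 ltry.
pose b : 'rV[R]_n := const_mx (`|r| + 1).
apply: (@le_lt_trans _ _ (lebesgue_rV R n (vbox (- b) b))).
  apply: le_measure; rewrite ?inE//; first exact: measurable_vbox.
  move=> x Ax i; have := Ar x i Ax; rewrite !mxE ler_norml => /andP[? ?].
  by have := ler_norm r; lra.
rewrite lebesgue_rV_vbox ?ltry// => i; rewrite !mxE.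
by have := normr_ge0 r; lra.
Qed.

Lemma lebesgue_rV_eball n (x : 'rV[R]_n) r : 0 < r ->
  (0 < lebesgue_rV R n (eball x r) < +oo)%E.
Proof.
move=> r0; apply/andP; split.
  apply: (lebesgue_rV_open_gt0 (x := x)); first exact: open_eball.
  by rewrite /eball /= subrr enorm0.
apply: (@lebesgue_rV_bounded _ _ (r + enorm x)) => [|y i]; first exact: measurable_eball.
rewrite /eball /= => yx; apply: (le_trans (ler_norm_coord y i)).
by have := enormD (y - x) x; rewrite subrK; lra.
Qed.

(* Orthogonal matrices preserve the Euclidean unit ball, so the factor given by
   uniqueness is 1. *)
Lemma lebesgue_rV_orthogonal n (O : 'M[R]_n) (A : set 'rV[R]_n) :
  O *m O^T = 1%:M -> measurable A ->
  lebesgue_rV R n [set x | A (x *m O)] = lebesgue_rV R n A.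
Proof.
move=> OO mA; rewrite (lebesgue_rV_linear OO mA).
have := lebesgue_rV_linear OO (measurable_eball 0 1).
rewrite (_ : [set x | eball 0 1 _] = eball 0 1); last first.
  by apply/seteqP; split => x; rewrite /eball /= !subr0 enorm_mulmx.
have /andP[] := @lebesgue_rV_eball n 0 1 ltr01.
case: (lebesgue_rV R n (eball 0 1)) => // b; rewrite lte_fin => b0 _.
set c := lebesgue_rV R n _; have : (0 <= c)%E by exact: measure_ge0.
case: c => [c| |] // c0.
  rewrite -EFinM => -[] /eqP; rewrite -subr_eq0 -[X in X - _]mul1r -mulrBl.
  by rewrite mulf_eq0 (gt_eqF b0) orbF subr_eq0 => /eqP <-; rewrite mul1e.
by rewrite gt0_mulye.
Qed.

(** The image of the product measure under concatenation is translation invariant and gives mass 1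
    to the unit box, which identifies it. *)
Lemma lebesgue_rV_split k l (A : set 'rV[R]_(k + l)) : measurable A ->
  (lebesgue_rV R k \x lebesgue_rV R l)%E [set p | A (row_mx p.1 p.2)] =
  lebesgue_rV R (k + l) A.
Proof.
move=> mA.
pose F (p : 'rV[R]_k * 'rV[R]_l) := row_mx p.1 p.2.
have mF : measurable_fun setT F.
  by apply: measurable_row_mx; [exact: measurable_fst|exact: measurable_snd].
pose mu := (lebesgue_rV R k \x lebesgue_rV R l)%E.
have [nu nuE] := pushforward_measure mu mF.
have nuB (a b : 'rV[R]_(k + l)) : (forall i, a 0 i <= b 0 i) ->
    nu (vbox a b) = (\prod_i (b 0 i - a 0 i))%:E.
  move=> ab; rewrite nuE.
  rewrite (_ : _ @^-1` _ = vbox (lsubmx a) (lsubmx b) `*` vbox (rsubmx a) (rsubmx b)).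
    rewrite [LHS](product_measure1E (lebesgue_rV R k) (lebesgue_rV R l));
      try exact: measurable_vbox.
    rewrite [X in (X * _)%E]lebesgue_rV_vbox => [|i]; last by rewrite !mxE.
    rewrite [X in (_ * X)%E]lebesgue_rV_vbox => [|i]; last by rewrite !mxE.
    rewrite -EFinM big_split_ord /=; congr (_ * _)%:E;
      by apply: eq_bigr => i _; rewrite !mxE.
  apply/seteqP; split => [[y z] /= H|[y z] /= [H1 H2] i].
    split=> i /=; [have := H (lshift l i)|have := H (rshift k i)];
      by rewrite /F /= ?row_mxEl ?row_mxEr !mxE.
  rewrite /F /= mxE; case: split_ordP => j ->.
    by have := H1 j; rewrite !mxE.
  by have := H2 j; rewrite !mxE.
have sf : sigma_finite setT nu.
  exists (fun j => vbox (const_mx (- j%:R)) (const_mx j%:R)).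
    by rewrite vbox_cover.
  move=> j; split; first exact: measurable_vbox.
  by rewrite nuB ?ltry// => i; rewrite !mxE; have := ler0n R j; lra.
have [m mE] := sigma_finite_packing sf.
transitivity (m A); first by rewrite mE nuE.
rewrite (lebesgue_rV_unique (mu := m))//.
  rewrite mE nuB => [|i]; last by rewrite !mxE.
  by rewrite big1 ?mul1e// => i _; rewrite !mxE subr0.
move=> v B mB; rewrite !mE !nuE.
pose S (p : 'rV[R]_k * 'rV[R]_l) := (p.1 + lsubmx v, p.2 + rsubmx v).
have mS : measurable_fun setT S.
  apply/measurable_fun_pairP; split => /=;
    by apply: measurable_rVD => //; exact: measurable_cst.
have [m' m'E] := pushforward_measure mu mS.
transitivity (m' (F @^-1` B)).
  rewrite m'E; congr (mu _); apply/seteqP.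
  have FS p : F p + v = F (S p) by rewrite /F /S /= -add_row_mx hsubmxK.
  by split => p /=; rewrite FS.
apply/esym/product_measure_unique; last by rewrite -[X in measurable X]setTI; exact: mF.
move=> C D mC mD; rewrite m'E.
rewrite (_ : _ @^-1` _ = [set x | C (x + lsubmx v)] `*` [set x | D (x + rsubmx v)])//.
rewrite [LHS](product_measure1E (lebesgue_rV R k) (lebesgue_rV R l)).
- by congr (_ * _)%E; exact: lebesgue_rV_translation.
- by apply: measurable_preim => //; apply: measurable_rVD => //; exact: measurable_cst.
- by apply: measurable_preim => //; apply: measurable_rVD => //; exact: measurable_cst.
Qed.

End lebesgue_isometry.

(** * Polar coordinates *)

Section powR_integrals.
Context (R : realType).
Local Notation mu := (@lebesgue_measure R).

Lemma continuous_powR (s x : R) : 0 < x -> {for x, continuous (@powR R ^~ s)}.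
Proof.
move=> x0; apply/differentiable_continuous/derivable1_diffP/derivable_powR.
by rewrite in_itv/= x0.
Qed.

Lemma cvg_powR_right0 (s : R) : 0 <= s -> x `^ s @[x --> 0^'+] --> 0 `^ s.
Proof.
rewrite le_eqVlt => /predU1P[<-|s0].
  rewrite powRr0; under eq_cvg do rewrite powRr0; exact: cvg_cst.
by rewrite powR0 ?gt_eqF//; exact: powR_cvg0.
Qed.

Lemma is_deriveZ_powR (k s x : R) : 0 < x ->
  is_derive x 1 (fun t => k * t `^ s) (k * (s * x `^ (s - 1))).
Proof.
move=> x0; have := is_derive1_powR s x0 => H.
exact: (is_deriveZ k).
Qed.

(** With [c] the value of a gauge at [x], this is the integral of [cutpow] against [dt / t] along
    the ray through [x]; the point is that it does not depend on [c]. *)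
Lemma integral_powR_near0 (c s : R) : 0 < c -> 1 <= s ->
  (\int[mu]_(t in `]0%R, c^-1%R[) (c `^ s * (s * t `^ (s - 1)))%R%:E = 1)%E.
Proof.
move=> c0 s1; have s0 : 0 < s by lra.
have ci0 : 0 < c^-1 by rewrite invr_gt0.
pose F t := c `^ s * t `^ s.
have mf : measurable_fun setT (fun t : R => c `^ s * (s * t `^ (s - 1))).
  by do 2 apply: measurable_funM => //; exact: measurable_powR.
have mfo : measurable_fun `]0, c^-1[ (EFin \o (fun t : R => c `^ s * (s * t `^ (s - 1)))).
  by apply: measurable_funTS; exact/measurable_EFinP.
rewrite -(integral_itv_bndoo true false mfo).
have dF (x : R) : 0 < x -> is_derive x 1 F (c `^ s * (s * x `^ (s - 1))).
  exact: is_deriveZ_powR.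
rewrite (@continuous_FTC2 _ _ F)//.
- by rewrite /F powR0 ?gt_eqF// mulr0 -powRM ?ltW// divff ?gt_eqF// powR1 sube0.
- apply/continuous_within_itvP => //; split.
  + move=> x; rewrite in_itv/= => /andP[x0 _].
    apply: cvgMr; apply: cvgMr; exact: continuous_powR.
  + by apply: cvgMr; apply: cvgMr; apply: cvg_powR_right0; lra.
  + by apply: cvgMr; apply: cvgMr; apply: cvg_at_left_filter; exact: continuous_powR.
- split.
  + by move=> x; rewrite in_itv/= => /andP[x0 _]; have [] := dF x x0.
  + by apply: cvgMr; apply: cvg_powR_right0; lra.
  + by apply: cvgMr; apply: cvg_at_left_filter; exact: continuous_powR.
- move=> x; rewrite in_itv/= => /andP[x0 _].
  by rewrite derive1E; have [_ ->] := dF x x0.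
Qed.

Lemma cvg_powRN_y (s : R) : 0 < s -> t `^ (- s) @[t --> +oo] --> 0.
Proof.
move=> s0.
apply: (@cvg_trans _ ((t^-1 `^ s) @[t --> +oo])).
  apply: near_eq_cvg; near=> t; have t0 : 0 < t by near: t; exact: nbhs_pinfty_gt.
  by rewrite powRN -powR_inv1 ?ltW// -powRrM mulN1r powRN.
have h0 : t^-1 @[t --> +oo] --> (0 : R).
  by apply/gtr0_cvgV0 => //; near=> t; near: t; exact: nbhs_pinfty_gt.
have h : t^-1 @[t --> +oo] --> (0 : R)^'+.
  move=> A /h0 A0; change (\forall t \near +oo, A t^-1); near=> t.
  suff : 0 < t^-1 -> A t^-1.
    by apply; rewrite invr_gt0; near: t; exact: nbhs_pinfty_gt.
  by near: t.
exact: (cvg_comp _ _ h (powR_cvg0 s0)).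
Unshelve. all: by end_near. Qed.

Lemma integral_powR_neary (c s : R) : 0 < c -> 1 <= s ->
  (\int[mu]_(t in `]c, +oo[) (c `^ s * (s * t `^ (- s - 1)))%R%:E = 1)%E.
Proof.
move=> c0 s1; have s0 : 0 < s by lra.
pose F t := - c `^ s * t `^ (- s).
have mf : measurable_fun setT (fun t : R => c `^ s * (s * t `^ (- s - 1))).
  by do 2 apply: measurable_funM => //; exact: measurable_powR.
rewrite integral_itv_obnd_cbnd; last first.
  by apply: measurable_funTS; exact/measurable_EFinP.
have dF (x : R) : 0 < x -> is_derive x 1 F (c `^ s * (s * x `^ (- s - 1))).
  move=> x0; have := is_deriveZ_powR (- c `^ s) (- s) x0.
  by rewrite !mulNr mulrN opprK.
rewrite (@ge0_continuous_FTC2y _ _ F _ 0)//.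
- by rewrite -EFinB sub0r /F mulNr opprK -powRD ?subrr ?powRr0// (gt_eqF c0) implybT.
- by move=> x cx; rewrite !mulr_ge0 ?powR_ge0// ltW.
- apply/continuous_within_itvcyP; split.
  + move=> x; rewrite in_itv/= andbT => cx.
    by apply: cvgMr; apply: cvgMr; apply: continuous_powR; lra.
  + by apply: cvgMr; apply: cvgMr; apply: cvg_at_right_filter; exact: continuous_powR.
- by rewrite -[X in _ --> X](mulr0 (- c `^ s)); apply: cvgMr; exact: cvg_powRN_y.
- by move=> x cx; have [] := dF x (lt_trans c0 cx).
- by apply: cvgMr; apply: cvg_at_right_filter; exact: continuous_powR.
- move=> x; rewrite in_itv/= andbT => cx; have x0 : 0 < x := lt_trans c0 cx.
  by rewrite derive1E; have [_ ->] := dF x x0.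
Qed.

End powR_integrals.

Section polar.
Context (R : realType) (d : nat).
Local Notation V := 'rV[R]_d.
Local Notation lam := (lebesgue_rV R d).
Local Notation leb := (@lebesgue_measure R).
Implicit Types (N : V -> R) (s : R).

(** What [polar_exchange] uses of a gauge. The instances are the Euclidean norm, the gauge of a body
    and, as [partial_min], the gauge of a projection. *)
Definition gauge_like N := [/\ measurable_fun setT N,
  forall t x, 0 < t -> N (t *: x) = t * N x,
  forall x, x != 0 -> 0 < N x & N 0 = 0].

(** Normalized so that its integral against [dt / t] along every ray from the origin is 1, for every
    gauge and every exponent [s >= 1]. *)
Definition cutpow N s (x : V) : R := if N x < 1 then s * N x `^ s else 0.

Lemma gauge_like_ge0 N x : gauge_like N -> 0 <= N x.
Proof.
by move=> [_ _ N0 NN]; have [->|/N0/ltW//] := eqVneq x 0; rewrite NN.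
Qed.

Lemma cutpow_ge0 N s x : 0 <= s -> 0 <= cutpow N s x.
Proof.
by move=> s0; rewrite /cutpow; case: ifP => // _; rewrite mulr_ge0// powR_ge0.
Qed.

Lemma cutpow0 N s : gauge_like N -> s != 0 -> cutpow N s 0 = 0.
Proof. by move=> [_ _ _ NN] s0; rewrite /cutpow NN powR0// mulr0 if_same. Qed.

Lemma measurable_cutpow d' (T : measurableType d') (f : T -> V) N s :
  measurable_fun setT N -> measurable_fun setT f ->
  measurable_fun setT (fun t => cutpow N s (f t)).
Proof.
move=> mN mf; have mNf : measurable_fun setT (fun t => N (f t)) by exact: measurableT_comp.
apply: measurable_fun_ifT.
- by apply: measurable_fun_ltr => //; exact: measurable_cst.
- apply: measurable_funM; first exact: measurable_cst.
  exact: (measurableT_comp (measurable_powR s) mNf).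
- exact: measurable_cst.
Qed.

Lemma integral_cutpow_near0 N s x : gauge_like N -> 1 <= s -> x != 0 ->
  (\int[leb]_t (if (0 < t)%R then cutpow N s (t *: x) * t^-1 else 0)%R%:E = 1)%E.
Proof.
move=> [_ NZ N0 NN] s1 x0.
rewrite -(integral_powR_near0 (N0 _ x0) s1) [RHS]integral_mkcond.
apply: eq_integral => t _; rewrite patchE mem_setE in_itv /=.
case: (boolP (0 < t)) => //= t0.
rewrite /cutpow NZ// -ltr_pdivlMr ?N0// div1r; case: ifP => [_|_]; last by rewrite mul0r.
congr EFin; rewrite powRM ?(ltW t0)//; last exact/ltW/N0.
by rewrite -(mulr_powRB1 (ltW t0)) ?(lt_le_trans ltr01)//; field; rewrite gt_eqF.
Qed.

(** The ray integral read through [t -> 1 / t], as it occurs in [polar_exchange] once a dilation has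
    moved the factor [t] from the argument of one gauge to that of the other. *)
Lemma integral_cutpow_neary N s x : gauge_like N -> 1 <= s -> x != 0 ->
  (\int[leb]_t (if (0 < t)%R then cutpow N s (t^-1 *: x) * t^-1 else 0)%R%:E = 1)%E.
Proof.
move=> [_ NZ N0 NN] s1 x0.
rewrite -(integral_powR_neary (N0 _ x0) s1) [RHS]integral_mkcond.
apply: eq_integral => t _; rewrite patchE mem_setE in_itv /= andbT.
case: ifPn => [t0|]; last first.
  by rewrite -leNgt => t0; rewrite ifF//; apply/negbTE; rewrite -leNgt (le_trans t0)// ltW// N0.
rewrite /cutpow NZ ?invr_gt0// ltr_pdivrMl// mulr1.
case: ifP => // _; last by rewrite mul0r.
congr EFin; rewrite powRM ?invr_ge0 ?(ltW t0)//; last exact/ltW/N0.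
rewrite -(powR_inv1 (ltW t0)) -powRrM mulN1r.
rewrite powRD; last by rewrite (gt_eqF t0) implybT.
ring.
Qed.

(* Both sides equal the integral of [f x * cutpow N1 s1 x * cutpow N2 s2 (t x)]
   against [dx dt/t]: the [t]-integral of a [cutpow] along a ray is 1, and
   [f x dx] is invariant under dilations. *)
Lemma polar_exchange (f : V -> \bar R) N1 N2 s1 s2 :
  gauge_like N1 -> gauge_like N2 -> 1 <= s1 -> 1 <= s2 ->
  measurable_fun setT f -> (forall x, 0 <= f x)%E ->
  (forall t x, 0 < t -> f (t *: x) = ((t ^- d)%:E * f x)%E) ->
  (\int[lam]_x (f x * (cutpow N1 s1 x)%:E) = \int[lam]_x (f x * (cutpow N2 s2 x)%:E))%E.
Proof.
move=> G1 G2 s11 s21 mf f0 fZ; have [mN1 _ _ _] := G1; have [mN2 _ _ _] := G2.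
have s10 : 0 <= s1 by lra.
have s20 : 0 <= s2 by lra.
have s1n : s1 != 0 by rewrite gt_eqF//; lra.
have s2n : s2 != 0 by rewrite gt_eqF//; lra.
pose T := (V * measurableTypeR R)%type.
have mx : measurable_fun setT (fst : T -> V) by exact: measurable_fst.
have mt : measurable_fun setT (snd : T -> R) by exact: measurable_snd.
(* The inverse of [t] is written as a power because powers are known to be measurable; only [t > 0]
   matters, where the two agree. *)
have mtV : measurable_fun setT (fun p : T => (p.2 : R) `^ (- 1)).
  exact: (measurableT_comp (measurable_powR (- 1)) mt).
have mpos : measurable_fun setT (fun p : T => 0 < (p.2 : R)).
  by apply: measurable_fun_ltr => //; exact: measurable_cst.
pose P (p : T) : \bar R := (f p.1 * (cutpow N1 s1 p.1)%:E *
  (if 0 < (p.2 : R) then cutpow N2 s2 ((p.2 : R) *: p.1) * (p.2 : R) `^ (- 1) else 0)%R%:E)%E.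
pose Q (p : T) : \bar R := (f p.1 * (cutpow N2 s2 p.1)%:E *
  (if 0 < (p.2 : R) then cutpow N1 s1 ((p.2 : R) `^ (- 1) *: p.1) * (p.2 : R) `^ (- 1) else 0)%R%:E)%E.
have mP : measurable_fun setT P.
  apply: emeasurable_funM; first apply: emeasurable_funM.
  - exact: measurableT_comp mx.
  - by apply/measurable_EFinP; exact: measurable_cutpow.
  - apply/measurable_EFinP; apply: measurable_fun_ifT => //.
    apply: measurable_funM => //; apply: measurable_cutpow => //.
    exact: measurable_rVZ.
have mQ : measurable_fun setT Q.
  apply: emeasurable_funM; first apply: emeasurable_funM.
  - exact: measurableT_comp mx.
  - by apply/measurable_EFinP; exact: measurable_cutpow.
  - apply/measurable_EFinP; apply: measurable_fun_ifT => //.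
    apply: measurable_funM => //; apply: measurable_cutpow => //.
    exact: measurable_rVZ.
have P0 p : (0 <= P p)%E.
  rewrite /P !mule_ge0// lee_fin ?cutpow_ge0//.
  by case: ifP => // _; rewrite mulr_ge0 ?powR_ge0 ?cutpow_ge0.
have Q0 p : (0 <= Q p)%E.
  rewrite /Q !mule_ge0// lee_fin ?cutpow_ge0//.
  by case: ifP => // _; rewrite mulr_ge0 ?powR_ge0 ?cutpow_ge0.
have inv1 (t : R) : 0 < t -> t `^ (- 1) = t^-1 by move=> t0; rewrite powR_inv1// ltW.
transitivity (\int[lam]_x \int[leb]_t P (x, t))%E.
  apply: eq_integral => x _; rewrite /P /= ge0_integralZl//.
  (* At the origin the ray integral is not 1, but [cutpow N1] vanishes there. *)
  - have [->|x0] := eqVneq x 0; first by rewrite cutpow0// mule0 mul0e.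
    rewrite -[LHS]mule1; congr (_ * _)%E.
    rewrite -[LHS](integral_cutpow_near0 G2 s21 x0).
    by apply: eq_integral => t _; case: ifPn => // t0; rewrite inv1.
  - apply/measurable_EFinP; apply: measurable_fun_ifT => //.
    + by apply: measurable_fun_ltr => //; exact: measurable_cst.
    + apply: measurable_funM; last exact: measurable_powR.
      by apply: measurable_cutpow => //; apply: measurable_rVZ.
  - move=> t _; rewrite lee_fin; case: ifP => // _.
    by rewrite mulr_ge0 ?powR_ge0 ?cutpow_ge0.
  - by rewrite mule_ge0// lee_fin cutpow_ge0.
transitivity (\int[leb]_t \int[lam]_x P (x, t))%E.
  exact: (fubini_tonelli (m1 := lam) (m2 := leb) P).
transitivity (\int[lam]_x \int[leb]_t Q (x, t))%E; last first.
  apply: eq_integral => x _; rewrite /Q /= ge0_integralZl//.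
  - have [->|x0] := eqVneq x 0; first by rewrite cutpow0// mule0 mul0e.
    rewrite -[RHS]mule1; congr (_ * _)%E.
    rewrite -[RHS](integral_cutpow_neary G1 s11 x0).
    by apply: eq_integral => t _; case: ifPn => // t0; rewrite inv1.
  - apply/measurable_EFinP; apply: measurable_fun_ifT => //.
    + by apply: measurable_fun_ltr => //; exact: measurable_cst.
    + apply: measurable_funM; last exact: measurable_powR.
      by apply: measurable_cutpow => //; apply: measurable_rVZ => //; exact: measurable_powR.
  - move=> t _; rewrite lee_fin; case: ifP => // _.
    by rewrite mulr_ge0 ?powR_ge0 ?cutpow_ge0.
  - by rewrite mule_ge0// lee_fin cutpow_ge0.
transitivity (\int[leb]_t \int[lam]_x Q (x, t))%E; last first.
  apply/esym; exact: (fubini_tonelli (m1 := lam) (m2 := leb) Q).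
apply: eq_integral => t _; have [t0|t0] := leP t 0.
  by apply: eq_integral => x _; rewrite /P /Q /= ltNge t0 /= !mule0.
(* For fixed [t], [P] is [G] at [t x]. The substitution costs [t ^- d], and the homogeneity of [f]
   gives [t ^+ d] back. *)
pose G (y : V) : \bar R := (f (t^-1 *: y) * (cutpow N1 s1 (t^-1 *: y))%:E *
  (cutpow N2 s2 y * t^-1)%:E)%E.
have mG : measurable_fun setT G.
  have mti : measurable_fun setT (fun y : V => t^-1 *: y).
    by apply: measurable_rVZ => //; exact: measurable_id.
  apply: emeasurable_funM; first apply: emeasurable_funM.
  - exact: measurableT_comp mti.
  - by apply/measurable_EFinP; exact: measurable_cutpow.
  - apply/measurable_EFinP; apply: measurable_funM => //.
    by apply: measurable_cutpow => //; exact: measurable_id.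
have G0 y : (0 <= G y)%E.
  by rewrite /G !mule_ge0// lee_fin ?mulr_ge0 ?cutpow_ge0// invr_ge0 ltW.
transitivity (\int[lam]_x G (t *: x))%E.
  apply: eq_integral => x _; rewrite /P /G /= t0 scalerA mulVf ?gt_eqF// scale1r.
  by rewrite inv1.
have mtx : measurable_fun setT (fun x : V => t *: x).
  by apply: measurable_rVZ => //; exact: measurable_id.
rewrite (ge0_integral_scaled_pushforward (mu2 := lam) (c := t ^- d) mtx)//; first last.
- by move=> A mA; exact: lebesgue_rV_scale.
- by rewrite invr_ge0 exprn_ge0// ltW.
rewrite -ge0_integralZl ?lee_fin ?invr_ge0 ?exprn_ge0 ?ltW//.
apply: eq_integral => y _; rewrite /G /Q /= t0 inv1// fZ ?invr_gt0//.
rewrite !muleA -!EFinM exprVn invrK mulVf ?mul1e; last by rewrite expf_neq0// gt_eqF.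
rewrite -!muleA; congr (_ * _)%E; rewrite -!EFinM; congr EFin; ring.
Qed.

End polar.

(** * The Hadwiger-Ohmann argument *)

Section boxes.
Context (R : realType) (l : nat).
Local Notation V := 'rV[R]_l.
Local Notation lam := (lebesgue_rV R l).
Local Notation box := (V * V)%type.
Implicit Types (B : box) (s : seq box) (c : R) (i : 'I_l).

Definition bset B := vbox B.1 B.2.
(** Truncated at 0, so that a box with reversed bounds has volume 0, in accordance with [bset]. *)
Definition bvol B := \prod_i Num.max (B.2 0 i - B.1 0 i) 0.
Definition nondeg B := [forall i, B.1 0 i < B.2 0 i].
(** Disjointness in the form that exhibits a coordinate hyperplane at which to cut. *)
Definition separated B B' :=
  [exists i, (B.2 0 i <= B'.1 0 i) || (B'.2 0 i <= B.1 0 i)].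
Definition lcut i c B : box :=
  (B.1, \row_j if j == i then Num.min (B.2 0 i) c else B.2 0 j).
Definition rcut i c B : box :=
  (\row_j if j == i then Num.max (B.1 0 i) c else B.1 0 j, B.2).

Lemma nondegP B : reflect (forall i, B.1 0 i < B.2 0 i) (nondeg B).
Proof. exact: forallP. Qed.

Lemma bset_lcut i c B : bset (lcut i c B) = bset B `&` [set x | x 0 i < c].
Proof.
apply/seteqP; split => [x H|x [H /= xc] j]; last first.
  rewrite mxE; have := H j; case: eqP => [->|//] /andP[-> ?].
  by rewrite lt_min xc andbT.
have := H i; rewrite mxE eqxx lt_min => /andP[_ /andP[_ xc]].
split=> // j; have := H j; rewrite mxE; case: eqP => // -> /andP[-> /=].
by rewrite lt_min => /andP[].
Qed.

Lemma bset_rcut i c B : bset (rcut i c B) = bset B `&` [set x | c <= x 0 i].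
Proof.
apply/seteqP; split => [x H|x [H /= xc] j]; last first.
  rewrite mxE; have := H j; case: eqP => [->|//] /andP[? ->].
  by rewrite ge_max xc !andbT.
have := H i; rewrite mxE eqxx ge_max => /andP[/andP[_ xc] _].
split=> // j; have := H j; rewrite mxE; case: eqP => // -> /andP[+ ->].
by rewrite ge_max => /andP[->].
Qed.

Lemma bset_degenerate B : ~~ nondeg B -> bset B = set0.
Proof.
rewrite negb_forall => /existsP[i]; rewrite -leNgt => H.
apply/seteqP; split => // x /(_ i) /andP[H1 H2]; move: H.
by rewrite leNgt (le_lt_trans H1 H2).
Qed.

Lemma measurable_bset B : measurable (bset B).
Proof. exact: measurable_vbox. Qed.

Lemma bvol_ge0 B : 0 <= bvol B.
Proof. by apply: prodr_ge0 => i _; rewrite le_max lexx orbT. Qed.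

Lemma bvol_degenerate B : ~~ nondeg B -> bvol B = 0.
Proof.
rewrite negb_forall => /existsP[i]; rewrite -leNgt => H.
apply/eqP/prodf_eq0; exists i => //; apply/eqP/max_idPr; lra.
Qed.

Lemma bvol_gt0 B : nondeg B -> 0 < bvol B.
Proof.
by move=> /nondegP H; apply: prodr_gt0 => i _; rewrite lt_max subr_gt0 H.
Qed.

Lemma lebesgue_rV_bset B : lam (bset B) = (bvol B)%:E.
Proof.
have [/nondegP H|H] := boolP (nondeg B).
  rewrite lebesgue_rV_vbox => [|i]; last exact/ltW.
  congr EFin; apply: eq_bigr => i _; apply/esym/max_idPl.
  by rewrite subr_ge0 ltW.
by rewrite bset_degenerate// bvol_degenerate// measure0.
Qed.

Lemma measurable_halfspace i c : measurable [set x : V | x 0 i < c].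
Proof.
have := measurable_coord i measurableT (measurable_itv `]-oo, c[).
by rewrite setTI; congr measurable.
Qed.

Lemma halfspaceC i c : ~` [set x : V | x 0 i < c] = [set x | c <= x 0 i].
Proof. by apply/seteqP; split => x /=; rewrite leNgt => /negP. Qed.

Lemma bset_cutU i c B : bset B = bset (lcut i c B) `|` bset (rcut i c B).
Proof. by rewrite bset_lcut bset_rcut -setIUr -halfspaceC setUv setIT. Qed.

Lemma bset_cutI i c B : [disjoint bset (lcut i c B) & bset (rcut i c B)]%classic.
Proof.
apply/disj_setPS; rewrite bset_lcut bset_rcut -halfspaceC.
by move=> x [[_ +] [_]].
Qed.

Lemma bvol_cut i c B : bvol B = bvol (lcut i c B) + bvol (rcut i c B).
Proof.
apply: EFin_inj; rewrite EFinD -!lebesgue_rV_bset {1}(bset_cutU i c B).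
rewrite measureU//; [exact: measurable_bset|exact: measurable_bset|].
by apply/eqP; exact: bset_cutI.
Qed.

Lemma integral_cut i c B (f : V -> \bar R) : measurable_fun setT f ->
  (forall x, 0 <= f x)%E ->
  (\int[lam]_(x in bset B) f x = \int[lam]_(x in bset (lcut i c B)) f x +
    \int[lam]_(x in bset (rcut i c B)) f x)%E.
Proof.
move=> mf f0; rewrite {1}(bset_cutU i c B) ge0_integral_setU//.
- exact: measurable_bset.
- exact: measurable_bset.
- exact: measurable_funTS.
- exact: bset_cutI.
Qed.

Definition boxvol s := \sum_(B <- s) bvol B.
Definition boxint (f : V -> \bar R) s := (\sum_(B <- s) \int[lam]_(x in bset B) f x)%E.
(** Degenerate pieces are discarded, so that a cut can lower the number of boxes. *)
Definition lcuts i c s := [seq B <- map (lcut i c) s | nondeg B].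
Definition rcuts i c s := [seq B <- map (rcut i c) s | nondeg B].

Lemma big_nondeg (T : Type) (idx : T) (op : Monoid.law idx) (F : box -> T) s :
  (forall B, ~~ nondeg B -> F B = idx) ->
  \big[op/idx]_(B <- [seq B <- s | nondeg B]) F B = \big[op/idx]_(B <- s) F B.
Proof.
move=> F0; rewrite big_filter; elim: s => [|B s IH]; rewrite ?big_nil// !big_cons.
by rewrite IH; case: ifPn => // /F0 ->; rewrite Monoid.mul1m.
Qed.

Lemma boxvol_cuts i c s : boxvol s = boxvol (lcuts i c s) + boxvol (rcuts i c s).
Proof.
rewrite /boxvol !(big_nondeg _ _ bvol_degenerate) !big_map -big_split /=.
by apply: eq_bigr => B _; exact: bvol_cut.
Qed.

Lemma boxint_cuts f i c s : measurable_fun setT f -> (forall x, 0 <= f x)%E ->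
  boxint f s = (boxint f (lcuts i c s) + boxint f (rcuts i c s))%E.
Proof.
move=> mf f0; rewrite /boxint !big_nondeg; last 2 first.
- by move=> B dB; rewrite bset_degenerate// integral_set0.
- by move=> B dB; rewrite bset_degenerate// integral_set0.
rewrite !big_map -big_split /=.
by apply: eq_bigr => B _; exact: integral_cut.
Qed.

Lemma boxvol_ge0 s : 0 <= boxvol s.
Proof. by apply: sumr_ge0 => B _; exact: bvol_ge0. Qed.

Lemma size_lcuts i c s : (size (lcuts i c s) <= size s)%N.
Proof. by rewrite size_filter -[leqRHS](size_map (lcut i c)) count_size. Qed.

Lemma size_rcuts i c s : (size (rcuts i c s) <= size s)%N.
Proof. by rewrite size_filter -[leqRHS](size_map (rcut i c)) count_size. Qed.

Lemma size_filter_lt (T : eqType) (a : pred T) (r : seq T) x :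
  x \in r -> ~~ a x -> (size (seq.filter a r) < size r)%N.
Proof.
move=> xr ax; rewrite size_filter ltn_neqAle count_size andbT -all_count.
by apply/negP => /allP /(_ x xr); exact/negP.
Qed.

(** A box beyond the hyperplane leaves no piece on this side; this is the progress made by the
    Hadwiger-Ohmann induction. *)
Lemma size_lcuts_lt i c s B : B \in s -> c <= B.1 0 i -> (size (lcuts i c s) < size s)%N.
Proof.
move=> Bs cB; rewrite -[ltnRHS](size_map (lcut i c)).
apply: (@size_filter_lt _ _ _ (lcut i c B)); first exact: map_f.
rewrite negb_forall; apply/existsP; exists i.
by rewrite mxE eqxx -leNgt ge_min cB orbT.
Qed.

Lemma size_rcuts_lt i c s B : B \in s -> B.2 0 i <= c -> (size (rcuts i c s) < size s)%N.
Proof.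
move=> Bs cB; rewrite -[ltnRHS](size_map (rcut i c)).
apply: (@size_filter_lt _ _ _ (rcut i c B)); first exact: map_f.
rewrite negb_forall; apply/existsP; exists i.
by rewrite mxE eqxx -leNgt le_max cB orbT.
Qed.

Lemma pairwise_lcuts i c s : pairwise separated s -> pairwise separated (lcuts i c s).
Proof.
move=> sep; apply: pairwise_filter; rewrite pairwise_map.
apply: sub_pairwise sep => B B' /existsP[j H]; apply/existsP; exists j.
rewrite !mxE; case: (j =P i) => [ji|//]; subst j.
by rewrite !ge_min; case/orP: H => ->; rewrite ?orbT.
Qed.

Lemma pairwise_rcuts i c s : pairwise separated s -> pairwise separated (rcuts i c s).
Proof.
move=> sep; apply: pairwise_filter; rewrite pairwise_map.
apply: sub_pairwise sep => B B' /existsP[j H]; apply/existsP; exists j.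
rewrite !mxE; case: (j =P i) => [ji|//]; subst j.
by rewrite !le_max; case/orP: H => ->; rewrite ?orbT.
Qed.

Lemma lcutsP i c s B : B \in lcuts i c s -> exists2 B', B' \in s & B = lcut i c B'.
Proof. by rewrite mem_filter => /andP[_ /mapP]. Qed.

Lemma rcutsP i c s B : B \in rcuts i c s -> exists2 B', B' \in s & B = rcut i c B'.
Proof. by rewrite mem_filter => /andP[_ /mapP]. Qed.

Lemma continuous_bvol_lcut i B : continuous (fun c : R => bvol (lcut i c B)).
Proof.
rewrite /bvol; apply: (@continuous_big (R : topologicalType) _ ( *%R) 1 xpredT (@mul_continuous R)).
move=> j _ c; apply: (@continuous_max _ _
  (fun c => (lcut i c B).2 0 j - (lcut i c B).1 0 j) (cst 0)); last exact: cst_continuous.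
apply: (@continuousB _ R^o); last exact: cst_continuous.
have [->|ji] := eqVneq j i.
  rewrite (_ : (fun c => _) = (fun c => Num.min (B.2 0 i) c)).
    by apply: continuous_min; [exact: cst_continuous|exact: cvg_id].
  by apply/funext => c'; rewrite mxE eqxx.
rewrite (_ : (fun c => _) = cst (B.2 0 j)); first exact: cst_continuous.
by apply/funext => c'; rewrite mxE (negbTE ji).
Qed.

Lemma continuous_boxvol_lcuts i s : continuous (fun c => boxvol (lcuts i c s)).
Proof.
rewrite (_ : (fun c => _) = (fun c => \sum_(B <- s) bvol (lcut i c B))); last first.
  by apply/funext => c; rewrite /boxvol (big_nondeg _ _ bvol_degenerate) big_map.
apply: (continuous_big (op := +%R)); first exact: add_continuous.
by move=> B _; exact: continuous_bvol_lcut.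
Qed.

(** The volume to the left of the hyperplane varies continuously from 0 to the whole, so the second
    family can be cut in the proportion imposed by the first. *)
Lemma boxvol_lcuts_ivt i s v : 0 <= v <= boxvol s ->
  exists c, boxvol (lcuts i c s) = v.
Proof.
move=> v0.
have lcE c : boxvol (lcuts i c s) = \sum_(B <- s) bvol (lcut i c B).
  by rewrite /boxvol (big_nondeg _ _ bvol_degenerate) big_map.
(* [M] bounds the [i]-th coordinates of all corners, so the cut at [- M] leaves nothing on the left
   and the cut at [M] leaves everything. *)
pose M := \sum_(B <- s) (`|B.1 0 i| + `|B.2 0 i|).
have HM B : B \in s -> `|B.1 0 i| + `|B.2 0 i| <= M.
  by move=> Bs; rewrite /M (big_rem B)//= lerDl sumr_ge0.
have M0 : 0 <= M by apply: sumr_ge0 => B _; rewrite addr_ge0.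
have E1 : boxvol (lcuts i (- M) s) = 0.
  rewrite lcE big_seq big1// => B Bs; apply: bvol_degenerate.
  rewrite negb_forall; apply/existsP; exists i; rewrite mxE eqxx -leNgt ge_min.
  have := HM B Bs; have := ler_norm (- B.1 0 i); rewrite normrN.
  by have := normr_ge0 (B.2 0 i) => ? ? ?; apply/orP; right; lra.
have E2 : boxvol (lcuts i M s) = boxvol s.
  rewrite lcE /boxvol !big_seq; apply: eq_bigr => B Bs; congr bvol.
  case: B Bs => b1 b2 Bs; congr pair; apply/rowP => j; rewrite mxE.
  case: eqP => // ->; apply/min_idPl; have := HM _ Bs.
  by have := ler_norm (b2 0 i); have := normr_ge0 (b1 0 i) => /=; lra.
have [|||c _ cv] := @IVT R (fun c => boxvol (lcuts i c s)) (- M) M v.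
- lra.
- by apply: continuous_subspaceT => x; exact: continuous_boxvol_lcuts.
- rewrite E1 E2 min_l ?max_r//; exact: boxvol_ge0.
- by exists c.
Qed.

End boxes.

Section box_inequality.
Context (R : realType) (l : nat).
Local Notation V := 'rV[R]_l.
Local Notation lam := (lebesgue_rV R l).
Implicit Types (t : R) (f g h k : V -> \bar R).

Lemma integral_diag_affine (d v : V) f : (forall i, 0 < d 0 i) ->
  measurable_fun setT f -> (forall x, 0 <= f x)%E ->
  (\int[lam]_x f (x *m diag_mx d + v)%R = (\prod_i (d 0 i)^-1)%:E * \int[lam]_x f x)%E.
Proof.
move=> d0 mf f0.
have mg : measurable_fun setT (fun x : V => x *m diag_mx d + v).
  apply: measurable_rVD; last exact: measurable_cst.
  by apply: measurable_rV_mulmx; exact: measurable_id.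
apply: (ge0_integral_scaled_pushforward mg) => //.
  by apply: prodr_ge0 => i _; rewrite invr_ge0 ltW.
move=> A mA; have mAv : measurable [set x : V | A (x + v)].
  by apply: measurable_preim => //; apply: measurable_rVD => //; exact: measurable_cst.
have := lebesgue_rV_diag d0 mAv.
by rewrite [X in (_ * X)%E](lebesgue_rV_translation v mA).
Qed.

(** Weighted arithmetic-geometric mean: each factor is at least [d i ^ (1 - t)], and these powers
    have product 1. *)
Lemma prod_convex_comb_ge1 t (d : 'I_l -> R) : 0 <= t <= 1 ->
  (forall i, 0 < d i) -> \prod_i d i = 1 -> 1 <= \prod_i (t + (1 - t) * d i).
Proof.
move=> /andP[t0 t1] d0 d1.
have dE i : d i = expR (ln (d i)) by rewrite lnK// posrE.
have sum0 : \sum_i ln (d i) = 0.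
  apply: expR_inj; rewrite expR0 expR_sum -[RHS]d1.
  by apply: eq_bigr => i _; rewrite -dE.
have E : \prod_i expR ((1 - t) * ln (d i)) = 1.
  by rewrite -expR_sum -mulr_sumr sum0 mulr0 expR0.
rewrite -[leLHS]E.
apply: ler_prod => i _; rewrite expR_ge0 /=; set u := ln (d i).
(* After [exp ((1 - t) u)] is factored out, [exp x >= 1 + x] bounds the bracket below by 1: the
   terms linear in [u] cancel. *)
have -> : t + (1 - t) * d i =
    expR ((1 - t) * u) * (t * expR (- ((1 - t) * u)) + (1 - t) * expR (t * u)).
  rewrite mulrDr mulrCA -expRD subrr expR0 mulr1 mulrCA -expRD -mulrDl subrK mul1r.
  by rewrite -dE.
rewrite ler_pMr ?expR_gt0//.
have H1 := expR_ge1Dx (- ((1 - t) * u)); have H2 := expR_ge1Dx (t * u).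
have t1' : 0 <= 1 - t by lra.
have := ler_wpM2l t0 H1; have := ler_wpM2l t1' H2; lra.
Qed.

(* Both boxes have the same volume, so the affine map [T] between them has
   Jacobian 1, and [x -> t x + (1 - t) T x] has Jacobian at least 1. *)
Lemma box_inequality1 t (A B : V * V) f g h k : 0 <= t <= 1 ->
  nondeg A -> nondeg B -> bvol A = bvol B ->
  measurable_fun setT f -> measurable_fun setT g ->
  measurable_fun setT h -> measurable_fun setT k ->
  (forall x, 0 <= f x)%E -> (forall x, 0 <= g x)%E ->
  (forall x, 0 <= h x)%E -> (forall x, 0 <= k x)%E ->
  (forall x y, bset A x -> bset B y ->
    f x + g y <= h (t *: x + (1 - t) *: y)%R + k ((1 - t) *: x + t *: y)%R)%E ->
  (\int[lam]_(x in bset A) f x + \int[lam]_(x in bset B) g x <=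
   \int[lam]_x h x + \int[lam]_x k x)%E.
Proof.
move=> t01 /nondegP dA /nondegP dB vAB mf mg mh mk f0 g0 h0 k0 H.
pose d : V := \row_i ((B.2 0 i - B.1 0 i) / (A.2 0 i - A.1 0 i)).
have A0 i : 0 < A.2 0 i - A.1 0 i by rewrite subr_gt0.
have B0 i : 0 < B.2 0 i - B.1 0 i by rewrite subr_gt0.
have d0 i : 0 < d 0 i by rewrite mxE divr_gt0.
have d1 : \prod_i d 0 i = 1.
  under eq_bigr do rewrite mxE.
  have bvE (C : V * V) : (forall i, 0 < C.2 0 i - C.1 0 i) ->
      bvol C = \prod_i (C.2 0 i - C.1 0 i).
    by move=> C0; apply: eq_bigr => i _; apply/max_idPl/ltW.
  rewrite prodf_div -!bvE// vAB divff// gt_eqF// -vAB.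
  by apply: bvol_gt0; apply/nondegP.
pose v := B.1 - A.1 *m diag_mx d.
pose T (x : V) : V := x *m diag_mx d + v.
have BT x : bset B (T x) <-> bset A x.
  split=> HT i; have := HT i; rewrite /T /v !mul_mx_diag !mxE.
    have -> : x 0 i * ((B.2 0 i - B.1 0 i) / (A.2 0 i - A.1 0 i)) +
        (B.1 0 i - A.1 0 i * ((B.2 0 i - B.1 0 i) / (A.2 0 i - A.1 0 i))) =
        B.1 0 i + (x 0 i - A.1 0 i) / (A.2 0 i - A.1 0 i) * (B.2 0 i - B.1 0 i).
      by field; rewrite gt_eqF.
    rewrite lerDl pmulr_lge0// pmulr_lge0 ?invr_gt0// subr_ge0 => /andP[-> /=].
    by rewrite -ltrBrDl gtr_pMl// ltr_pdivrMr// mul1r ltrD2r.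
  have -> : x 0 i * ((B.2 0 i - B.1 0 i) / (A.2 0 i - A.1 0 i)) +
      (B.1 0 i - A.1 0 i * ((B.2 0 i - B.1 0 i) / (A.2 0 i - A.1 0 i))) =
      B.1 0 i + (x 0 i - A.1 0 i) / (A.2 0 i - A.1 0 i) * (B.2 0 i - B.1 0 i).
    by field; rewrite gt_eqF.
  rewrite lerDl pmulr_lge0// pmulr_lge0 ?invr_gt0// subr_ge0 => /andP[-> /=].
  by rewrite -ltrBrDl gtr_pMl// ltr_pdivrMr// mul1r ltrD2r.
have mT : measurable_fun setT T.
  apply: measurable_rVD; last exact: measurable_cst.
  by apply: measurable_rV_mulmx; exact: measurable_id.
have intB : (\int[lam]_(x in bset B) g x = \int[lam]_(x in bset A) g (T x))%E.
  rewrite integral_mkcond [RHS]integral_mkcond.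
  have -> : ((fun x => g (T x)) \_ (bset A) = fun x => (g \_ (bset B)) (T x))%E.
    apply/funext => x; rewrite !patchE; have [xA|xA] := pselect (bset A x).
      by rewrite !mem_set//; exact/BT.
    by rewrite !memNset// => /BT.
  rewrite integral_diag_affine//; last 2 first.
  - by apply/measurable_restrict => //; [exact: measurable_bset|exact: measurable_funTS].
  - by move=> x; apply: erestrict_ge0.
  by rewrite prodfV d1 invr1 mul1e.
(* Used with [s = t] for [h] and with [s = 1 - t] for [k]. *)
have intS (s : R) (u : V -> \bar R) : 0 <= s <= 1 -> measurable_fun setT u ->
    (forall x, 0 <= u x)%E ->
    (\int[lam]_(x in bset A) u (s *: x + (1 - s) *: T x)%R <= \int[lam]_x u x)%E.
  move=> /[dup] s01 /andP[s0 s1] mu u0.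
  pose e : V := \row_i (s + (1 - s) * d 0 i).
  have e0 i : 0 < e 0 i.
    rewrite mxE; have := d0 i => di; have [->|s_neq0] := eqVneq s 0; first by lra.
    have : 0 < s by rewrite lt_def s_neq0.
    have : 0 <= (1 - s) * d 0 i by rewrite mulr_ge0 ?subr_ge0// ltW.
    lra.
  have SE (x : V) : s *: x + (1 - s) *: T x = x *m diag_mx e + (1 - s) *: v.
    rewrite /T scalerDr addrA; congr (_ + _).
    by apply/rowP => i; rewrite !mul_mx_diag !mxE; ring.
  have mS : measurable_fun setT (fun x : V => u (s *: x + (1 - s) *: T x)).
    apply: measurableT_comp => //; apply: measurable_rVD.
      by apply: measurable_rVZ => //; exact: measurable_id.
    exact: measurable_rVZ.
  apply: (@le_trans _ _ (\int[lam]_x u (s *: x + (1 - s) *: T x)%R)%E).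
    by apply: ge0_subset_integral => //; exact: measurable_bset.
  under eq_integral do rewrite SE.
  rewrite integral_diag_affine//.
  rewrite -[leRHS]mul1e; apply: lee_wpmul2r; first exact: integral_ge0.
  rewrite lee_fin prodfV invf_le1 ?prodr_gt0//.
  under eq_bigr do rewrite mxE.
  exact: prod_convex_comb_ge1.
have mid : measurable_fun setT (fun x : V => x) by exact: measurable_id.
rewrite intB -ge0_integralD//; first last.
- exact/measurable_funTS/(measurableT_comp mg).
- exact: measurable_funTS.
- exact: measurable_bset.
apply: (@le_trans _ _ (\int[lam]_(x in bset A)
  (h (t *: x + (1 - t) *: T x)%R + k ((1 - t) *: x + t *: T x)%R))%E).
  have mh' : measurable_fun setT (fun x : V => h (t *: x + (1 - t) *: T x)).
    by apply: measurableT_comp => //; apply: measurable_rVD; exact: measurable_rVZ.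
  have mk' : measurable_fun setT (fun x : V => k ((1 - t) *: x + t *: T x)).
    by apply: measurableT_comp => //; apply: measurable_rVD; exact: measurable_rVZ.
  apply: ge0_le_integral => //.
  - exact: measurable_bset.
  - by move=> x _; rewrite adde_ge0.
  - by apply: measurable_funTS; apply: emeasurable_funD => //; exact: (measurableT_comp mg).
  - by apply: measurable_funTS; exact: emeasurable_funD.
  - by move=> x Ax; apply: H => //; apply/BT.
rewrite ge0_integralD//; first last.
- apply: measurable_funTS; apply: measurableT_comp => //; apply: measurable_rVD; exact: measurable_rVZ.
- apply: measurable_funTS; apply: measurableT_comp => //; apply: measurable_rVD; exact: measurable_rVZ.
- exact: measurable_bset.
apply: leeD; first exact: intS.
have := intS (1 - t) k; rewrite subKr; apply => //.
by move: t01 => /andP[? ?]; lra.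
Qed.

Lemma convex_comb_lt t (a b c d : R) : 0 <= t -> 0 <= 1 - t -> a < c -> b < d ->
  t * a + (1 - t) * b < t * c + (1 - t) * d.
Proof.
move=> t0 t1 ac bd; have [->|tn0] := eqVneq t 0; first lra.
apply: ltr_leD; first by rewrite ltr_pM2l// lt_def tn0.
by apply: ler_wpM2l => //; exact: ltW.
Qed.

(* Hadwiger-Ohmann: cutting both families by parallel hyperplanes in the same
   proportion separates the pieces, and lowers the total number of boxes. *)
Theorem box_inequality t f g h k (sA sB : seq (V * V)) : 0 <= t <= 1 ->
  all (@nondeg R l) sA -> all (@nondeg R l) sB ->
  pairwise (@separated R l) sA -> pairwise (@separated R l) sB ->
  boxvol sA = boxvol sB ->
  measurable_fun setT f -> measurable_fun setT g ->
  measurable_fun setT h -> measurable_fun setT k ->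
  (forall x, 0 <= f x)%E -> (forall x, 0 <= g x)%E ->
  (forall x, 0 <= h x)%E -> (forall x, 0 <= k x)%E ->
  (forall A B x y, A \in sA -> B \in sB -> bset A x -> bset B y ->
    f x + g y <= h (t *: x + (1 - t) *: y)%R + k ((1 - t) *: x + t *: y)%R)%E ->
  (boxint f sA + boxint g sB <= \int[lam]_x h x + \int[lam]_x k x)%E.
Proof.
move=> t01.
have [m] := ubnP (size sA + size sB); elim: m sA sB f g h k => // m IH.
(* The case of at least two boxes in [sA]. If only [sB] has several, the two families exchange
   roles. *)
have step sA sB f g h k : (size sA + size sB < m.+1)%N -> (1 < size sA)%N ->
    all (@nondeg R l) sA -> all (@nondeg R l) sB ->
    pairwise (@separated R l) sA -> pairwise (@separated R l) sB ->
    boxvol sA = boxvol sB ->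
    measurable_fun setT f -> measurable_fun setT g ->
    measurable_fun setT h -> measurable_fun setT k ->
    (forall x, 0 <= f x)%E -> (forall x, 0 <= g x)%E ->
    (forall x, 0 <= h x)%E -> (forall x, 0 <= k x)%E ->
    (forall A B x y, A \in sA -> B \in sB -> bset A x -> bset B y ->
      f x + g y <= h (t *: x + (1 - t) *: y)%R + k ((1 - t) *: x + t *: y)%R)%E ->
    (boxint f sA + boxint g sB <= \int[lam]_x h x + \int[lam]_x k x)%E.
  move=> sm s1 nA nB pA pB vAB mf mg mh mk f0 g0 h0 k0 H.
  (* A hyperplane separating the first two boxes of [sA] removes one of them from each side. *)
  have [i [c [Hl Hr]]] : exists i c, (size (lcuts i c sA) < size sA)%N /\
      (size (rcuts i c sA) < size sA)%N.
    case: sA s1 pA {sm nA vAB H} => [|A1 [|A2 s]] //= _ /andP[/andP[/existsP[i /orP[H|H]] _] _].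
      exists i, (A2.1 0 i); split.
        by apply: (@size_lcuts_lt _ _ _ _ _ A2) => //; rewrite !inE eqxx orbT.
      by apply: (@size_rcuts_lt _ _ _ _ _ A1) => //; rewrite !inE eqxx.
    exists i, (A1.1 0 i); split.
      by apply: (@size_lcuts_lt _ _ _ _ _ A1) => //; rewrite !inE eqxx.
    by apply: (@size_rcuts_lt _ _ _ _ _ A2) => //; rewrite !inE eqxx orbT.
  have [|c' vl] := @boxvol_lcuts_ivt _ _ i sB (boxvol (lcuts i c sA)).
    by rewrite boxvol_ge0 -vAB (boxvol_cuts i c sA) lerDl boxvol_ge0.
  have vr : boxvol (rcuts i c sA) = boxvol (rcuts i c' sB).
    by have := boxvol_cuts i c sA; have := boxvol_cuts i c' sB; lra.
  rewrite (boxint_cuts i c sA mf f0) (boxint_cuts i c' sB mg g0).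
  (* If [x] and [y] lie below the hyperplanes at [c] and [c'], the argument of [h] lies in [H1] and
     that of [k] in [H2]; likewise above for the complements. So [h] and [k] are cut at different
     places. *)
  pose H1 := [set x : V | x 0 i < t * c + (1 - t) * c'].
  pose H2 := [set x : V | x 0 i < (1 - t) * c + t * c'].
  have mH1 : measurable H1 by exact: measurable_halfspace.
  have mH2 : measurable H2 by exact: measurable_halfspace.
  have split_int (E : set V) (u : V -> \bar R) : measurable E -> measurable_fun setT u ->
      (forall x, 0 <= u x)%E ->
      (\int[lam]_x u x = \int[lam]_x (u \_ E) x + \int[lam]_x (u \_ (~` E)) x)%E.
    move=> mE mu u0; rewrite -!integral_mkcond -ge0_integral_setU ?setUv//.
    - exact: measurableC.
    - exact/disj_setPCl.
  rewrite (split_int H1 h)// (split_int H2 k)//.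
  rewrite addeACA [leRHS]addeACA; move: t01 => /andP[t0 t1].
  have t1' : 0 <= 1 - t by lra.
  have mr (E : set V) (u : V -> \bar R) : measurable E -> measurable_fun setT u -> measurable_fun setT (u \_ E).
    by move=> mE mu; apply/(measurable_restrictT _ mE); exact: measurable_funTS.
  have er (E : set V) (u : V -> \bar R) : (forall x, 0 <= u x)%E -> forall x, (0 <= (u \_ E) x)%E.
    by move=> u0 x; exact: erestrict_ge0.
  have all_nondeg s : all (@nondeg R l) [seq B <- s | nondeg B].
    by apply/allP => B; rewrite mem_filter => /andP[].
  apply: leeD.
    apply: IH => //; try exact: all_nondeg; try exact: pairwise_lcuts;
      try exact: mr; try exact: er.
    - by rewrite -ltnS (leq_trans _ sm)// ltnS -addSn leq_add// size_lcuts.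
    - move=> A B x y /lcutsP[A' A's ->] /lcutsP[B' B's ->].
      rewrite !bset_lcut => -[xA /= xc] [yB /= yc].
      rewrite !patchE !mem_set; [exact: (H A' B')| |].
        by rewrite /H2 /= !mxE addrC [ltRHS]addrC; exact: convex_comb_lt.
      by rewrite /H1 /= !mxE; exact: convex_comb_lt.
  apply: IH => //; try exact: all_nondeg; try exact: pairwise_rcuts;
    try exact: (mr _ _ (measurableC _)); try exact: er.
  - by rewrite -ltnS (leq_trans _ sm)// ltnS -addSn leq_add// size_rcuts.
  - move=> A B x y /rcutsP[A' A's ->] /rcutsP[B' B's ->].
    rewrite !bset_rcut => -[xA /= xc] [yB /= yc].
    rewrite !patchE !mem_set; [exact: (H A' B')| |]; rewrite halfspaceC /= !mxE;
      by apply: lerD; apply: ler_wpM2l.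
move=> sA sB f g h k sm nA nB pA pB vAB mf mg mh mk f0 g0 h0 k0 H.
have [sA1|sA1] := ltnP 1 (size sA); first exact: step.
have [sB1|sB1] := ltnP 1 (size sB).
  rewrite addeC [leRHS]addeC; apply: step => //; first by rewrite addnC.
  move=> B A y x Bs As yB xA; rewrite addeC [leRHS]addeC.
  by rewrite [(1 - t) *: y + _]addrC [t *: y + _]addrC; exact: (H A B).
(* At most one box is left on each side; equality of volumes excludes a single box against none. *)
case: sA nA vAB H {pA sm} sA1 => [|A [|//]] nA vAB H _;
  case: sB nB vAB H {pB} sB1 => [|B [|//]] nB vAB H _.
- by rewrite /boxint !big_nil adde0 adde_ge0// integral_ge0.
- move: vAB nB; rewrite /boxvol big_nil big_seq1 /= andbT => vB /bvol_gt0.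
  by rewrite -vB ltxx.
- move: vAB nA; rewrite /boxvol big_nil big_seq1 /= andbT => vA /bvol_gt0.
  by rewrite vA ltxx.
- rewrite /boxint !big_seq1; move: vAB nA nB; rewrite /boxvol !big_seq1 /= !andbT.
  move=> vAB nA nB; apply: (box_inequality1 (t := t)) => // x y xA yB.
  by apply: (H A B) => //; rewrite inE.
Qed.

End box_inequality.

Section limn_einf_bounds.
Context (R : realType).
Implicit Types (u : (\bar R)^nat) (c : \bar R).

Lemma limn_einf_le u c : (forall n, u n <= c)%E -> (limn_einf u <= c)%E.
Proof.
move=> uc; rewrite limn_einf_lim; apply: lime_le; first exact: is_cvg_einfs.
apply: nearW => n; apply: le_trans (uc n).
by apply: ereal_inf_lbound; exists n => /=.
Qed.

Lemma limn_einf_ge u c : (\forall n \near \oo, c <= u n)%E -> (c <= limn_einf u)%E.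
Proof.
move=> [N _ cu]; rewrite limn_einf_lim; apply: lime_ge; first exact: is_cvg_einfs.
near=> n; apply: le_ereal_inf_tmp => _ [m /= nm <-]; apply: cu => /=.
by rewrite (leq_trans _ nm)//; near: n; exact: nbhs_infty_ge.
Unshelve. all: by end_near. Qed.

End limn_einf_bounds.

(** * From boxes to open sets *)

Section open_approximation.
Context (R : realType) (l : nat).
Local Notation V := 'rV[R]_l.
Local Notation lam := (lebesgue_rV R l).
Local Notation box := (V * V)%type.
Implicit Types (U : set V) (j : nat) (t : R) (f h : V -> \bar R).

(** With mesh [1 / (j + 1)], [2 (j + 1) ^ 2] cells per axis fill the interval from [- (j + 1)] to
    [j + 1]. *)
Definition grid_index j : finType := {ffun 'I_l -> 'I_(2 * j.+1 ^ 2)}.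

Definition grid_corner j (m : grid_index j) : V :=
  \row_i ((m i)%:R / j.+1%:R - j.+1%:R).

Definition grid_cell j (m : grid_index j) : box :=
  (grid_corner m, grid_corner m + const_mx (j.+1%:R^-1)).

(** The closed cell is tested: negating [oppbox] yields a cell that contains the opposite faces, and
    it must lie in [U] as well. *)
Definition cell_inside U (B : box) :=
  `[< forall x : V, (forall i, B.1 0 i <= x 0 i <= B.2 0 i) -> U x >].

Definition grid U j : seq box :=
  [seq B <- map (@grid_cell j) (enum (grid_index j)) | cell_inside U B].

Definition oppbox (B : box) : box := (- B.2, - B.1).

Lemma nondeg_grid U j : all (@nondeg R l) (grid U j).
Proof.
apply/allP => B; rewrite mem_filter => /andP[_ /mapP[m _ ->]].
by apply/nondegP => i; rewrite /= !mxE ltrDl invr_gt0 ltr0n.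
Qed.

Lemma separated_grid U j : pairwise (@separated R l) (grid U j).
Proof.
apply: pairwise_filter; rewrite pairwise_map.
have := enum_uniq (grid_index j); rewrite uniq_pairwise; apply: sub_pairwise.
move=> m m' /= mm'; have [i mi] : exists i, m i != m' i.
  apply/existsP; apply: contraNT mm'; rewrite negb_exists => /forallP H.
  by apply/eqP/ffunP => i; apply/eqP; have := H i; rewrite negbK.
apply/existsP; exists i; rewrite !mxE.
have j0 : 0 < j.+1%:R^-1 :> R by rewrite invr_gt0.
have le_cell (p q : nat) : (p < q)%N ->
    p%:R / j.+1%:R - j.+1%:R + j.+1%:R^-1 <= q%:R / j.+1%:R - j.+1%:R :> R.
  rewrite -(ler_nat R) -natr1 => pq.
  have : (p%:R + 1) * j.+1%:R^-1 <= q%:R * j.+1%:R^-1 :> R by rewrite ler_wpM2r// ltW.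
  by rewrite mulrDl mul1r => ?; rewrite addrAC lerD2r.
have : m i != m' i :> nat by [].
by rewrite neq_ltn => /orP[/le_cell ->|/le_cell ->]; rewrite ?orbT.
Qed.

Lemma nondeg_oppbox B : nondeg (oppbox B) = nondeg B.
Proof. by apply: eq_forallb => i; rewrite /= !mxE ltrN2. Qed.

Lemma separated_oppbox B B' : separated B B' -> separated (oppbox B) (oppbox B').
Proof.
by move=> /existsP[i H]; apply/existsP; exists i; rewrite /= !mxE !lerN2 orbC.
Qed.

Lemma bvol_oppbox B : bvol (oppbox B) = bvol B.
Proof. by apply: eq_bigr => i _; rewrite /= !mxE opprK addrC. Qed.

Lemma bset_grid U j B x : B \in grid U j -> bset B x -> U x.
Proof.
rewrite mem_filter => /andP[/asboolP H _] Bx; apply: H => i.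
by have /andP[-> /ltW ->] := Bx i.
Qed.

Lemma bset_oppbox_grid U j B x : B \in grid U j -> bset (oppbox B) x -> U (- x).
Proof.
rewrite mem_filter => /andP[/asboolP H _] Bx; apply: H => i.
by have := Bx i; rewrite /= !mxE lerNl ltrNr => /andP[-> /ltW ->].
Qed.

(** The first index serves the half-open cells and the second their opposites, which are closed at
    the other end; the second differs from the floor when [w] is an integer. *)
Lemma real_floor_between (N : nat) (w : R) : 0 < w < N%:R ->
  (exists m : 'I_N, m%:R <= w < m.+1%:R) /\ (exists m : 'I_N, m%:R < w <= m.+1%:R).
Proof.
move=> /andP[w0 wN]; have /andP[tw wt] := truncn_itv (ltW w0).
have tN : (Num.truncn w < N)%N by rewrite -(ltr_nat R) (le_lt_trans tw).
split; first by exists (Ordinal tN); rewrite /= tw wt.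
have [tw'|tw'] := ltP (Num.truncn w)%:R w.
  by exists (Ordinal tN); rewrite /= tw' ltW.
have E : w = (Num.truncn w)%:R by apply/le_anti; rewrite tw tw'.
have t0 : (0 < Num.truncn w)%N by rewrite -(ltr0n R) -E.
have pN : ((Num.truncn w).-1 < N)%N by rewrite (leq_ltn_trans (leq_pred _)).
by exists (Ordinal pN); rewrite /= prednK// -E lexx andbT [X in _ < X]E ltr_nat prednK.
Qed.

Lemma grid_eventually U x : open U -> U x ->
  \forall j \near \oo,
    (exists2 B, B \in grid U j & bset B x) /\
    (exists2 B, B \in grid U j & bset (oppbox B) (- x)).
Proof.
move=> oU Ux; have /nbhs_ballP[e /= e0 eU] : nbhs x U by exact: open_nbhs_nbhs.
near=> j.
have jx : `|x| < j.+1%:R.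
  rewrite (lt_trans (archi_boundP (normr_ge0 x)))// ltr_nat ltnS.
  by near: j; exact: nbhs_infty_ge.
have je : j.+1%:R^-1 < e.
  rewrite invf_plt ?posrE//.
  rewrite (lt_trans (archi_boundP _))// ?invr_ge0 ?ltW// ltr_nat ltnS.
  by near: j; exact: nbhs_infty_ge.
have j0 : 0 < j.+1%:R :> R by rewrite ltr0n.
(* Coordinates in units of the mesh, counted from the corner of the grid, so that rounding [w i]
   gives the index of a cell. *)
pose w i := (x 0 i + j.+1%:R) * j.+1%:R.
have w0 i : 0 < w i < (2 * j.+1 ^ 2)%:R.
  have := le_lt_trans (ler_coord_norm x i) jx; rewrite ltr_norml => /andP[H1 H2].
  rewrite pmulr_lgt0//; apply/andP; split; first lra.
  by rewrite natrM natrX expr2 mulrA ltr_pM2r//; lra.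
have cell (m : grid_index j) : (forall i, (m i)%:R <= w i <= (m i).+1%:R) ->
    grid_cell m \in grid U j.
  move=> mw; rewrite mem_filter map_f ?mem_enum// andbT.
  apply/asboolP => y Hy; apply: eU; split=> // a i; rewrite (ord1 a) -ball_normE /=.
  rewrite (le_lt_trans _ je)//; have /andP[mw1 mw2] := mw i.
  have H1 : (m i)%:R / j.+1%:R <= x 0 i + j.+1%:R by rewrite ler_pdivrMr.
  have H2 : x 0 i + j.+1%:R <= (m i)%:R / j.+1%:R + j.+1%:R^-1.
    by rewrite -[X in _ <= _ + X]mul1r -mulrDl natr1 ler_pdivlMr.
  move: H1 H2 (Hy i); rewrite /= !mxE ler_distl.
  by set a1 := (m i)%:R / _; set b1 := j.+1%:R^-1; set c1 := j.+1%:R; clearbody a1 b1 c1 => ? ? /andP[? ?]; lra.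
split.
  have /choice[m Hm] := fun i => (real_floor_between (w0 i)).1.
  exists (grid_cell [ffun i => m i]).
    by apply: cell => i; rewrite ffunE; have /andP[-> /ltW ->] := Hm i.
  move=> i; have /andP[mw1 mw2] := Hm i; rewrite /= !mxE ffunE.
  have H1 : (m i)%:R / j.+1%:R <= x 0 i + j.+1%:R by rewrite ler_pdivrMr.
  have H2 : x 0 i + j.+1%:R < (m i)%:R / j.+1%:R + j.+1%:R^-1.
    by rewrite -[X in _ < _ + X]mul1r -mulrDl natr1 ltr_pdivlMr.
  by move: H1 H2; set a1 := (m i)%:R / _; set b1 := j.+1%:R^-1; set c1 := j.+1%:R; clearbody a1 b1 c1 => ? ?; lra.
have /choice[m Hm] := fun i => (real_floor_between (w0 i)).2.
exists (grid_cell [ffun i => m i]).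
  by apply: cell => i; rewrite ffunE; have /andP[/ltW -> ->] := Hm i.
move=> i; have /andP[mw1 mw2] := Hm i; rewrite /= !mxE ffunE.
have H1 : (m i)%:R / j.+1%:R < x 0 i + j.+1%:R by rewrite ltr_pdivrMr.
have H2 : x 0 i + j.+1%:R <= (m i)%:R / j.+1%:R + j.+1%:R^-1.
  by rewrite -[X in _ <= _ + X]mul1r -mulrDl natr1 ler_pdivlMr.
by move: H1 H2; set a1 := (m i)%:R / _; set b1 := j.+1%:R^-1; set c1 := j.+1%:R; clearbody a1 b1 c1 => ? ?; lra.
Unshelve. all: by end_near. Qed.

Lemma boxint_integral f (s : seq box) : measurable_fun setT f -> (forall x, 0 <= f x)%E ->
  boxint f s = (\int[lam]_x \sum_(B <- s) (f \_ (bset B)) x)%E.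
Proof.
move=> mf f0; rewrite ge0_integral_sum//.
- by apply: eq_bigr => B _; rewrite [LHS]integral_mkcond.
- move=> B; apply/(measurable_restrictT _ (measurable_bset B)); exact: measurable_funTS.
- by move=> B x _; exact: erestrict_ge0.
Qed.

(* [box_inequality] for the boxes of a fine grid inside [U] and their opposites;
   both kinds of integrals converge as the mesh tends to 0. *)
Theorem symmetric_open_inequality t U f h : 0 <= t <= 1 -> open U ->
  measurable_fun setT f -> measurable_fun setT h ->
  (forall x, 0 <= f x)%E -> (forall x, 0 <= h x)%E ->
  (forall x y, U x -> U y ->
    f x + f y <= h (t *: x - (1 - t) *: y)%R + h (t *: y - (1 - t) *: x)%R)%E ->
  (\int[lam]_(x in U) f x <= \int[lam]_x h x)%E.
Proof.
move=> t01 oU mf mh f0 h0 H.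
have mN (u : V -> \bar R) : measurable_fun setT u -> measurable_fun setT (fun x : V => u (- x)).
  by move=> mu; apply: measurableT_comp => //; exact/measurable_rVN/measurable_id.
have intN (u : V -> \bar R) : measurable_fun setT u -> (forall x, 0 <= u x)%E ->
    (\int[lam]_x u (- x)%R = \int[lam]_x u x)%E.
  move=> mu u0; rewrite -[RHS]mul1e.
  apply: (ge0_integral_scaled_pushforward (c := 1)) => //.
    exact/measurable_rVN/measurable_id.
  move=> A mA; rewrite mul1e -[RHS](@lebesgue_rV_orthogonal _ _ (- 1%:M))//.
    by congr (lam _); apply/seteqP; split => x /=; rewrite mulmxN mulmx1.
  by rewrite linearN /= trmx1 mulNmx mul1mx opprK.
(* Reflecting the second family and the function [k] turns the differences in [H] into the convex
   combinations of [box_inequality]. *)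
pose g (x : V) := f (- x); pose k (x : V) := h (- x).
have g0 x : (0 <= g x)%E by exact: f0.
have k0 x : (0 <= k x)%E by exact: h0.
have mU : measurable U by exact: open_measurable_rV.
have mUN : measurable [set x : V | U (- x)].
  by apply: measurable_preim => //; exact/measurable_rVN/measurable_id.
pose F j (x : V) := (\sum_(B <- grid U j) (f \_ (bset B)) x +
  \sum_(B <- map oppbox (grid U j)) (g \_ (bset B)) x)%E.
have mr (E : set V) (u : V -> \bar R) : measurable E -> measurable_fun setT u -> measurable_fun setT (u \_ E).
  by move=> mE mu; apply/(measurable_restrictT _ mE); exact: measurable_funTS.
have er (E : set V) (u : V -> \bar R) : (forall x, 0 <= u x)%E -> forall x, (0 <= (u \_ E) x)%E.
  by move=> u0 x; exact: erestrict_ge0.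
have msum (u : V -> \bar R) (s : seq box) : measurable_fun setT u ->
    measurable_fun setT (fun x => \sum_(B <- s) (u \_ (bset B)) x)%E.
  by move=> mu; apply: emeasurable_sum => B; apply: mr => //; exact: measurable_bset.
have F0 j x : (0 <= F j x)%E by rewrite adde_ge0// sume_ge0// => B _; exact: er.
have bound j : (\int[lam]_x F j x <= \int[lam]_x h x + \int[lam]_x k x)%E.
  rewrite ge0_integralD//; first last.
  - by apply: msum; exact: mN.
  - by move=> x _; apply: sume_ge0 => B _; exact: er.
  - exact: msum.
  - by move=> x _; apply: sume_ge0 => B _; exact: er.
  rewrite -!boxint_integral//; last exact: mN.
  apply: (box_inequality t01) => //; try exact: mN.
  - exact: nondeg_grid.
  - by rewrite all_map (eq_all nondeg_oppbox) nondeg_grid.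
  - exact: separated_grid.
  - by rewrite pairwise_map; apply: sub_pairwise (separated_grid U j) => B B'; exact: separated_oppbox.
  - by rewrite /boxvol big_map; apply: eq_bigr => B _; rewrite bvol_oppbox.
  - move=> A _ x y As /mapP[B Bs ->] xA yB; rewrite /g /k.
    have := H _ _ (bset_grid As xA) (bset_oppbox_grid Bs yB).
    by rewrite !scalerN opprK opprD [(- ((1 - t) *: x) - _)%R]addrC.
have fUg : (\int[lam]_(x in U) f x + \int[lam]_(x in [set x : V | U (- x)%R]) g x <=
    \int[lam]_x h x + \int[lam]_x k x)%E.
  rewrite integral_mkcond [X in (_ + X)%E]integral_mkcond -ge0_integralD//; first last.
  - by apply: mr => //; exact: mN.
  - by move=> x _; apply: er => y; exact: f0.
  - exact: mr.
  - by move=> x _; exact: er.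
  (* Successive grids are not nested, so the limit is taken by Fatou's lemma: near infinity the sums
     dominate [f] on [U] and [g] on its opposite, and [bound] is uniform in [j]. *)
  apply: (@le_trans _ _ (\int[lam]_x limn_einf (F^~ x))%E).
    apply: ge0_le_integral => //.
    - by move=> x _; rewrite adde_ge0//; apply: er => y; exact: f0.
    - by apply: emeasurable_funD; apply: mr => //; exact: mN.
    - have mF0 j : measurable_fun setT (F j).
        by apply: emeasurable_funD; apply: msum => //; exact: mN.
      have mF j : measurable_fun setT (fun x => - F j x)%E.
        exact: (measurableT_comp (@oppe_measurable R setT) (mF0 j)).
      exact: (measurableT_comp (@oppe_measurable R setT) (measurable_fun_limn_esup mF)).
    - move=> x _; apply: limn_einf_ge.
      have ge_sum (u : V -> \bar R) (r : seq box) B : (forall x, 0 <= u x)%E ->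
          B \in r -> bset B x -> (u x <= \sum_(B <- r) (u \_ (bset B)) x)%E.
        move=> u0 Br Bx; rewrite (big_rem B)//= [X in (X + _)%E]patchE mem_set// leeDl//.
        by apply: sume_ge0 => B' _; exact: er.
      have N1 : \forall j \near \oo, ((f \_ U) x <= \sum_(B <- grid U j) (f \_ (bset B)) x)%E.
        rewrite patchE; case: ifPn => [/set_mem Ux|_]; last first.
          by apply: nearW => j; apply: sume_ge0 => B _; exact: er.
        by apply: filterS (grid_eventually oU Ux) => j [[B Bs Bx] _]; exact: ge_sum Bx.
      have N2 : \forall j \near \oo, ((g \_ [set x : V | U (- x)%R]) x <=
          \sum_(B <- map oppbox (grid U j)) (g \_ (bset B)) x)%E.
        rewrite patchE; case: ifPn => [/set_mem /= Ux|_]; last first.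
          by apply: nearW => j; apply: sume_ge0 => B _; apply: er => y; exact: f0.
        apply: filterS (grid_eventually oU Ux) => j [_ [B Bs]]; rewrite opprK => Bx.
        by apply: (ge_sum g _ (oppbox B)) => //; exact: map_f.
      near=> j; apply: leeD; [near: j; exact: N1|near: j; exact: N2].
  apply: le_trans; first apply: fatou => //.
  - by move=> j; apply: emeasurable_funD; apply: msum => //; exact: mN.
  - exact: limn_einf_le.
move: fUg; rewrite /k intN//.
have -> : (\int[lam]_(x in [set x : V | U (- x)%R]) g x = \int[lam]_(x in U) f x)%E.
  rewrite integral_mkcond [RHS]integral_mkcond -[RHS](intN _ (mr U f mU mf) (er U f f0)).
  by apply: eq_integral => x _; rewrite !patchE /g.
(* Both sides are now doubled; halving goes by contradiction since they may be infinite. *)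
move=> fh; rewrite leNgt; apply/negP => hf.
by move: fh; rewrite leNgt => /negP; apply; exact: lteD.
Unshelve. all: by end_near. Qed.

End open_approximation.

(** * Borel sets are Hausdorff measurable *)

Section separated_outer_measure.
Context (R : realType) (T : Type) (mu : {outer_measure set T -> \bar R}) (phi : T -> R).
Hypothesis mu_separated : forall (s t : R) (A B : set T), s < t ->
  (forall x, A x -> phi x <= s) -> (forall x, B x -> t <= phi x) ->
  (mu A + mu B <= mu (A `|` B))%E.
Variables (c : R) (X : set T).
Let r (j : nat) : R := c + j.+1%:R^-1.
Let shell j := X `&` [set x | r j.+1 < phi x <= r j].

Let r_gt j : c < r j.
Proof. by rewrite ltrDl invr_gt0. Qed.

(* Shells of the same parity are separated, so their measures add up. *)
Lemma alternate_shells_le e N : (\sum_(i < N) mu (shell (2 * i + e)) <= mu X)%E.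
Proof.
(* The half-integer puts [t k] strictly below the first [k] shells of this parity and strictly above
   the next one. *)
pose t k : R := c + (k.*2%:R + e%:R + 2^-1)^-1.
have H k : (\sum_(i < k) mu (shell (2 * i + e)) <= mu (X `&` [set x | (t k < phi x)%R]))%E.
  elim: k => [|k IH]; first by rewrite big_ord0 outer_measure_ge0.
  have k0 : 0 <= k.*2%:R :> R by [].
  have e0 : 0 <= e%:R :> R by [].
  have t1 : r (2 * k + e) < t k.
    rewrite ltrD2l ltf_pV2 ?posrE//.
    by rewrite mul2n -[(_ + e).+1]addn1 !natrD; lra.
  have t2 : t k.+1 < r (2 * k + e).+1.
    rewrite ltrD2l ltf_pV2 ?posrE//.
    by rewrite doubleS mul2n -[(_ + e).+2]addn2 -[(k.*2).+2]addn2 !natrD; lra.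
  have t3 : t k.+1 < t k.
    rewrite ltrD2l ltf_pV2 ?posrE//.
    by rewrite doubleS -[(k.*2).+2]addn2 natrD; lra.
  rewrite big_ord_recr /= addeC; apply: le_trans; first exact: leeD2l IH.
  apply: le_trans.
    apply: (mu_separated t1); first by move=> x [_ /= /andP[]].
    by move=> x [_ /= /ltW].
  apply: le_outer_measure => x [[Xx /= /andP[x1 _]]|[Xx /= x1]]; split => //=.
    exact: lt_trans x1.
  exact: lt_trans x1.
by apply: (le_trans (H N)); apply: le_outer_measure => x [].
Qed.

Lemma shells_le N : (\sum_(0 <= i < N) mu (shell i) <= mu X + mu X)%E.
Proof.
apply: (@le_trans _ _ (\sum_(0 <= i < 2 * N) mu (shell i))%E).
  apply: lee_sum_nneg_natr => // [i _ _|]; first exact: outer_measure_ge0.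
  by rewrite mul2n -addnn leq_addr.
have -> : (\sum_(0 <= i < 2 * N) mu (shell i) =
    \sum_(i < N) mu (shell (2 * i + 0)) + \sum_(i < N) mu (shell (2 * i + 1)))%E.
  elim: N => [|k IH]; first by rewrite muln0 big_nil !big_ord0 adde0.
  rewrite mulnS addnC addn2 !big_nat_recr//= IH !big_ord_recr /= addn0 addn1.
  by rewrite -!addeA; congr (_ + _)%E; rewrite addeCA.
by apply: leeD; exact: alternate_shells_le.
Qed.

Lemma separated_caratheodory_le : (mu X < +oo)%E ->
  (mu (X `&` [set x | (phi x <= c)%R]) + mu (X `&` ~` [set x | (phi x <= c)%R]) <= mu X)%E.
Proof.
move=> Xoo.
have series_oo : (\sum_(0 <= i <oo) mu (shell i) < +oo)%E.
  apply: (@le_lt_trans _ _ (mu X + mu X)%E); last exact: lte_add_pinfty.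
  apply: lime_le; last by apply: nearW => N; exact: shells_le.
  by apply: is_cvg_nneseries => i _ _; exact: outer_measure_ge0.
have tail := nneseries_tail_cvg series_oo (fun i _ => outer_measure_ge0 mu (shell i)).
apply/lee_addgt0Pr => e e0.
have [j tj] : exists j, (\sum_(j <= i <oo) mu (shell i) <= e%:E)%E.
  have oe : nbhs (0%R : \bar R) [set y | (y < e%:E)%E].
    by apply: open_nbhs_nbhs; split; [exact: open_ereal_lt_ereal|rewrite /= lte_fin].
  by have [N _ /(_ N (leqnn N)) /= /ltW] := tail _ oe; exists N.
(* [Q] is at distance [r j - c] in [phi] from the part below [c], and the shells left out have total
   measure at most [e]. *)
pose Q := X `&` [set x | r j < phi x].
have QE : X `&` ~` [set x | phi x <= c] `<=` Q `|` \bigcup_i shell (i + j).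
  move=> x [Xx /= /negP]; rewrite -ltNge => cx.
  have [xj|xj] := ltP (r j) (phi x); first by left.
  right.
  have ex : exists i, r i.+1 < phi x.
    exists (Num.bound (phi x - c)^-1).
    have xc : 0 < phi x - c by rewrite subr_gt0.
    rewrite /r -ltrBrDl invf_plt ?posrE//.
    by rewrite (lt_trans (archi_boundP _)) ?invr_ge0 ?ltW// ltr_nat.
  have r_lt i k : (r i < r k) = (k < i)%N.
    by rewrite ltrD2l ltf_pV2 ?posrE// ltr_nat ltnS.
  case: (ex_minnP ex) => i ri imin; have ji : (j <= i)%N.
    by rewrite -ltnS -r_lt (lt_le_trans ri).
  exists (i - j)%N => //; rewrite subnK//; split=> //=; rewrite ri /=.
  case: i ri imin ji => [|i] ri imin ji; first by move: ji; rewrite leqn0 => /eqP <-.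
  by rewrite leNgt; apply/negP => /imin; rewrite ltnn.
have muQ : (mu (X `&` [set x | (phi x <= c)%R]) + mu Q <= mu X)%E.
  apply: le_trans; first apply: (mu_separated (r_gt j)).
  - by move=> x [].
  - by move=> x [_ /ltW].
  by apply: le_outer_measure => x [[]|[]].
apply: (@le_trans _ _ (mu (X `&` [set x | (phi x <= c)%R]) + (mu Q + e%:E))%E).
  apply: leeD2l; apply: (le_trans (le_outer_measure mu _ _ QE)).
  apply: (le_trans (outer_measureU2 mu _ _)); apply: leeD2l.
  apply: (le_trans (outer_measure_sigma_subadditive mu _)).
  rewrite (nneseries_addn j (f := fun i => mu (shell i)))// => i.
  exact: outer_measure_ge0.
by rewrite addeA; exact: leeD2r.
Qed.

End separated_outer_measure.

(** Caratheodory's criterion for metric outer measures, with a gap between the values of [phi] in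
    place of a positive distance; it is applied with [phi] a coordinate. *)
Lemma separated_caratheodory (R : realType) (T : Type)
    (mu : {outer_measure set T -> \bar R}) (phi : T -> R) :
  (forall (s t : R) (A B : set T), s < t ->
    (forall x, A x -> phi x <= s) -> (forall x, B x -> t <= phi x) ->
    (mu A + mu B <= mu (A `|` B))%E) ->
  forall c, mu.-caratheodory [set x | phi x <= c].
Proof.
move=> sep c; apply: le_caratheodory_measurable => X.
have [Xoo|] := ltP (mu X) +oo%E; first exact: separated_caratheodory_le.
by move=> /(le_trans (leey _)).
Qed.

Section hausdorff_borel.
Context (R : realType) (n d : nat).
Local Notation V := 'rV[R]_n.
Implicit Types (A B : set V).

Lemma ediam_ge (U : set V) x y : U x -> U y -> ((enorm (x - y))%:E <= ediam U)%E.
Proof. by move=> Ux Uy; apply: ereal_sup_ubound; exists (x, y). Qed.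

Lemma ediam0 : ediam (set0 : set V) = -oo%E.
Proof.
apply/eqP; rewrite -leeNy_eq; apply: ge_ereal_sup => _ [p [[]]].
Qed.

(** A set of diameter at most [delta] cannot meet both [A] and [B], so a cover of the union splits
    into covers of the two parts that share no nonempty member. *)
Lemma hausdorff_delta_separated i (s t delta : R) A B : delta < t - s ->
  (forall x, A x -> x 0 i <= s) -> (forall x, B x -> t <= x 0 i) ->
  (hausdorff_delta d delta A + hausdorff_delta d delta B <=
   hausdorff_delta d delta (A `|` B))%E.
Proof.
move=> dst As Bt; apply: le_ereal_inf_tmp => _ [U [Ud UAB] <-].
pose V1 k := if `[< U k `&` A !=set0 >] then U k else set0.
pose V2 k := if `[< U k `&` B !=set0 >] then U k else set0.
have cov (E : set V) (W : nat -> set V) : (forall x, E x -> (A `|` B) x) ->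
    (forall k, W k = if `[< U k `&` E !=set0 >] then U k else set0) ->
    hausdorff_cover delta E W.
  move=> EAB WE; split=> [k|x Ex].
    by rewrite WE; case: asboolP => // _; rewrite ediam0 leNye.
  have [k _ Ukx] := UAB _ (EAB _ Ex); exists k => //; rewrite WE.
  by case: asboolP => // -[]; exists x.
apply: (@le_trans _ _ (\sum_(k <oo) hausdorff_weight d (V1 k) +
    \sum_(k <oo) hausdorff_weight d (V2 k))%E).
  apply: leeD; apply: ereal_inf_lbound.
    by exists V1 => //; apply: cov => // x; left.
  by exists V2 => //; apply: cov => // x; right.
rewrite -nneseriesD; [|by move=> *; exact: hausdorff_weight_ge0..].
apply: lee_nneseries => [k _ _|k _].
  by rewrite adde_ge0// hausdorff_weight_ge0.
rewrite /V1 /V2; case: asboolP => [[x [Ux Ax]]|_]; case: asboolP => [[y [Uy By]]|_];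
  rewrite ?hausdorff_weight0 ?adde0 ?add0e ?hausdorff_weight_ge0//.
have := le_trans (ediam_ge Uy Ux) (Ud k); rewrite lee_fin => xy.
have := ler_norm_coord (y - x) i; have := ler_norm ((y - x) 0 i).
have := As x Ax; have := Bt y By; rewrite !mxE => ? ? ? ?; exfalso.
have : t - s <= delta by lra.
by rewrite leNgt dst.
Qed.

Lemma le_hausdorff_delta_scale (delta delta' : R) A : delta' <= delta ->
  (hausdorff_delta d delta A <= hausdorff_delta d delta' A)%E.
Proof.
move=> dd; apply: ereal_inf_le_tmp => _ [U [Ud UA] <-]; exists U => //; split=> // k.
by rewrite (le_trans (Ud k))// lee_fin.
Qed.

Lemma hausdorff_delta_le (delta : R) A : 0 < delta ->
  (hausdorff_delta d delta A <= hausdorff d A)%E.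
Proof. by move=> d0; apply: ereal_sup_ubound; exists delta. Qed.

Lemma hausdorff_separated i (s t : R) A B : s < t ->
  (forall x, A x -> x 0 i <= s) -> (forall x, B x -> t <= x 0 i) ->
  (hausdorff d A + hausdorff d B <= hausdorff d (A `|` B))%E.
Proof.
move=> st As Bt; have [ABoo|] := ltP (hausdorff d (A `|` B)) +oo%E; last first.
  by move=> /(le_trans (leey _)).
have fin E : E `<=` A `|` B -> hausdorff d E \is a fin_num.
  move=> EAB; rewrite ge0_fin_numE ?hausdorff_ge0//.
  by apply: le_lt_trans ABoo; exact: le_hausdorff.
have key (d1 d2 : R) : 0 < d1 -> 0 < d2 ->
    (hausdorff_delta d d1 A + hausdorff_delta d d2 B <= hausdorff d (A `|` B))%E.
  (* A common scale below [d1], [d2] and the gap; refining the scale only increases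
     [hausdorff_delta]. *)
  move=> d10 d20; pose d3 := Num.min (Num.min d1 d2) ((t - s) / 2).
  have d30 : 0 < d3 by rewrite !lt_min d10 d20 divr_gt0// subr_gt0.
  have d3st : d3 < t - s.
    rewrite (@le_lt_trans _ _ ((t - s) / 2))// ?ge_min ?lexx ?orbT//.
    by rewrite ltr_pdivrMr//; lra.
  apply: le_trans (hausdorff_delta_le _ d30).
  apply: le_trans (hausdorff_delta_separated d3st As Bt).
  by apply: leeD; apply: le_hausdorff_delta_scale; rewrite !ge_min lexx ?orbT.
have finA : hausdorff d A \is a fin_num by apply: fin => x; left.
have finB : hausdorff d B \is a fin_num by apply: fin => x; right.
have findB d2 : 0 < d2 -> hausdorff_delta d d2 B \is a fin_num.
  move=> d20; rewrite ge0_fin_numE ?hausdorff_delta_ge0//.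
  by apply: le_lt_trans (hausdorff_delta_le _ d20) _; rewrite ltey_eq finB.
rewrite -leeBrDr//; apply: ge_ereal_sup => _ [d1 d10 <-].
rewrite leeBrDr// addeC -leeBrDr; last first.
  rewrite ge0_fin_numE ?hausdorff_delta_ge0//.
  by apply: le_lt_trans (hausdorff_delta_le _ d10) _; rewrite ltey_eq finA.
apply: ge_ereal_sup => _ [d2 d20 <-]; rewrite leeBrDr.
  by rewrite addeC; exact: key.
rewrite ge0_fin_numE ?hausdorff_delta_ge0//.
by apply: le_lt_trans (hausdorff_delta_le _ d10) _; rewrite ltey_eq finA.
Qed.

(** Measurability of the identity says that Borel sets are Caratheodory measurable; coordinate
    half-spaces suffice. *)
Lemma measurable_caratheodory_id :
  measurable_fun setT (id : caratheodory_type (@hausdorff R n d) -> V).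
Proof.
apply: measurable_fun_rV => i.
apply: (measurability _ (measurable_realfun.RGenOInfty.measurableE R)).
move=> _ [_ [c ->] <-]; rewrite setTI.
have := separated_caratheodory (@hausdorff_separated i) c.
move=> /(@caratheodory_measurable_setC _ _ (@hausdorff R n d)).
congr (_.-caratheodory _).
by apply/seteqP; split => x /=; rewrite in_itv/= andbT ltNge => /negP.
Qed.

Lemma hausdorff_image_isometry (f : V -> V) A :
  (forall x y, enorm (f x - f y) = enorm (x - y)) ->
  (hausdorff d (f @` A) <= hausdorff d A)%E.
Proof.
move=> fiso.
have diamE U : ediam (f @` U) = ediam U.
  rewrite /ediam; congr ereal_sup; apply/seteqP; split.
    by move=> _ [[_ _] /= [[x Ux <-] [y Uy <-]] <-]; exists (x, y) => //=; rewrite fiso.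
  by move=> _ [[x y] /= [Ux Uy] <-]; exists (f x, f y); rewrite /= ?fiso//; split; [exists x|exists y].
have weightE U : hausdorff_weight d (f @` U) = hausdorff_weight d U.
  rewrite /hausdorff_weight diamE; have -> // : `[< f @` U = set0 >] = `[< U = set0 >].
  apply: asbool_equiv_eq; split => [H|->]; last exact: image_set0.
  apply/seteqP; split=> // x Ux; have : (f @` U) (f x) by exists x.
  by rewrite H.
apply: ge_ereal_sup => _ [delta d0 <-]; apply: le_trans (hausdorff_delta_le _ d0).
apply: le_ereal_inf_tmp => _ [U [Ud UA] <-]; apply: ereal_inf_lbound.
exists (fun k => f @` U k); last by apply: eq_eseriesr => k _; exact: weightE.
split=> [k|_ [x /UA[k _ Ukx] <-]]; first by rewrite diamE.
by exists k => //; exists x.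
Qed.

(** For an involution preimages are images, so the inequality for images, used twice, gives
    equality. Reflections are of this kind. *)
Lemma hausdorff_involution (f : V -> V) A : involutive f ->
  (forall x y, enorm (f x - f y) = enorm (x - y)) ->
  hausdorff d [set x | A (f x)] = hausdorff d A.
Proof.
move=> ff fiso; have fE E : [set x | E (f x)] = f @` E.
  apply/seteqP; split => [x /= Ex|_ [x Ex <-]]; first by exists (f x).
  by rewrite /= ff.
have fA : f @` (f @` A) = A.
  apply/seteqP; split => [_ [_ [x Ax <-] <-]|x Ax]; first by rewrite ff.
  by exists (f x) => //; exists x.
apply/eqP; rewrite eq_le fE hausdorff_image_isometry//=.
by rewrite -[X in (hausdorff d X <= _)%E]fA hausdorff_image_isometry.
Qed.

End hausdorff_borel.

(** * Gauges of convex bodies *)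

Lemma convex_setE (R : realType) (E : lmodType R) (K : set E) :
  convex_set (K : set (convex_lmodType E)) <->
  (forall x y t, K x -> K y -> 0 <= t <= 1 -> K (t *: x + (1 - t) *: y)).
Proof.
split=> [cK x y t Kx Ky t01|cK x y t].
  have := cK x y (Itv01 (andP t01).1 (andP t01).2); rewrite !inE; exact.
rewrite !inE => Kx Ky; apply: cK => //.
by apply/andP; split.
Qed.

Lemma lipschitz_continuous_rV (R : realType) n (f : 'rV[R]_n -> R) (C : R) :
  (forall x y, f x - f y <= C * enorm (x - y)) -> continuous f.
Proof.
move=> fC x; apply: (@cvgrPdist_le _ R^o _ _ (nbhs_filter x) _ _).2 => e e0.
have D0 : 0 < `|C| + 1 by rewrite ltr_wpDl.
have nx : nbhs x (eball x (e / (`|C| + 1))).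
  apply: open_nbhs_nbhs; split; first exact: open_eball.
  by rewrite /eball /= subrr enorm0 divr_gt0.
near=> y.
have xy : (`|C| + 1) * enorm (x - y) <= e.
  have : eball x (e / (`|C| + 1)) y by near: y; exact: nx.
  by rewrite /eball /= -enormN opprB ltr_pdivlMr// mulrC => /ltW.
have CE : C * enorm (x - y) <= e.
  by apply: le_trans xy; rewrite ler_wpM2r ?enorm_ge0// (le_trans (ler_norm C))// lerDl.
rewrite ler_norml lerNl opprB (le_trans (fC x y))// andbT (le_trans (fC y x))//.
by rewrite -enormN opprB.
Unshelve. all: by end_near. Qed.

Section gauge.
Context (R : realType) (n : nat).
Local Notation V := 'rV[R]_n.
Implicit Types (K : set V) (x y : V) (t c : R).

(** The Minkowski functional. Its value 0 at the origin comes from two defaults: the supremum of an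
    unbounded set is 0, and so is the inverse of 0. *)
Definition gauge K x : R := (radial_fun K x)^-1.

Section body.
Variable K : set V.
Hypothesis Kbody : convex_body_o K.

Lemma convex_bodyP x y t : K x -> K y -> 0 <= t <= 1 -> K (t *: x + (1 - t) *: y).
Proof. by case: Kbody => -[_ /convex_setE + _] _; exact. Qed.

Lemma convex_body0 : K 0.
Proof. by case: Kbody => _; exact: nbhs_singleton. Qed.

Lemma convex_body_star x t : K x -> 0 <= t <= 1 -> K (t *: x).
Proof.
by move=> Kx t01; have := convex_bodyP Kx convex_body0 t01; rewrite scaler0 addr0.
Qed.

Lemma convex_body_compact : compact K.
Proof. by case: Kbody => -[]. Qed.

Lemma convex_body_closed : closed K.
Proof. by apply: compact_closed; [exact: norm_hausdorff|exact: convex_body_compact]. Qed.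

Lemma convex_body_inner : exists2 r, 0 < r & forall x, enorm x <= r -> K x.
Proof.
case: Kbody => _; rewrite /interior /= => /nbhs_ballP[e /= e0 eK].
exists (e / 2); first by rewrite divr_gt0.
move=> x xe; apply: eK; split=> // i j; rewrite (ord1 i) -ball_normE /= mxE sub0r normrN.
rewrite (le_lt_trans (ler_norm_coord x j))// (le_lt_trans xe)//.
by rewrite ltr_pdivrMr//; lra.
Qed.

Lemma convex_body_outer : exists2 M, 0 < M & forall x, K x -> enorm x <= M.
Proof.
have [M [_ HM]] := compact_bounded convex_body_compact.
exists (n%:R * (`|M| + 1) + 1) => [|x /(HM (`|M| + 1)) H].
  by rewrite ltr_wpDl// mulr_ge0// addr_ge0.
rewrite (le_trans (enorm_le_norm x))// -[leLHS]addr0 lerD// ler_wpM2l//.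
by apply: H; rewrite (le_lt_trans (ler_norm M))// ltrDl.
Qed.

Let E x : set R := [set r | 0 < r /\ K (r *: x)].

Lemma radial_set_neq0 x : E x !=set0.
Proof.
have [r r0 rK] := convex_body_inner.
have e0 := enorm_ge0 x.
exists (r / (enorm x + 1)); split; first by rewrite divr_gt0//; lra.
apply: rK; rewrite enormZ ger0_norm ?divr_ge0 ?(ltW r0)//; last lra.
by rewrite mulrAC ler_pdivrMr; nra.
Qed.

Lemma radial_set_ubound x : x != 0 -> has_ubound (E x).
Proof.
rewrite -enorm_gt0 => x0; have [M M0 KM] := convex_body_outer.
exists (M / enorm x) => r [r0 /KM]; rewrite enormZ gtr0_norm//.
by rewrite ler_pdivlMr.
Qed.

Lemma radial_fun_gt0 x : x != 0 -> 0 < radial_fun K x.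
Proof.
move=> x0; have [r Er] := radial_set_neq0 x.
by apply: (lt_le_trans Er.1); exact: (ub_le_sup (radial_set_ubound x0)).
Qed.

Lemma radial_fun0 : radial_fun K 0 = 0.
Proof.
apply: sup_out => -[_ [M HM]].
have : E 0 (`|M| + 1) by split; [rewrite ltr_wpDl|rewrite scaler0; exact: convex_body0].
by move=> /HM; rewrite leNgt (le_lt_trans (ler_norm M))// ltrDl.
Qed.

Lemma radial_fun_in x : x != 0 -> K (radial_fun K x *: x).
Proof.
move=> x0; set s := radial_fun K x.
have Es : closure (E x) s.
  by apply: closure_sup; [exact: radial_set_neq0|exact: radial_set_ubound].
have cE : closed [set r : R | K (r *: x)].
  apply: (@preimage_closed _ _ (fun r : R => r *: x)); last exact: convex_body_closed.
  by move=> r _; apply: cvgZr_tmp; exact: cvg_id.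
by apply: cE; apply: closureS Es => r [].
Qed.

Lemma gauge0 : gauge K 0 = 0.
Proof. by rewrite /gauge radial_fun0 invr0. Qed.

Lemma gauge_gt0 x : x != 0 -> 0 < gauge K x.
Proof. by move=> x0; rewrite invr_gt0 radial_fun_gt0. Qed.

Lemma gauge_ge0 x : 0 <= gauge K x.
Proof. by have [->|/gauge_gt0/ltW//] := eqVneq x 0; rewrite gauge0. Qed.

(** Sublevel sets of the gauge are the dilates of [K]; the algebraic properties of the gauge are
    read off from this. *)
Lemma gauge_leP c x : 0 < c -> gauge K x <= c <-> K (c^-1 *: x).
Proof.
move=> c0; have [->|x0] := eqVneq x 0.
  by rewrite gauge0 scaler0 ltW//; split=> // _; exact: convex_body0.
have s0 := radial_fun_gt0 x0; set s := radial_fun K x in s0 *.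
rewrite /gauge -/s -[X in _ <= X]invrK lef_pV2 ?posrE ?invr_gt0//; split => [cs|Kc].
  have -> : c^-1 *: x = (c^-1 / s) *: (s *: x) by rewrite scalerA divfK// gt_eqF.
  apply: convex_body_star; first exact: radial_fun_in.
  apply/andP; split; first by rewrite divr_ge0 ?invr_ge0 ?ltW.
  by rewrite ler_pdivrMr// mul1r.
by apply: (ub_le_sup (radial_set_ubound x0)); split; rewrite ?invr_gt0.
Qed.

Lemma eq_of_le_pos (a b : R) : 0 <= a -> 0 <= b ->
  (forall c, 0 < c -> a <= c <-> b <= c) -> a = b.
Proof.
move=> a0 b0 H; apply/le_anti/andP; split; rewrite leNgt; apply/negP => ab.
  have : a <= (a + b) / 2 by apply/H; rewrite ?ler_pdivlMr//; lra.
  by rewrite ler_pdivlMr//; lra.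
have : b <= (a + b) / 2 by apply/H; rewrite ?ler_pdivlMr//; lra.
by rewrite ler_pdivlMr//; lra.
Qed.

Lemma gaugeZ t x : 0 < t -> gauge K (t *: x) = t * gauge K x.
Proof.
move=> t0; apply: eq_of_le_pos; rewrite ?mulr_ge0 ?gauge_ge0 ?(ltW t0)// => c c0.
rewrite gauge_leP// mulrC -ler_pdivlMr// gauge_leP ?divr_gt0//.
by rewrite scalerA invfM invrK mulrC.
Qed.

Lemma gaugeD x y : gauge K (x + y) <= gauge K x + gauge K y.
Proof.
have [->|x0] := eqVneq x 0; first by rewrite gauge0 !add0r.
have [->|y0] := eqVneq y 0; first by rewrite gauge0 !addr0.
have a0 := gauge_gt0 x0; have b0 := gauge_gt0 y0.
have ab0 : 0 < gauge K x + gauge K y by rewrite addr_gt0.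
apply/gauge_leP => //.
have /(gauge_leP x a0) Kx := lexx (gauge K x).
have /(gauge_leP y b0) Ky := lexx (gauge K y).
set a := gauge K x in a0 ab0 Kx *; set b := gauge K y in b0 ab0 Ky *.
(* [(x + y) / (a + b)] is the convex combination of [x / a] and [y / b] with weights proportional to
   [a] and [b]. *)
have := @convex_bodyP _ _ (a / (a + b)) Kx Ky.
have -> : 1 - a / (a + b) = b / (a + b) by field; rewrite gt_eqF.
have cancel_scale (u : R) (w : V) : 0 < u -> (u / (a + b)) *: (u^-1 *: w) = (a + b)^-1 *: w.
  by move=> u0; rewrite scalerA mulrAC mulfV ?gt_eqF// mul1r.
rewrite !cancel_scale// scalerDr; apply.
apply/andP; split; first by rewrite divr_ge0 ?ltW.
by rewrite ler_pdivrMr// mul1r; lra.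
Qed.

Lemma gauge_enorm_le : exists2 C, 0 < C & forall x, gauge K x <= C * enorm x.
Proof.
have [r r0 rK] := convex_body_inner; exists r^-1; first by rewrite invr_gt0.
move=> x; have [->|x0] := eqVneq x 0; first by rewrite gauge0 enorm0 mulr0.
rewrite -enorm_gt0 in x0; apply/gauge_leP; first by rewrite mulr_gt0 ?invr_gt0.
apply: rK; rewrite enormZ invfM invrK gtr0_norm ?mulr_gt0 ?invr_gt0//.
by rewrite mulfVK ?gt_eqF.
Qed.

Lemma enorm_gauge_le : exists2 M, 0 < M & forall x, enorm x <= M * gauge K x.
Proof.
have [M M0 KM] := convex_body_outer; exists M => // x.
have [->|x0] := eqVneq x 0; first by rewrite gauge0 enorm0 mulr0.
have g0 := gauge_gt0 x0; have /(gauge_leP x g0)/KM := lexx (gauge K x).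
rewrite enormZ ger0_norm; last by rewrite invr_ge0 ltW.
by rewrite ler_pdivrMl// mulrC.
Qed.

Lemma continuous_gauge : continuous (gauge K).
Proof.
have [C C0 HC] := gauge_enorm_le; apply: (lipschitz_continuous_rV (C := C)) => x y.
rewrite (le_trans _ (HC _))// lerBlDr; have := gaugeD (x - y) y; by rewrite subrK.
Qed.

Lemma gauge_like_gauge : gauge_like (gauge K).
Proof.
split; [by apply: continuous_measurable_rV; exact: continuous_gauge|exact: gaugeZ|
  exact: gauge_gt0|exact: gauge0].
Qed.

End body.

Lemma gaugeN K x : convex_body_e K -> gauge K (- x) = gauge K x.
Proof.
move=> [Ko KN]; apply: eq_of_le_pos; rewrite ?gauge_ge0// => c c0.
rewrite !(gauge_leP Ko)// scalerN; rewrite -{1}KN; split=> [[y Ky /oppr_inj <-]//|Kx].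
by exists (c^-1 *: x).
Qed.

End gauge.

(** * Supporting hyperplanes *)

Section support.
Context (R : realType) (n : nat).
Local Notation V := 'rV[R]_n.
Implicit Types (K : set V) (x y z v : V).

Lemma compact_usphere : compact (@usphere R n).
Proof.
apply: bounded_closed_compact.
  exists 1; split=> // r r1 x; rewrite /usphere /= => x1.
  by rewrite (le_trans (ler_norm_enorm x))// x1 ltW.
rewrite (_ : @usphere R n = @enorm R n @^-1` [set 1])//.
apply: preimage_closed; last exact: closed_eq.
by move=> x _; exact: continuous_enorm.
Qed.

(** The direction is that from the point [p] of [K] nearest to [z] towards [z]: a point [y]
    violating [key] would allow a move from [p] towards [y] that comes closer to [z]. *)
Lemma separating_direction K z : K !=set0 -> convex_set (K : set (convex_lmodType V)) ->
  compact K -> ~ K z -> exists2 v, usphere v & forall y, K y -> dotv y v < dotv z v.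
Proof.
move=> K0 /convex_setE cK Kc Kz.
have [|p pK pmin] := @EVT_min_rV R n (fun y => enorm (z - y)) K K0 Kc.
  apply: continuous_subspaceT => y; apply: (@continuous_comp _ _ _ (fun y : V => z - y) (@enorm R n)).
    by apply: continuousB; [exact: cst_continuous|exact: cvg_id].
  exact: continuous_enorm.
have {}pK : K p by exact: set_mem.
set w := z - p.
have w0 : w != 0 by rewrite subr_eq0; apply/eqP => zp; apply: Kz; rewrite zp.
have key y : K y -> dotv (y - p) w <= 0.
  move=> Ky; rewrite leNgt; apply/negP => d0.
  set D := dotv (y - p) (y - p); have D0 : 0 <= D := dotv_ge0 _.
  (* [t D] stays below [dotv (y - p) w], so the linear gain outweighs the quadratic loss; the added
     1 avoids division by 0. *)
  pose t := Num.min 1 (dotv (y - p) w / (D + 1)).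
  have t0 : 0 < t by rewrite lt_min ltr01 divr_gt0//; lra.
  have t1 : t <= 1 by rewrite ge_min lexx.
  have tD : t * (D + 1) <= dotv (y - p) w.
    by rewrite -ler_pdivlMr; [rewrite ge_min lexx orbT|lra].
  have /mem_set/pmin : K (t *: y + (1 - t) *: p) by apply: cK; rewrite // ltW.
  have -> : z - (t *: y + (1 - t) *: p) = w - t *: (y - p).
    by rewrite /w scalerBl scale1r scalerBr !opprD !opprK; apply/rowP => i; rewrite !mxE; ring.
  rewrite -(@ler_pXn2r _ 2)// ?nnegrE ?enorm_ge0// !sqr_enorm.
  have expand (a b : V) (r : R) :
      dotv (a - r *: b) (a - r *: b) = dotv a a - r * (2 * dotv b a - r * dotv b b).
    rewrite dotvDl !dotvDr !dotvNl !dotvNr !dotvZl !dotvZr (dotvC a b); ring.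
  rewrite expand -/D.
  have : 0 < t * (2 * dotv (y - p) w - t * D) by rewrite mulr_gt0//; nra.
  lra.
have ew : 0 < enorm w by rewrite enorm_gt0.
exists ((enorm w)^-1 *: w).
  by rewrite /usphere /= enormZ gtr0_norm ?invr_gt0// mulVf// gt_eqF.
move=> y Ky; rewrite !dotvZr ltr_pM2l ?invr_gt0//.
have := key y Ky; have : 0 < dotv w w by rewrite -sqr_enorm exprn_gt0.
by rewrite {1 2}/w !(dotvDl, dotvNl); lra.
Qed.

(** The points [(1 + 1 / (j + 1)) x] lie outside [K] and can be separated from it; a cluster point
    of the separating directions on the compact sphere supports [K] at [x]. *)
Lemma support_exists K x : convex_body_o K -> K x ->
  (forall t, 1 < t -> ~ K (t *: x)) ->
  exists2 v, usphere v & forall y, K y -> dotv y v <= dotv x v.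
Proof.
move=> Ko Kx Kt; have [[K0 Kconv Kc] _] := Ko.
have /choice[v Hv] (j : nat) : exists v, usphere v /\
    forall y, K y -> dotv y v < dotv ((1 + j.+1%:R^-1) *: x) v.
  have [|v Sv Hv] := @separating_direction K ((1 + j.+1%:R^-1) *: x) K0 Kconv Kc.
    by apply: Kt; rewrite ltrDl invr_gt0.
  by exists v.
have [|v0 [Sv0 clv]] := @compact_usphere (v @ \oo) _.
  by exists 0%N => // j _; exact: (Hv j).1.
exists v0 => // y Ky.
have xv j : dotv x (v j) <= enorm x.
  rewrite (le_trans (dotv_le_enorm _ _))//; have := (Hv j).1.
  by rewrite /usphere /= => ->; rewrite mulr1.
suff H (m : nat) : dotv (y - x) v0 <= enorm x * m.+1%:R^-1.
  rewrite -subr_le0 -dotvNl -dotvDl; apply/ler_addgt0Pr => e e0; rewrite add0r.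
  have e1 : 0 <= enorm x / e by rewrite divr_ge0 ?enorm_ge0 ?ltW.
  apply: (le_trans (H (Num.bound (enorm x / e)))).
  rewrite ler_pdivrMr// mulrC -ler_pdivrMr//.
  by rewrite ltW// (lt_trans (archi_boundP e1))// ltr_nat.
(* The bound of index [m] defines a closed set of directions containing [v j] for all [j >= m],
   hence also the cluster point. *)
have cD : closed [set v | dotv (y - x) v <= enorm x * m.+1%:R^-1].
  rewrite (_ : mkset _ = (fun v => dotv (y - x) v) @^-1` [set r | r <= enorm x * m.+1%:R^-1])//.
  apply: preimage_closed; last exact: closed_le.
  move=> u _; apply: (continuous_big (op := +%R)); first exact: add_continuous.
  by move=> i _ w; apply: continuousM; [exact: cst_continuous|exact: coord_continuous].
apply: cD; move: clv; rewrite clusterE; apply.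
exists m => // j /= mj; rewrite dotvDl dotvNl.
have := (Hv j).2 y Ky; rewrite dotvZl mulrDl mul1r => Hy.
have : j.+1%:R^-1 * dotv x (v j) <= enorm x * m.+1%:R^-1.
  rewrite mulrC; apply: (@le_trans _ _ (enorm x * j.+1%:R^-1)).
    by rewrite ler_wpM2r.
  by rewrite ler_wpM2l ?enorm_ge0// lef_pV2 ?posrE// ler_nat.
by move=> H; rewrite lerBlDl; apply: le_trans (ltW Hy) _; rewrite lerD2l.
Qed.

Lemma support_fun_ubound K v : convex_body_o K -> has_ubound [set dotv v y | y in K].
Proof.
move=> Ko; have [M M0 KM] := convex_body_outer Ko.
exists (enorm v * M) => _ [y Ky <-].
rewrite (le_trans (dotv_le_enorm _ _))// ler_wpM2l ?enorm_ge0//; exact: KM.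
Qed.

(** Every boundary point has an outer normal, so the denominator is an integral over the whole
    sphere. *)
Lemma rev_radial_Gauss_usphere K : convex_body_o K ->
  rev_radial_Gauss K (@usphere R n) = @usphere R n.
Proof.
move=> Ko; apply/seteqP; split=> [u []//|u Su]; split=> //.
have u0 : u != 0 by rewrite -enorm_eq0 Su oner_eq0.
have Kx := radial_fun_in Ko u0.
have [t t1|v Sv Hv] := support_exists Ko Kx.
  rewrite scalerA => Ktu; have s0 := radial_fun_gt0 Ko u0.
  have := ub_le_sup (radial_set_ubound Ko u0) (conj _ Ktu) => /(_ (mulr_gt0 (lt_trans ltr01 t1) s0)).
  by rewrite -/(radial_fun K u) ger_pMl// leNgt t1.
exists v => //; rewrite /supporting_hyperplane /support_fun /=.
apply/le_anti/andP; split.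
  by apply: ub_le_sup; [exact: support_fun_ubound|exists (radial_fun K u *: u) => //; rewrite dotvC].
apply: ge_sup; first by exists (dotv v (radial_fun K u *: u)), (radial_fun K u *: u).
by move=> _ [y Ky <-]; rewrite dotvC; exact: Hv.
Qed.

End support.

(** * Uniformly distributed measures and the sphere *)

Section uniformly_distributed.
Context (R : realType) (n : nat).
Local Notation V := 'rV[R]_n.
Implicit Types (mu nu : {sigma_finite_measure set V -> \bar R}) (S A U W : set V).

Lemma measurable_ball_section nu W r : measurable W ->
  measurable_fun setT (fun x => nu (W `&` eball x r)).
Proof.
move=> mW.
have mf1 : measurable_fun setT (fst : V * V -> V) by exact: measurable_fst.
have mf2 : measurable_fun setT (snd : V * V -> V) by exact: measurable_snd.
pose E := [set p : V * V | W p.2] `&` [set p | (eball 0 r) (p.2 - p.1)].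
have mE : measurable E.
  apply: measurableI; apply: measurable_preim => //; last exact: measurable_eball.
  by apply: measurable_rVD => //; exact: measurable_rVN.
have := measurable_fun_xsection nu mE.
congr (measurable_fun _); apply/funext => x /=; congr (nu _).
by apply/seteqP; split => y; rewrite /xsection /= inE /E /eball /= subr0.
Qed.

(* Integrating [1_(|x - y| < r)] against [mu x nu] in both orders. *)
Lemma uniform_fubini mu nu S W r (a : \bar R) : measurable S -> measurable W ->
  (forall y, S y -> mu (S `&` eball y r) = a) ->
  (\int[mu]_(x in S) nu (S `&` W `&` eball x r) = a * nu (S `&` W))%E.
Proof.
move=> mS mW mua; set SW := S `&` W; have mSW : measurable SW by exact: measurableI.
have mf1 : measurable_fun setT (fst : V * V -> V) by exact: measurable_fst.
have mf2 : measurable_fun setT (snd : V * V -> V) by exact: measurable_snd.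
pose E := [set p : V * V | S p.1] `&` [set p | SW p.2] `&` [set p | (eball 0 r) (p.2 - p.1)].
have mE : measurable E.
  apply: measurableI; first by apply: measurableI; apply: measurable_preim.
  apply: measurable_preim; last exact: measurable_eball.
  by apply: measurable_rVD => //; exact: measurable_rVN.
have swap : (mu \x nu)%E E = (mu \x^ nu)%E E.
  apply: product_measure_unique => // X Y mX mY; exact: product_measure2E.
transitivity ((mu \x nu)%E E).
  rewrite integral_mkcond; apply: eq_integral => x _ /=; rewrite patchE.
  case: ifPn => [/set_mem xS|/negP xS].
    by congr (nu _); apply/seteqP; split => y; rewrite /xsection /= inE /E /eball /= subr0;
      [move=> [? ?]|move=> [[_ ?] ?]].
  rewrite -[LHS](measure0 nu); congr (nu _).
  apply/seteqP; split => y //; rewrite /xsection /= inE /E /= => -[[Sx _] _].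
  by apply: xS; rewrite inE.
rewrite swap /product_measure2.
rewrite (eq_integral (fun y => a * (\1_SW y)%:E)%E); last first.
  move=> y _ /=; rewrite indicE; case: (boolP (y \in SW)) => yS.
    have SWy := set_mem yS.
    rewrite mule1 -(mua y SWy.1); congr (mu _); apply/seteqP; split => x;
      rewrite /ysection /= inE /E /eball /= subr0 -enormN opprB.
      by move=> [[? _] ?].
    by move=> [? ?].
  rewrite mule0 -[RHS](measure0 mu); congr (mu _).
  apply/seteqP; split => x //; rewrite /ysection /= inE => -[[_ By] _].
  by move: yS; rewrite notin_setE.
(* The hypothesis ties [a] to a measure, and so to a sign, only when there is a point to evaluate it
   at. *)
have a0 : (0 <= a)%E \/ SW = set0.
  have [->|/set0P[y [Sy _]]] := eqVneq SW set0; first by right.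
  by left; rewrite -(mua y Sy).
case: a0 => [a0|SW0]; last first.
  rewrite SW0 measure0 mule0 integral0_eq// => y _.
  by rewrite indicE in_set0 mule0.
by rewrite ge0_integralZl ?integral_indic ?setIT//; exact: measurableT_comp.
Qed.

(* Balls of one radius have the same measure for each of [mu] and [nu], hence
   [b r * mu S = a r * nu S]; on the points of [U] at distance at least [r] from
   the complement, [uniform_fubini] gives the inequality. *)
Lemma uniform_open_le mu nu S U (a b : R -> \bar R) :
  measurable S -> open U -> (mu S < +oo)%E -> (nu S < +oo)%E ->
  (forall (r : R) y, 0 < r -> S y -> mu (S `&` eball y r) = a r) ->
  (forall (r : R) y, 0 < r -> S y -> nu (S `&` eball y r) = b r) ->
  (forall r : R, 0 < r -> (0 < b r)%E) ->
  (mu (S `&` U) * nu S <= nu (S `&` U) * mu S)%E.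
Proof.
move=> mS oU muS nuS mua nub b0.
have mU : measurable U by exact: open_measurable_rV.
have [->|/set0P[y0 Sy0]] := eqVneq S set0; first by rewrite set0I !measure0 mule0.
have bfin r : 0 < r -> (b r < +oo)%E.
  move=> r0; rewrite -(nub r y0 r0 Sy0); apply: le_lt_trans nuS.
  by apply: le_measure; rewrite ?inE//; apply: measurableI => //; exact: measurable_eball.
have ab r : 0 < r -> (b r * mu S = a r * nu S)%E.
  move=> r0; have := uniform_fubini nu mS measurableT (fun y => mua r y r0).
  rewrite setIT => <-.
  rewrite (eq_integral (cst (b r)))// ?integral_cst// => x /set_mem Sx.
  exact: nub.
pose Uj (j : nat) := S `&` ~` \bigcup_(y in ~` U) eball y j.+1%:R^-1.
have mUj j : measurable (Uj j).
  apply: measurableI => //; apply: measurableC; apply: open_measurable_rV.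
  by apply: bigcup_open => y _; exact: open_eball.
have UjP j x : Uj j x -> eball x j.+1%:R^-1 `<=` U.
  move=> [Sx H] y xy; apply: contrapT => Uy; apply: H; exists y => //.
  by move: xy; rewrite /eball /= -enormN opprB.
have UjU : \bigcup_j Uj j = S `&` U.
  apply/seteqP; split=> [x [j _ Ux]|x [Sx Ux]].
    split; first by case: Ux.
    by apply: (UjP j x Ux); rewrite /eball /= subrr enorm0 invr_gt0.
  have /nbhs_ballP[e /= e0 eU] : nbhs x U by exact: open_nbhs_nbhs.
  exists (Num.bound e^-1) => //; split=> // -[y Uy]; rewrite /eball /= => xy.
  apply: Uy; apply: eU; split=> // i j; rewrite (ord1 i) -ball_normE /=.
  have := ler_norm_coord (x - y) j; rewrite !mxE => H.
  rewrite (le_lt_trans H)// (lt_trans xy)// invf_plt ?posrE//.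
  by rewrite (lt_trans (archi_boundP _)) ?invr_ge0 ?(ltW e0)// ltr_nat.
have ndUj : nondecreasing_seq Uj.
  move=> j k jk; apply/subsetPset => x [Sx H]; split=> // -[y Uy xy]; apply: H.
  exists y => //; rewrite /eball /= in xy *; apply: lt_le_trans xy _.
  by rewrite lef_pV2 ?posrE// ler_nat.
have bound j : (mu (Uj j) * nu S <= nu (S `&` U) * mu S)%E.
  set r := j.+1%:R^-1 : R; have r0 : 0 < r by rewrite invr_gt0.
  have br : b r \is a fin_num by rewrite ge0_fin_numE ?bfin// ltW// b0.
  rewrite -(@lee_pmul2l _ (b r))// ?b0//.
  rewrite [X in (_ <= X)%E]muleA [X in (_ <= X * _)%E]muleC -muleA ab//.
  rewrite [X in (_ <= X)%E]muleA [X in (_ <= X * _)%E]muleC muleA.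
  apply: lee_wpmul2r => //.
  rewrite -(uniform_fubini nu mS mU (fun y => mua r y r0)).
  apply: (@le_trans _ _ (\int[mu]_(x in Uj j) nu (S `&` U `&` eball x r))%E).
    (* Around a point of [Uj j] the ball of radius [r] lies in [U], so intersecting with [U] loses
       nothing. *)
    rewrite (eq_integral (cst (b r))) ?integral_cst// => x /set_mem Ux.
    rewrite /= -(nub r x r0 Ux.1) -setIA; congr (nu (_ `&` _)).
    by rewrite setIidr//; exact: UjP.
  apply: ge0_subset_integral => //; last by move=> x [].
  by apply: measurable_funTS; apply: measurable_ball_section; exact: measurableI.
have cv : (mu (Uj j) * nu S @[j --> \oo] --> mu (S `&` U) * nu S)%E.
  rewrite -UjU; apply: cvgeMr; first by rewrite ge0_fin_numE.
  apply: nondecreasing_cvg_mu => //; exact: bigcup_measurable.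
rewrite -(cvg_lim _ cv)//; apply: lime_le; first exact: cvgP cv.
exact: nearW.
Qed.

End uniformly_distributed.

(** * Reflections and the measure of the sphere *)

Section reflections.
Context (R : realType) (n : nat).
Local Notation V := 'rV[R]_n.

(** The reflection in the hyperplane orthogonal to [w = x - y]. Equality of the norms gives
    [dotv w w = 2 * dotv x w], which makes it send [x] to [y]; its matrix is symmetric, hence also
    an involution. *)
Lemma householder (x y : V) : enorm x = enorm y ->
  exists O : 'M[R]_n, [/\ O *m O^T = 1%:M, O *m O = 1%:M & x *m O = y].
Proof.
move=> xy; have [->|w0] := eqVneq x y.
  by exists 1%:M; split; rewrite ?trmx1 ?mulmx1.
have [w wE] : exists w, w = x - y by exists (x - y).
have ww : dotv w w != 0 by rewrite dotv_eq0 wE subr_eq0.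
have wwE : w *m w^T = (dotv w w)%:M.
  by rewrite [LHS]mx11_scalar dotvE.
set c := 2 / dotv w w; pose O : 'M[R]_n := 1%:M - c *: (w^T *m w).
have OT : O^T = O.
  by rewrite /O linearB /= trmx1 linearZ /= trmx_mul trmxK.
have OO : O *m O = 1%:M.
  rewrite /O mulmxBl mul1mx mulmxBr mulmx1 -scalemxAl -scalemxAr.
  rewrite mulmxA -(mulmxA w^T) wwE mul_mx_scalar -scalemxAl !scalerA.
  have -> : c * (c * dotv w w) = c + c by rewrite /c; field.
  by rewrite scalerDl opprB addrK subrK.
exists O; rewrite OT; split=> //.
rewrite /O mulmxBr mulmx1 -scalemxAr mulmxA.
have -> : x *m w^T = (dotv x w)%:M by rewrite [LHS]mx11_scalar dotvE.
rewrite mul_scalar_mx scalerA.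
have -> : c * dotv x w = 1.
  have xyE : dotv x x = dotv y y by rewrite -!sqr_enorm xy.
  have wwx : dotv w w = 2 * dotv x w.
    rewrite wE !(dotvDl, dotvDr, dotvNl, dotvNr) (dotvC y x) xyE; ring.
  by rewrite /c mulrAC -wwx mulfV.
by rewrite scale1r wE opprB addrCA subrr addr0.
Qed.

End reflections.

Section sphere.
Context (R : realType) (n : nat).
Local Notation V := 'rV[R]_n.
Local Notation S := (@usphere R n).
Local Notation lam := (lebesgue_rV R n).
Implicit Types (A U : set V) (x y : V).

(** The origin is sent to itself, off the sphere, so cones over subsets of the sphere avoid it. *)
Definition direction x : V := (enorm x)^-1 *: x.

Lemma measurable_direction : measurable_fun setT direction.
Proof.
rewrite (_ : direction = fun x => (enorm x) `^ (- 1) *: x); last first.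
  by apply/funext => x; rewrite powR_inv1 ?enorm_ge0.
apply: measurable_rVZ; last exact: measurable_id.
exact: (measurableT_comp (measurable_powR (- 1)) (@measurable_enorm R n)).
Qed.

Lemma measurable_usphere : measurable S.
Proof. by apply: closed_measurable_rV; apply: compact_closed; [exact: norm_hausdorff|exact: compact_usphere]. Qed.

Lemma direction_usphere x : x != 0 -> S (direction x).
Proof.
rewrite -enorm_gt0 => x0; rewrite /usphere /direction /= enormZ gtr0_norm ?invr_gt0//.
by rewrite mulVf// gt_eqF.
Qed.

Lemma direction_mulmx (O : 'M[R]_n) x : O *m O^T = 1%:M ->
  direction (x *m O) = direction x *m O.
Proof. by move=> OO; rewrite /direction enorm_mulmx// scalemxAl. Qed.

Lemma eball_mulmx (O : 'M[R]_n) x y r : O *m O^T = 1%:M -> x *m O = y ->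
  forall z, eball y r (z *m O) <-> eball x r z.
Proof. by move=> OO <- z; rewrite /eball /= -mulmxBl enorm_mulmx. Qed.

Lemma usphere_mulmx (O : 'M[R]_n) z : O *m O^T = 1%:M -> S (z *m O) <-> S z.
Proof. by move=> OO; rewrite /usphere /= enorm_mulmx. Qed.

Definition cone_ball A : set V := [set z | enorm z < 1 /\ A (direction z)].

Lemma measurable_cone_ball A : measurable A -> measurable (cone_ball A).
Proof.
move=> mA; apply: measurableI; last exact: measurable_preim measurable_direction mA.
have := measurable_eball (0 : V) 1; congr measurable.
by apply/seteqP; split => z; rewrite /eball /= subr0.
Qed.

Lemma lebesgue_cone_ball_lty A : measurable A -> (lam (cone_ball A) < +oo)%E.
Proof.
move=> mA; apply: (lebesgue_rV_bounded (r := 1)); first exact: measurable_cone_ball.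
by move=> z i [z1 _]; rewrite (le_trans (ler_norm_coord z i))// ltW.
Qed.

Lemma lebesgue_cone_eball x y r : S x -> S y ->
  lam (cone_ball (S `&` eball x r)) = lam (cone_ball (S `&` eball y r)).
Proof.
move=> Sx Sy; have [|O [OO _ xy]] := @householder R n x y.
  by rewrite Sx Sy.
have mC : measurable (cone_ball (S `&` eball y r)).
  by apply: measurable_cone_ball; apply: measurableI; [exact: measurable_usphere|exact: measurable_eball].
rewrite -[RHS](lebesgue_rV_orthogonal OO mC); congr (lam _); apply/seteqP.
split=> z; rewrite /cone_ball /= direction_mulmx// enorm_mulmx//;
  have [H1 H2] := eball_mulmx r OO xy (direction z); have [H3 H4] := usphere_mulmx (direction z) OO.
  by move=> [? [? ?]]; do 2?split=> //; auto.
by move=> [? [? ?]]; do 2?split=> //; auto.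
Qed.

Lemma lebesgue_cone_eball_gt0 x r : S x -> 0 < r ->
  (0 < lam (cone_ball (S `&` eball x r)))%E.
Proof.
(* A ball of radius [e] around [x / 2] fits in the cone: there [|z| < 3 / 4], and [direction z] is
   within [2 e] of [2 z], which is within [2 e] of [x]. *)
move=> Sx r0; pose e := Num.min (r / 4) (1 / 4).
have e0 : 0 < e by rewrite lt_min !divr_gt0.
have er : e <= r / 4 by rewrite ge_min lexx.
have e4 : e <= 1 / 4 by rewrite ge_min lexx orbT.
case/andP: (lebesgue_rV_eball (2^-1 *: x) e0) => + _.
move/lt_le_trans; apply; apply: le_measure; rewrite ?inE.
- exact: measurable_eball.
- by apply: measurable_cone_ball; apply: measurableI; [exact: measurable_usphere|exact: measurable_eball].
move=> z; rewrite /eball /= => zx.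
have x1 : enorm x = 1 by exact: Sx.
have hx : enorm (2^-1 *: x) = 2^-1 by rewrite enormZ x1 mulr1 ger0_norm// invr_ge0.
have z1 : enorm z < 2^-1 + e.
  by have := enormD (z - 2^-1 *: x) (2^-1 *: x); rewrite subrK hx; lra.
have z2 : 2^-1 - e < enorm z.
  by have := enormD (2^-1 *: x - z) z; rewrite subrK hx -enormN opprB; lra.
have z0 : 0 < enorm z by lra.
have zn : z != 0 by rewrite -enorm_gt0.
split; [by rewrite /=; lra|split; first exact: direction_usphere].
rewrite /eball /=; have -> : direction z - x = (direction z - 2 *: z) + 2 *: (z - 2^-1 *: x).
  by rewrite scalerBr scalerA mulfV ?scale1r// addrA subrK.
rewrite (le_lt_trans (enormD _ _))// enormZ ger0_norm//.
have -> : direction z - 2 *: z = (1 - 2 * enorm z) *: direction z.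
  by rewrite /direction scalerBl scale1r scalerA -mulrA mulfV ?mulr1// gt_eqF.
rewrite enormZ (direction_usphere zn) mulr1.
have : `|1 - 2 * enorm z| < 2 * e by rewrite ltr_norml; lra.
lra.
Qed.

End sphere.

Section sphere_measure.
Context (R : realType) (n d : nat).
Local Notation V := 'rV[R]_n.
Local Notation S := (@usphere R n).
Local Notation lam := (lebesgue_rV R n).
Local Notation H := (@hausdorff_measure R n d).
Implicit Types (A U : set V) (x y : V).

Lemma measurable_caratheodory_borel A : measurable A ->
  measurable (A : set (caratheodory_type (@hausdorff R n d))).
Proof.
by move=> mA; have := measurable_caratheodory_id (d := d) measurableT mA; rewrite setTI.
Qed.

Lemma integral_mrestr_id d' (T : measurableType d') (mu : {measure set T -> \bar R})
    (B A : set T) (mB : measurable B) (f : T -> \bar R) :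
  measurable A -> A `<=` B ->
  (\int[mrestr mu mB]_x (f \_ A) x = \int[mu]_(x in A) f x)%E.
Proof.
move=> mA AB; rewrite -integral_mkcond.
apply: (eq_measure_integral mu) => C mC CA /=; rewrite /mrestr setIidl//.
exact: subset_trans AB.
Qed.

Lemma integral_mrestr d' (T : measurableType d') (mu : {measure set T -> \bar R})
    (B : set T) (mB : measurable B) (f : T -> \bar R) :
  measurable_fun setT f -> (forall t, 0 <= f t)%E ->
  (\int[mrestr mu mB]_x f x = \int[mu]_(x in B) f x)%E.
Proof.
move=> mf f0; rewrite [LHS](ge0_negligible_integral (N := ~` B))//=; first last.
- by rewrite /mrestr setICl measure0.
- exact: measurableC.
rewrite setDE setCK setTI; apply: (eq_measure_integral mu) => C mC CB.
by rewrite /= /mrestr setIidl.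
Qed.

Lemma finite_measure_packing d' (T : measurableType d') (mu : {measure set T -> \bar R}) :
  (mu setT < +oo)%E ->
  exists nu : {sigma_finite_measure set T -> \bar R}, forall B : set T, nu B = mu B.
Proof.
move=> muT; apply: sigma_finite_packing; exists (fun=> setT) => //.
by rewrite bigcup_const.
Qed.

Lemma hausdorff_usphere_eball x y r : S x -> S y ->
  hausdorff d (S `&` eball x r) = hausdorff d (S `&` eball y r).
Proof.
move=> Sx Sy; have [|O [OOT OO xy]] := @householder R n x y.
  by rewrite Sx Sy.
rewrite -(@hausdorff_involution R n d (fun z => z *m O) (S `&` eball y r)).
- congr (hausdorff d _); apply/seteqP.
  by split=> z /= [? ?]; split; rewrite ?usphere_mulmx//;
    [apply/(eball_mulmx r OOT xy)|apply/(usphere_mulmx z OOT)|apply/(eball_mulmx r OOT xy z)].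
- by move=> z; rewrite -mulmxA OO mulmx1.
- by move=> z w; rewrite -mulmxBl enorm_mulmx.
Qed.

(** Both sides are finite Borel measures on the sphere giving equal mass to balls of equal radius
    centred on it. [uniform_open_le] in both directions yields proportionality on open sets, which
    generate the Borel sets and are stable under intersection. *)
Lemma hausdorff_cone : (0 < hausdorff d S < +oo)%E ->
  exists2 c : R, 0 < c & forall A, measurable A ->
    hausdorff d (A `&` S) = (c%:E * lam (cone_ball (A `&` S)))%E.
Proof.
move=> /andP[S0 Soo]; have mS := @measurable_usphere R n.
have [y0 Sy0] : S !=set0.
  by apply/set0P/eqP => S_0; move: S0; rewrite S_0 hausdorff0 ltxx.
have mSH := measurable_caratheodory_borel mS.
have mC := measurable_cone_ball mS.
have [mu0 mu0E] := pushforward_measure (mrestr H mSH) (measurable_caratheodory_id (d := d)).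
have [nu0 nu0E] := pushforward_measure (mrestr lam mC) (@measurable_direction R n).
have mu0S A : mu0 A = hausdorff d (A `&` S) by rewrite mu0E.
have nu0S A : nu0 A = lam (cone_ball (A `&` S)).
  rewrite nu0E /= /mrestr; congr (lam _); apply/seteqP.
  by split=> z; rewrite /cone_ball /= => -[? [? ?]].
have [|mu muE] := @finite_measure_packing _ _ mu0; first by rewrite mu0S setTI.
have [|nu nuE] := @finite_measure_packing _ _ nu0.
  by rewrite nu0S setTI; exact: lebesgue_cone_ball_lty.
pose a r := mu (S `&` eball y0 r); pose b r := nu (S `&` eball y0 r).
have mua r y : 0 < r -> S y -> mu (S `&` eball y r) = a r.
  move=> r0 Sy; rewrite /a !muE !mu0S ![_ `&` _ `&` S]setIAC !setIid.
  exact: hausdorff_usphere_eball.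
have nub r y : 0 < r -> S y -> nu (S `&` eball y r) = b r.
  move=> r0 Sy; rewrite /b !nuE !nu0S ![_ `&` _ `&` S]setIAC !setIid.
  exact: lebesgue_cone_eball.
have muSE : mu S = hausdorff d S by rewrite muE mu0S setIid.
have nuSE : nu S = lam (cone_ball S) by rewrite nuE nu0S setIid.
have muS : (mu S < +oo)%E by rewrite muSE.
have nuS : (nu S < +oo)%E by rewrite nuSE lebesgue_cone_ball_lty.
have b0 r : 0 < r -> (0 < b r)%E.
  move=> r0; rewrite /b nuE nu0S setIAC setIid; exact: lebesgue_cone_eball_gt0.
have nuS0 : (0 < nu S)%E.
  apply: (lt_le_trans (b0 1 ltr01)); apply: le_measure; rewrite ?inE//.
  by apply: measurableI => //; exact: measurable_eball.
have oT : open [set: V] by exact: openT.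
have mSU U : open U -> measurable (S `&` U).
  by move=> oU; apply: measurableI => //; exact: open_measurable_rV.
(* Positivity of the Hausdorff mass of balls is required when the two measures exchange roles; it
   follows from that of the cones by Fubini. *)
have a0 r : 0 < r -> (0 < a r)%E.
  move=> r0; rewrite lt_def measure_ge0 andbT; apply/eqP => ar0.
  have := uniform_fubini nu mS measurableT (fun y => mua r y r0).
  rewrite setIT ar0 mul0e.
  rewrite (eq_integral (cst (b r))) ?integral_cst//; last by move=> x /set_mem Sx; exact: nub.
  move=> bS0; have : (0 < b r * mu S)%E by rewrite mule_gt0 ?b0// muSE.
  by rewrite bS0 ltxx.
have open_eq U : open U -> (mu (S `&` U) * nu S = nu (S `&` U) * mu S)%E.
  move=> oU; apply/eqP; rewrite eq_le; apply/andP; split.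
    exact: (uniform_open_le (a := a) (b := b)).
  exact: (uniform_open_le (a := b) (b := a)).
have nuSf : nu S \is a fin_num by rewrite ge0_fin_numE.
have muSf : mu S \is a fin_num by rewrite ge0_fin_numE.
have nuS0' : 0 < fine (nu S) by rewrite fine_gt0// nuS0.
have muS0' : 0 < fine (mu S) by rewrite fine_gt0// muS andbT muSE.
exists (fine (mu S) / fine (nu S)); first by rewrite divr_gt0.
have c0 : 0 <= fine (mu S) / fine (nu S) by rewrite divr_ge0// ltW.
move=> A mA; rewrite -mu0S -nu0S -nuE -muE.
rewrite -[_ / _]/((NngNum c0)%:num).
have := @measure_unique _ R V (@open V) (fun=> setT) erefl _ (fun=> oT) _ mu
  (mscale (NngNum c0) nu) _ _ A mA; apply.
- exact: openI.
- by rewrite bigcup_const.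
- move=> U oU.
  have := open_eq U oU; rewrite setIC.
  have muUE : mu (U `&` S) = mu U by rewrite !muE !mu0S -setIA setIid.
  have nuUE : nu (U `&` S) = nu U by rewrite !nuE !nu0S -setIA setIid.
  rewrite muUE nuUE => E; rewrite -[LHS]mule1.
  have -> : 1%E = (nu S * ((fine (nu S))^-1)%:E)%E.
    by rewrite -{1}(fineK nuSf) -EFinM mulfV// gt_eqF.
  by rewrite muleA E -{1}(fineK muSf) -muleA -EFinM muleC.
- by move=> _; rewrite -[X in (X < _)%E]/(mu setT) muE mu0S setTI.
Qed.

Lemma sphere_integral : (0 < hausdorff d S < +oo)%E ->
  exists2 c : R, 0 < c & forall A (f : V -> \bar R), measurable A -> A `<=` S ->
    measurable_fun setT f -> (forall t, 0 <= f t)%E ->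
    (\int[H]_(u in A) f u = c%:E * \int[lam]_(x in cone_ball A) f (direction x))%E.
Proof.
move=> HS; have [c c0 cE] := hausdorff_cone HS; exists c => // A f mA AS mf f0.
have mS := @measurable_usphere R n.
have mSH := measurable_caratheodory_borel mS.
have mC := measurable_cone_ball mS.
have [nu nuE] := pushforward_measure (mrestr lam mC) (@measurable_direction R n).
have mg : measurable_fun setT (f \_ A) by apply/(measurable_restrictT _ mA); exact: measurable_funTS.
have g0 x : (0 <= (f \_ A) x)%E by rewrite patchE; case: ifP.
have nuS B : nu B = lam (cone_ball (B `&` S)).
  rewrite nuE /= /mrestr; congr (lam _); apply/seteqP.
  by split=> z; rewrite /cone_ball /= => -[? [? ?]].
rewrite -(integral_mrestr_id _ mSH)//; last exact: measurable_caratheodory_borel.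
have -> := ge0_integral_scaled_pushforward (mu1 := mrestr H mSH) (mu2 := nu)
  (measurable_caratheodory_id (d := d)) (ltW c0) _ mg g0; last first.
  by move=> B mB; rewrite nuS -cE.
congr (_ * _)%E.
have := ge0_integral_scaled_pushforward (mu1 := mrestr lam mC) (mu2 := nu)
  (@measurable_direction R n) ler01 _ mg g0.
rewrite mul1e => <-; last by move=> B mB; rewrite nuE mul1e.
rewrite integral_mrestr//; last by exact: measurableT_comp mg (@measurable_direction R n).
rewrite [RHS]integral_mkcond [LHS]integral_mkcond; apply: eq_integral => z _; rewrite !patchE.
case: ifPn => [/set_mem[z1 Sz]|zC]; rewrite ?patchE.
  congr (if _ then _ else _); apply/idP/idP; rewrite !inE => //.
  by move=> -[].
by rewrite ifN//; apply: contra zC; rewrite !inE => -[? /AS].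
Qed.

End sphere_measure.

(** * Orthonormal bases adapted to a subspace *)

Section orthonormal_bases.
Context (R : realType) (n : nat).
Local Notation V := 'rV[R]_n.
Implicit Types (L W : {vspace V}).

(** Dimension count: on [W] the map [x -> x *m A^T] has rank at most [k < \dim W], so its kernel is
    nonzero. *)
Lemma orthogonal_unit_vector W k (A : 'M[R]_(k, n)) : (k < \dim W)%N ->
  exists v : V, [/\ v \in W, v *m v^T = 1%:M & A *m v^T = 0].
Proof.
move=> kW; pose f := linfun (mulmxr A^T : V -> 'rV[R]_k).
have fE x : f x = x *m A^T by rewrite lfunE.
pose U := (W :&: lker f)%VS.
have U0 : U != 0%VS.
  rewrite -dimv_eq0 -lt0n -(ltn_add2r (\dim (f @: W))%VS) add0n limg_ker_dim.
  apply: leq_ltn_trans kW; apply: leq_trans (dimvS (subvf _)) _.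
  by rewrite dimvf /dim /= mul1n.
have /memv_capP[uW] := memv_pick U; rewrite memv_ker fE => /eqP uA.
set u := vpick U in uW uA.
have u0 : u != 0 by rewrite vpick0.
have e0 : enorm u != 0 by rewrite enorm_eq0.
exists ((enorm u)^-1 *: u); split; first exact: memvZ.
  rewrite [LHS]mx11_scalar -dotvE dotvZl dotvZr -sqr_enorm; congr (_%:M).
  by field.
by apply: trmx_inj; rewrite trmx_mul trmxK -scalemxAl uA scaler0 trmx0.
Qed.

Lemma orthonormal_extension l W k (A : 'M[R]_(k, n)) : (k + l)%N = \dim W ->
  exists B : 'M[R]_(l, n),
    [/\ forall i, row i B \in W, B *m B^T = 1%:M & A *m B^T = 0].
Proof.
elim: l k A => [|l IH] k A klW.
  exists 0; split; first by move=> [].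
    by apply/matrixP => -[].
  by rewrite trmx0 mulmx0.
have [|v [vW vv Av]] := @orthogonal_unit_vector W k A; first by rewrite -klW -[X in (X < _)%N]addn0 ltn_add2l.
have [|B [BW BB]] := IH _ (col_mx A v); first by rewrite addn1 -klW addnS.
rewrite mul_col_mx => /eqP; rewrite col_mx_eq0 => /andP[/eqP AB /eqP vB].
have Bv : B *m v^T = 0 by apply: trmx_inj; rewrite trmx_mul trmxK vB trmx0.
have rowW (i : 'I_(1 + l)) : row i (col_mx v B) \in W.
  by case: (split_ordP i) => j ->; rewrite ?rowKd// rowKu (ord1 j) row_id.
have rowI : col_mx v B *m (col_mx v B)^T = 1%:M.
  by rewrite tr_col_mx mul_col_row vv BB vB Bv -scalar_mx_block.
have rowA : A *m (col_mx v B)^T = 0 by rewrite tr_col_mx mul_mx_row Av AB row_mx0.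
by exists (col_mx v B).
Qed.

(** The dimensions are returned as [k] and [l] with an equation, so that substituting for [n] turns
    vectors into concatenations of an [L]-part and an orthogonal part. *)
Lemma orthonormal_basis L : exists k l (O : 'M[R]_(k + l, n)),
  [/\ k = \dim L, (k + l)%N = n, O *m O^T = 1%:M &
      forall x, x \in L -> exists w : 'rV_k, x = row_mx w 0 *m O].
Proof.
set k := \dim L; have kn : (k <= n)%N.
  by have := dimvS (subvf L); rewrite dimvf /dim /= mul1n.
have [B [BL BB _]] := @orthonormal_extension k L 0 0 (add0n _).
have [|C [_ CC BC]] := @orthonormal_extension (n - k) fullv k B.
  by rewrite dimvf /dim /= mul1n subnKC.
have CB : C *m B^T = 0 by apply: trmx_inj; rewrite trmx_mul trmxK BC trmx0.
exists k, (n - k)%N, (col_mx B C); split=> //; first by rewrite subnKC.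
  by rewrite tr_col_mx mul_col_row BB CC BC CB -scalar_mx_block.
pose g := linfun (mulmxr B : 'rV[R]_k -> V).
have gE w : g w = w *m B by rewrite lfunE.
have kerg : lker g == 0%VS.
  rewrite -subv0; apply/subvP => w; rewrite memv_ker gE memv0 => /eqP wB.
  by rewrite -[w]mulmx1 -BB mulmxA wB mul0mx.
have imgL : (limg g == L)%VS.
  rewrite eqEdim limg_dim_eq; last by rewrite (eqP kerg) capv0.
  rewrite dimvf /dim /= mul1n leqnn andbT; apply/subvP => _ /memv_imgP[w _ ->].
  by rewrite gE mulmx_sum_row memv_suml// => i _; exact: memvZ.
move=> x; rewrite -(eqP imgL) => /memv_imgP[w _ ->]; exists w.
by rewrite gE mul_row_col mul0mx addr0.
Qed.

End orthonormal_bases.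

(** * Slices parallel to the orthogonal complement *)

Lemma lebesgue_integral_scale (R : realType) l (c : R) (f : 'rV[R]_l -> \bar R) :
  0 < c -> measurable_fun setT f -> (forall z, 0 <= f z)%E ->
  (\int[lebesgue_rV R l]_z f z =
   (c ^+ l)%:E * \int[lebesgue_rV R l]_z f (c *: z)%R)%E.
Proof.
move=> c0 mf f0.
rewrite (ge0_integral_scaled_pushforward (mu2 := lebesgue_rV R l) (g := fun z : 'rV[R]_l => c *: z)
  (c := c ^- l))//.
- by rewrite muleA -EFinM mulfV ?mul1e// expf_neq0// gt_eqF.
- by apply: measurable_rVZ => //; exact: measurable_id.
- by rewrite invr_ge0 exprn_ge0// ltW.
- by move=> A mA; exact: lebesgue_rV_scale.
Qed.

(** The combination with weights [t] and [1 - t] of the two points on the right is [(2 t - 1) a],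
    and with weights exchanged [(2 t - 1) b]. The triangle inequality and the convexity of the power
    bound each, and the weights add up to 1. *)
Lemma power_mean_combination (R : realType) n (a b : 'rV[R]_n) (t p : R) :
  0 <= t <= 1 -> 1 / 2 <= t -> 1 <= p ->
  (2 * t - 1) `^ p * (enorm a `^ p + enorm b `^ p) <=
  enorm (t *: a - (1 - t) *: b) `^ p + enorm (t *: b - (1 - t) *: a) `^ p.
Proof.
move=> /andP[t0 t1] t2 p1; set A := t *: a - _; set B := t *: b - _.
have p0 : 0 <= p by lra.
have half (x y : 'rV[R]_n) : (2 * t - 1) `^ p * enorm x `^ p <=
    t * enorm (t *: x - (1 - t) *: y) `^ p + (1 - t) * enorm (t *: y - (1 - t) *: x) `^ p.
  rewrite -powRM ?enorm_ge0//; last lra.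
  set X := t *: x - _; set Y := t *: y - _.
  have -> : (2 * t - 1) * enorm x = enorm (t *: X + (1 - t) *: Y).
    have -> : t *: X + (1 - t) *: Y = (2 * t - 1) *: x.
      by apply/rowP => i; rewrite !mxE; ring.
    by rewrite enormZ ger0_norm//; lra.
  apply: (@le_trans _ _ ((t * enorm X + (1 - t) * enorm Y) `^ p)).
    apply: ge0_ler_powR => //; rewrite ?nnegrE ?enorm_ge0//.
      by rewrite addr_ge0// mulr_ge0 ?enorm_ge0//; lra.
    by rewrite (le_trans (enormD _ _))// !enormZ !ger0_norm//; lra.
  have := @convex_powR R p p1 (Itv01 t0 t1) (enorm X) (enorm Y).
  by rewrite !inE /= !in_itv /= !andbT; apply; exact: enorm_ge0.
rewrite mulrDr; apply: le_trans (lerD (half a b) (half b a)) _; rewrite {}/A {}/B.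
move: (_ `^ p) (enorm (t *: b - _) `^ p) => u v; lra.
Qed.

Lemma power_mean_combination_scaled (R : realType) n (a b : 'rV[R]_n) (s c t p : R) :
  0 < s -> 0 < c -> 2 * t - 1 = s * c -> 0 <= t <= 1 -> 1 <= p ->
  s `^ p * enorm a `^ p + s `^ p * enorm b `^ p <=
  (c `^ p)^-1 * enorm (t *: a - (1 - t) *: b) `^ p +
  (c `^ p)^-1 * enorm (t *: b - (1 - t) *: a) `^ p.
Proof.
move=> s0 c0 t2 t01 p1; have sc : 0 < s * c by rewrite mulr_gt0.
have th : 1 / 2 <= t by lra.
have := power_mean_combination a b t01 th p1; rewrite t2 powRM ?(ltW s0) ?(ltW c0)//.
move: (enorm (t *: a - _) `^ p) (enorm (t *: b - _) `^ p) => u v.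
move: (enorm a `^ p) (enorm b `^ p) => x y H.
rewrite -!mulrDr ler_pdivlMl ?powR_gt0// mulrA (mulrC (c `^ p))//.
Qed.

Lemma dotv_row_mx (R : realType) k l (y y' : 'rV[R]_k) (z z' : 'rV[R]_l) :
  dotv (row_mx y z) (row_mx y' z') = dotv y y' + dotv z z'.
Proof.
rewrite /dotv big_split_ord /=; congr (_ + _); apply: eq_bigr => i _.
  by rewrite !row_mxEl.
by rewrite !row_mxEr.
Qed.

Definition norm_like (R : realType) n (N : 'rV[R]_n -> R) :=
  [/\ gauge_like N, (forall x y, N (x + y) <= N x + N y), (forall x, N (- x) = N x),
      (exists2 C, 0 < C & forall x, N x <= C * enorm x) &
      (exists2 M, 0 < M & forall x, enorm x <= M * N x)].

Section slices.
Context (R : realType) (k l : nat).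
Variables (N : 'rV[R]_(k + l) -> R) (p : R).
Hypothesis N_norm : norm_like N.
Hypothesis p1 : 1 <= p.
Local Notation lamk := (lebesgue_rV R k).
Local Notation laml := (lebesgue_rV R l).
Local Notation lam := (lebesgue_rV R (k + l)).
Implicit Types (y : 'rV[R]_k) (z : 'rV[R]_l) (s t : R).

Definition ball_slice y : \bar R := (\int[laml]_z
  (if N (row_mx y z) < 1 then enorm (row_mx y z) `^ p else 0)%R%:E)%E.

Definition level_slice y s : \bar R := (\int[laml]_z
  (if N (row_mx y z) == s then enorm (row_mx y z) `^ p else 0)%R%:E)%E.

Let p0 : 0 <= p. Proof. by rewrite (le_trans ler01). Qed.

Let N_gauge : gauge_like N. Proof. by case: N_norm. Qed.

Let ND (x y : 'rV[R]_(k + l)) : N (x + y) <= N x + N y. Proof. by case: N_norm. Qed.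

Let NZ t x : 0 < t -> N (t *: x) = t * N x.
Proof. by case: N_gauge => _ + _ _; exact. Qed.

Let mN : measurable_fun setT N. Proof. by case: N_gauge. Qed.

Let mW d (T : measurableType d) (f : T -> 'rV[R]_(k + l)) :
  measurable_fun setT f -> measurable_fun setT (fun u => enorm (f u) `^ p).
Proof.
move=> mf; apply: (measurableT_comp (measurable_powR p)).
exact: (measurableT_comp (@measurable_enorm R _) mf).
Qed.

Let mrow y : measurable_fun setT (fun z => row_mx y z).
Proof. by apply: measurable_row_mx => //; exact: measurable_id. Qed.

Let continuous_slice y : continuous (fun z => N (row_mx y z)).
Proof.
have [_ _ _ [C _ NC] _] := N_norm; apply: (lipschitz_continuous_rV (C := C)) => z z'.
have -> : enorm (z - z') = enorm (row_mx y z - row_mx y z').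
  by rewrite opp_row_mx add_row_mx subrr /enorm dotv_row_mx dotv0l add0r.
apply: le_trans (NC _); rewrite lerBlDr.
by have := ND (row_mx y z - row_mx y z') (row_mx y z'); rewrite subrK.
Qed.

(* For [a], [b] in the open slice [{N < c}] above [y] and [t = (1 + s c) / 2], the
   point [t a - (1 - t) b] lies above [s c y] and has [N < c], as [N] is even.
   Shrinking by [c > 1] brings it to the slice of [{N < 1}] above [s y]. *)
Let level_slice_le_scaled y s c : 0 < s -> 1 < c -> s * c <= 1 ->
  ((s `^ p)%:E * level_slice y 1 <= (c ^+ l)%:E * ball_slice (s *: y))%E.
Proof.
move=> s0 c1 sc1; have c0 : 0 < c by rewrite (lt_trans ltr01).
pose t := (1 + s * c) / 2.
have sc0 : 0 < s * c by rewrite mulr_gt0.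
have t01 : 0 <= t <= 1.
  by apply/andP; split; rewrite ?divr_ge0 ?ler_pdivrMr//; lra.
have t2 : 2 * t - 1 = s * c by rewrite /t; field.
(* The open set to which [symmetric_open_inequality] applies; it contains the level set [{N = 1}]
   because [c > 1]. *)
pose U : set 'rV[R]_l := [set z | N (row_mx y z) < c].
have oU : open U.
  rewrite (_ : U = (fun z => N (row_mx y z)) @^-1` `]-oo, c[%classic).
    by apply: open_comp; [move=> z _; exact: continuous_slice|exact: interval_open].
  by apply/seteqP; split => z; rewrite /= in_itv.
pose f z : \bar R := (s `^ p * enorm (row_mx y z) `^ p)%:E.
pose h z : \bar R := (if N (row_mx ((s * c) *: y) z) < c
  then (c `^ p)^-1 * enorm (row_mx ((s * c) *: y) z) `^ p else 0)%:E.
have mf : measurable_fun setT f.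
  by apply/measurable_EFinP; apply: measurable_funM => //; exact: mW.
have mh : measurable_fun setT h.
  apply/measurable_EFinP; apply: measurable_fun_ifT => //.
    by apply: measurable_fun_ltr => //; exact: measurableT_comp.
  by apply: measurable_funM => //; exact: mW.
have f0 z : (0 <= f z)%E by rewrite lee_fin mulr_ge0 ?powR_ge0.
have h0 z : (0 <= h z)%E.
  by rewrite lee_fin; case: ifP => // _; rewrite mulr_ge0 ?invr_ge0 ?powR_ge0.
have key z z' : U z -> U z' -> (f z + f z' <=
    h (t *: z - (1 - t) *: z')%R + h (t *: z' - (1 - t) *: z)%R)%E.
  move=> Uz Uz'; pose a := row_mx y z; pose b := row_mx y z'.
  have rowE (u u' : 'rV[R]_l) : row_mx ((s * c) *: y) (t *: u - (1 - t) *: u') =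
      t *: row_mx y u - (1 - t) *: row_mx y u'.
    rewrite !scale_row_mx opp_row_mx add_row_mx -scalerBl -t2; congr row_mx.
    by congr (_ *: _); ring.
  have Nlt u u' : U u -> U u' -> N (t *: row_mx y u - (1 - t) *: row_mx y u') < c.
    move=> Uu Uu'; have t0 : 0 < t by lra.
    have NN : forall x, N (- x) = N x by case: N_norm.
    have := ND (t *: row_mx y u) (- ((1 - t) *: row_mx y u')); rewrite NN NZ//.
    have -> : N ((1 - t) *: row_mx y u') = (1 - t) * N (row_mx y u').
      (* The weight [1 - t] vanishes when [s c = 1], where positive homogeneity says nothing. *)
      have [t1|t1] := ltP t 1; first by rewrite NZ// subr_gt0.
      have -> : 1 - t = 0 by lra.
      by rewrite scale0r mul0r; case: N_gauge.
    move: Uu Uu'; rewrite /U /=; set u1 := N (row_mx y u); set u2 := N (row_mx y u').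
    by move=> H1 H2 H3; apply: le_lt_trans H3 _; nra.
  rewrite /h (rowE z z') (rowE z' z) (Nlt _ _ Uz Uz') (Nlt _ _ Uz' Uz).
  exact: (power_mean_combination_scaled (row_mx y z) (row_mx y z') s0 c0 t2 t01 p1).
have := symmetric_open_inequality t01 oU mf mh f0 h0 key.
rewrite (lebesgue_integral_scale c0 mh h0) => H.
apply: (@le_trans _ _ (\int[laml]_(z in U) f z)%E).
  rewrite /level_slice -ge0_integralZl//.
  - rewrite [leRHS]integral_mkcond; apply: ge0_le_integral => //.
    + by move=> z _; rewrite mule_ge0// lee_fin ?powR_ge0//; case: ifP => _ //; rewrite powR_ge0.
    + apply: emeasurable_funM => //; apply/measurable_EFinP.
      apply: measurable_fun_ifT => //; last exact: mW.
      by apply: measurable_fun_eqr => //; exact: measurableT_comp.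
    + by apply/(measurable_restrictT _ (open_measurable_rV oU)); exact: measurable_funTS.
    move=> z _; rewrite patchE; case: eqP => [Nz|_]; last by rewrite mule0; case: ifP.
    by rewrite mem_set ?EFinM// /U /= Nz.
  - apply/measurable_EFinP; apply: measurable_fun_ifT => //; last exact: mW.
    by apply: measurable_fun_eqr => //; exact: measurableT_comp.
  - by move=> z _; rewrite lee_fin; case: ifP => // _; rewrite powR_ge0.
  - by rewrite lee_fin powR_ge0.
(* The dilation [z -> c z] has contributed [c ^+ l]; the power [p] of [c] is cancelled by the factor
   built into [h]. *)
apply: (le_trans H); rewrite le_eqVlt; apply/orP; left; apply/eqP; congr (_ * _)%E.
apply: eq_integral => z _; rewrite /h.
have -> : row_mx ((s * c) *: y) (c *: z) = c *: row_mx (s *: y) z.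
  by rewrite scale_row_mx scalerA (mulrC c).
rewrite NZ// gtr_pMr//; case: ifP => // _; congr EFin.
rewrite enormZ gtr0_norm// powRM ?enorm_ge0 ?(ltW c0)// mulKf// gt_eqF//.
exact: powR_gt0.
Qed.

(** The limit of the scaled inequality as [c] decreases to 1; it may be taken because the right-hand
    side is finite, the infinite case being trivial. *)
Lemma level_slice_le y s : 0 < s < 1 ->
  ((s `^ p)%:E * level_slice y 1 <= ball_slice (s *: y))%E.
Proof.
move=> /andP[s0 s1].
have [|] := ltP (ball_slice (s *: y)) +oo%E; last by move=> /(le_trans (leey _)).
have b0 : (0 <= ball_slice (s *: y))%E.
  by apply: integral_ge0 => z _; rewrite lee_fin; case: ifP => // _; rewrite powR_ge0.
move=> boo; have bfin : ball_slice (s *: y) \is a fin_num by rewrite ge0_fin_numE.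
apply/lee_addgt0Pr => e e0; set r := fine (ball_slice (s *: y)).
have cvr : c ^+ l * r @[c --> 1^'+] --> 1 ^+ l * r.
  by apply: cvg_at_right_filter; apply: cvgM; [exact: exprn_continuous|exact: cvg_cst].
rewrite expr1n mul1r in cvr.
have re : r < r + e by rewrite ltrDl.
have H := cvgr_lt _ cvr _ re; near (at_right (1 : R)) => c.
have c1 : 1 < c by near: c; exact: nbhs_right_gt.
have sc : s * c <= 1.
  rewrite -ler_pdivlMl// mulr1; apply/ltW; near: c; apply: nbhs_right_lt.
  by rewrite invf_gt1.
apply: (le_trans (level_slice_le_scaled y s0 c1 sc)).
rewrite -(fineK bfin) -EFinM -EFinD lee_fin; apply/ltW.
by near: c; exact: H.
Unshelve. all: by end_near. Qed.

Let measurable_level y s : measurable_fun setT (fun z =>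
  (if N (row_mx y z) == s then enorm (row_mx y z) `^ p else 0)%R%:E).
Proof.
apply/measurable_EFinP; apply: measurable_fun_ifT => //; last exact: mW.
by apply: measurable_fun_eqr => //; exact: measurableT_comp.
Qed.

Let level_ge0 y s z :
  (0 <= (if N (row_mx y z) == s then enorm (row_mx y z) `^ p else 0)%R%:E)%E.
Proof. by rewrite lee_fin; case: ifP => // _; rewrite powR_ge0. Qed.

Lemma level_sliceZ y s t : 0 < t ->
  level_slice (t *: y) (t * s) = ((t ^+ l * t `^ p)%:E * level_slice y s)%E.
Proof.
move=> t0; rewrite [LHS](lebesgue_integral_scale t0 (measurable_level _ _) (level_ge0 _ _)).
rewrite EFinM -muleA; congr (_ * _)%E; rewrite -ge0_integralZl//.
- apply: eq_integral => z _; rewrite -scale_row_mx NZ// -EFinM; congr EFin.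
  rewrite (inj_eq (mulfI (lt0r_neq0 t0)) (N (row_mx y z)) s).
  case: (N (row_mx y z) == s); last by rewrite mulr0.
  by rewrite enormZ gtr0_norm// powRM ?enorm_ge0// ltW.
- by rewrite lee_fin powR_ge0.
Qed.

(** Rescaling level [s] to level 1 produces [s ^+ l] and the power [p] of [s]; the latter is
    absorbed by [level_slice_le]. *)
Lemma level_slice_ball y s : 0 < s < 1 ->
  (level_slice y s <= (s ^+ l)%:E * ball_slice y)%E.
Proof.
move=> s01; have /andP[s0 _] := s01.
have yE : y = s *: (s^-1 *: y) by rewrite scalerA mulfV ?scale1r// gt_eqF.
rewrite {1}yE -[X in level_slice _ X]mulr1 level_sliceZ// EFinM -muleA.
apply: lee_wpmul2l; first by rewrite lee_fin exprn_ge0// ltW.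
by rewrite [in leRHS]yE; exact: level_slice_le.
Qed.

(** The set [{N = 1}] lies in the Euclidean ball of radius [M], which bounds both the integrand and
    the slices at level 1; homogeneity gives the other levels. *)
Lemma level_slice_ub : exists2 C, 0 < C & forall y s, 0 < s ->
  (level_slice y s <= (s ^+ l * s `^ p * C)%:E)%E.
Proof.
have [_ _ _ _ [M M0 NM]] := N_norm.
pose B := eball (0 : 'rV[R]_l) (M + 1).
have M1 : 0 < M + 1 by rewrite addr_gt0.
have /andP[B0 Boo] := lebesgue_rV_eball (0 : 'rV[R]_l) M1.
have Bfin : laml B \is a fin_num by rewrite ge0_fin_numE.
exists (M `^ p * fine (laml B)) => [|y s s0].
  by rewrite mulr_gt0 ?powR_gt0// fine_gt0// B0 Boo.
have yE : y = s *: (s^-1 *: y) by rewrite scalerA mulfV ?scale1r// gt_eqF.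
rewrite yE -[X in level_slice _ X]mulr1 level_sliceZ// [leRHS]EFinM.
apply: lee_wpmul2l; first by rewrite lee_fin mulr_ge0 ?powR_ge0 ?exprn_ge0// ltW.
set y' := s^-1 *: y; rewrite EFinM fineK// -integral_cst//; last exact: measurable_eball.
rewrite [leRHS]integral_mkcond; apply: ge0_le_integral => //.
- apply/(measurable_restrictT _ (measurable_eball _ _)); exact: measurable_cst.
move=> z _; rewrite patchE; case: eqP => [Nz|_]; last first.
  by case: ifP => // _; rewrite lee_fin powR_ge0.
have zM : enorm (row_mx y' z) <= M by rewrite (le_trans (NM _))// Nz mulr1.
rewrite mem_set; first by rewrite lee_fin ge0_ler_powR ?nnegrE ?enorm_ge0// ltW.
rewrite /B /eball /= subr0 (@le_lt_trans _ _ M)//; last by rewrite ltrDl.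
by apply: le_trans zM; rewrite /enorm ler_wsqrtr// dotv_row_mx lerDr dotv_ge0.
Qed.

(** For [y] near 0 the slice contains a fixed ball around a point [z0] other than 0, on which the
    integrand is bounded below by a positive constant. With [r = 1 / (2 C)], points of norm below
    [2 r] satisfy [N < 1]. *)
Lemma ball_slice_lb : (0 < l)%N -> exists e eta, [/\ 0 < e, 0 < eta &
  forall y, enorm y < e -> (eta%:E <= ball_slice y)%E].
Proof.
move=> l0; have [_ _ _ [C C0 NC] _] := N_norm.
pose r := (2 * C)^-1; have r0 : 0 < r by rewrite invr_gt0 mulr_gt0.
pose u : 'rV[R]_l := const_mx 1.
have u0 : 0 < enorm u.
  rewrite enorm_gt0; apply/eqP => /rowP/(_ (Ordinal l0)); rewrite !mxE => /eqP.
  by rewrite oner_eq0.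
pose z0 := (r / 2 / enorm u) *: u.
have z0E : enorm z0 = r / 2.
  rewrite enormZ ger0_norm; last by rewrite !divr_ge0// ltW.
  by rewrite divfK// gt_eqF.
have r4 : 0 < r / 4 by rewrite divr_gt0.
have /andP[B0 Boo] := lebesgue_rV_eball z0 r4.
have Bfin : laml (eball z0 (r / 4)) \is a fin_num by rewrite ge0_fin_numE.
exists r, ((r / 4) `^ p * fine (laml (eball z0 (r / 4)))); split=> //.
  by rewrite mulr_gt0 ?powR_gt0// fine_gt0// B0 Boo.
move=> y yr; rewrite EFinM fineK// -integral_cst//; last exact: measurable_eball.
rewrite [leLHS]integral_mkcond; apply: ge0_le_integral => //.
- by move=> z _; rewrite patchE; case: ifP => // _; rewrite lee_fin powR_ge0.
- apply/(measurable_restrictT _ (measurable_eball _ _)); exact: measurable_cst.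
- apply/measurable_EFinP; apply: measurable_fun_ifT => //; last exact: mW.
  by apply: measurable_fun_ltr => //; exact: measurableT_comp.
move=> z _; rewrite patchE; case: ifPn => [/set_mem|_]; last first.
  by rewrite lee_fin; case: ifP => // _; rewrite powR_ge0.
rewrite /eball /= => zr.
have z1 := enormD (z - z0) z0; have z2 := enormD (z0 - z) z.
rewrite !subrK -?(enormN (z0 - z)) ?opprB z0E in z1 z2.
have rowE : row_mx y z = row_mx y 0 + row_mx 0 z by rewrite add_row_mx addr0 add0r.
have ey : enorm (row_mx y 0 : 'rV[R]_(k + l)) = enorm y.
  by rewrite /enorm dotv_row_mx dotv0l addr0.
have ez : enorm (row_mx 0 z : 'rV[R]_(k + l)) = enorm z.
  by rewrite /enorm dotv_row_mx dotv0l add0r.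
have x1 : enorm (row_mx y z) < 2 * r.
  by rewrite rowE (le_lt_trans (enormD _ _))// ey ez; lra.
have -> : N (row_mx y z) < 1.
  rewrite (le_lt_trans (NC _))// -ltr_pdivlMl// mulr1 (lt_le_trans x1)//.
  by rewrite /r invfM mulrA mulfV// mul1r.
rewrite lee_fin ge0_ler_powR ?nnegrE ?enorm_ge0// ?ltW//.
have : enorm z <= enorm (row_mx y z) by rewrite /enorm ler_wsqrtr// dotv_row_mx lerDr dotv_ge0.
lra.
Qed.

End slices.

Lemma lebesgue_integral_split (R : realType) k l (f : 'rV[R]_(k + l) -> \bar R) :
  measurable_fun setT f -> (forall x, 0 <= f x)%E ->
  (\int[lebesgue_rV R (k + l)]_x f x =
   \int[lebesgue_rV R k]_y \int[lebesgue_rV R l]_z f (row_mx y z))%E.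
Proof.
move=> mf f0; pose g (q : 'rV[R]_k * 'rV[R]_l) := row_mx q.1 q.2.
have mg : measurable_fun setT g.
  by apply: measurable_row_mx; [exact: measurable_fst|exact: measurable_snd].
have mfg : measurable_fun setT (fun q => f (g q)) by exact: measurableT_comp.
have := ge0_integral_scaled_pushforward (mu1 := (lebesgue_rV R k \x lebesgue_rV R l)%E)
  (mu2 := lebesgue_rV R (k + l)) mg ler01 _ mf f0.
rewrite mul1e => <-; last by move=> A mA; rewrite mul1e; exact: lebesgue_rV_split.
exact: (fubini_tonelli1 (m1 := lebesgue_rV R k) (m2 := lebesgue_rV R l) (fun q => f (g q))).
Qed.

(** * The inequality for the integrals over the body *)

Section body_inequality.
Context (R : realType) (k l : nat).
Variables (N : 'rV[R]_(k + l) -> R) (NM : 'rV[R]_k -> R) (p : R).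
Hypothesis N_norm : norm_like N.
Hypothesis NM_gauge : gauge_like NM.
Hypothesis NM_ub : exists2 C, 0 < C & forall y, NM y <= C * enorm y.
Hypothesis p1 : 1 <= p.
Hypothesis l0 : (0 < l)%N.
Local Notation lamk := (lebesgue_rV R k).
Local Notation laml := (lebesgue_rV R l).
Local Notation lam := (lebesgue_rV R (k + l)).
Implicit Types (y : 'rV[R]_k) (z : 'rV[R]_l).

Let mN : measurable_fun setT N. Proof. by case: N_norm => -[]. Qed.

Let mNM : measurable_fun setT NM. Proof. by case: NM_gauge. Qed.

Let p0 : 0 < p. Proof. by rewrite (lt_le_trans ltr01). Qed.

Let mW d (T : measurableType d) (f : T -> 'rV[R]_(k + l)) :
  measurable_fun setT f -> measurable_fun setT (fun u => enorm (f u) `^ p).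
Proof.
move=> mf; apply: (measurableT_comp (measurable_powR p)).
exact: (measurableT_comp (@measurable_enorm R _) mf).
Qed.

Let mrow : measurable_fun setT (fun q : 'rV[R]_k * 'rV[R]_l => row_mx q.1 q.2).
Proof. by apply: measurable_row_mx; [exact: measurable_fst|exact: measurable_snd]. Qed.

Let G y := level_slice N p y (NM y).

Let F y := ball_slice N p y.

Let G_ge0 y : (0 <= G y)%E.
Proof. by apply: integral_ge0 => z _; rewrite lee_fin; case: eqP => _ //; rewrite powR_ge0. Qed.

Let F_ge0 y : (0 <= F y)%E.
Proof. by apply: integral_ge0 => z _; rewrite lee_fin; case: ltP => _ //; rewrite powR_ge0. Qed.

Let measurable_G : measurable_fun setT G.
Proof.
apply: (measurable_fun_fubini_tonelli_F (m2 := laml) (fun q : 'rV[R]_k * 'rV[R]_l =>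
  (if N (row_mx q.1 q.2) == NM q.1 then enorm (row_mx q.1 q.2) `^ p else 0)%R%:E)); last first.
  by move=> q; rewrite lee_fin; case: eqP => _ //; rewrite powR_ge0.
apply/measurable_EFinP; apply: measurable_fun_ifT => //; last exact: mW.
apply: measurable_fun_eqr; first exact: measurableT_comp.
by apply: measurableT_comp => //; exact: measurable_fst.
Qed.

Let measurable_F : measurable_fun setT F.
Proof.
apply: (measurable_fun_fubini_tonelli_F (m2 := laml) (fun q : 'rV[R]_k * 'rV[R]_l =>
  (if N (row_mx q.1 q.2) < 1 then enorm (row_mx q.1 q.2) `^ p else 0)%R%:E)); last first.
  by move=> q; rewrite lee_fin; case: ltP => _ //; rewrite powR_ge0.
apply/measurable_EFinP; apply: measurable_fun_ifT => //; last exact: mW.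
by apply: measurable_fun_ltr => //; exact: measurableT_comp.
Qed.

Let G0 : G 0 = 0%E.
Proof.
have [_ _ Npos _] : gauge_like N by case: N_norm.
apply: integral0_eq => z _; have [_ _ _ ->] := NM_gauge; case: eqP => // N0.
have [->|/Npos] := eqVneq (row_mx 0 z : 'rV[R]_(k + l)) 0; last by rewrite N0 ltxx.
by rewrite enorm0 powR0// gt_eqF.
Qed.

Let a : R := p + (k + l)%:R.
Let b : R := p + k%:R.
(* Homogeneous of degree [- k], so that [polar_exchange] trades the exponent
   [p + k + l] against [p + k], which costs the factor [NM y ^- l]. *)
Let f y : \bar R := (G y * (NM y `^ (- a))%:E)%E.

Let a1 : 1 <= a. Proof. by rewrite (le_trans p1)// lerDl. Qed.

Let b1 : 1 <= b. Proof. by rewrite (le_trans p1)// lerDl. Qed.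

Let NM_gt0 y : y != 0 -> 0 < NM y. Proof. by case: NM_gauge => _ _ + _; exact. Qed.

Let f_cutpow_a y : (f y * (cutpow NM a y)%:E =
  a%:E * (if (NM y < 1)%R then G y else 0))%E.
Proof.
have an : a != 0 by rewrite gt_eqF// (lt_le_trans ltr01).
have [->|y0] := eqVneq y 0.
  by rewrite cutpow0// mule0 G0 if_same mule0.
have s0 := NM_gt0 y0; rewrite /f /cutpow; case: ltP => _; last by rewrite !mule0.
rewrite -muleA -EFinM powRN mulrCA mulVf ?mulr1; last by rewrite gt_eqF// powR_gt0.
exact: muleC.
Qed.

(** [Q] is [NM y ^- l * G y] where [NM y < 1], and 0 elsewhere and at the origin. The bound by [F y]
    gives the inequality, and the other bound, small near the origin, its strictness. *)
Let f_cutpow_b y : exists2 Q : \bar R, (f y * (cutpow NM b y)%:E = b%:E * Q)%E &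
  [/\ (0 <= Q)%E, (Q <= F y)%E & forall C : R, (forall y s, 0 < s ->
    (level_slice N p y s <= (s ^+ l * s `^ p * C)%:E)%E) -> 0 <= C ->
    NM y < 1 -> (Q <= (NM y `^ p * C)%:E)%E].
Proof.
have bn : b != 0 by rewrite gt_eqF// (lt_le_trans ltr01).
have [->|y0] := eqVneq y 0.
  exists 0%E; first by rewrite cutpow0// !mule0.
  by split=> // C _ C0 _; rewrite lee_fin mulr_ge0 ?powR_ge0.
have s0 := NM_gt0 y0; rewrite /f /cutpow; case: ltP => s1; last first.
  by exists 0%E; rewrite ?mule0; split.
have sl0 : 0 < NM y ^+ l by rewrite exprn_gt0.
exists ((NM y ^- l)%:E * G y)%E.
  rewrite -muleA -EFinM [RHS]muleA -EFinM [RHS]muleC; congr (_ * _%:E)%E.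
  rewrite powRN.
  have -> : a = b + l%:R by rewrite /a /b natrD addrA.
  rewrite powRD; last by rewrite (gt_eqF s0) implybT.
  have sb : 0 < NM y `^ b by rewrite powR_gt0.
  by rewrite powR_mulrn ?(ltW s0)//; field; rewrite !gt_eqF.
split.
- by rewrite mule_ge0// lee_fin invr_ge0 ltW.
- rewrite -(@lee_pmul2l _ (NM y ^+ l)%:E)// muleA -EFinM mulfV ?gt_eqF// mul1e.
  by apply: level_slice_ball => //; rewrite s0 s1.
move=> C HC C0 _; rewrite -(@lee_pmul2l _ (NM y ^+ l)%:E)// muleA -EFinM.
by rewrite mulfV ?gt_eqF// mul1e -EFinM mulrA; exact: HC.
Qed.

Let fZ t y : 0 < t -> f (t *: y) = ((t ^- k)%:E * f y)%E.
Proof.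
move=> t0; have [_ NMZ _ _] := NM_gauge.
rewrite /f /G NMZ// level_sliceZ// powRM ?(ltW t0) ?(gauge_like_ge0 _ NM_gauge)//.
rewrite [X in (_ * X)%E]EFinM muleACA -EFinM; congr (_%:E * _)%E.
rewrite powRN; have -> : a = p + (k%:R + l%:R) by rewrite /a natrD.
rewrite !powRD; try by rewrite (gt_eqF t0) implybT.
have tp : 0 < t `^ p by rewrite powR_gt0.
by rewrite !powR_mulrn ?(ltW t0)//; field; rewrite !expf_neq0 ?gt_eqF.
Qed.

Let diag_integral : (\int[lam]_x (if (N x < 1) && (N x == NM (lsubmx x))
    then enorm x `^ p else 0)%R%:E = \int[lamk]_y (if (NM y < 1)%R then G y else 0))%E.
Proof.
rewrite lebesgue_integral_split; last 2 first.
- apply/measurable_EFinP; apply: measurable_fun_ifT => //; last first.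
    by apply: mW; exact: measurable_id.
  apply: measurable_and; first by apply: measurable_fun_ltr.
  apply: measurable_fun_eqr => //; apply: measurableT_comp => //.
  by apply: measurable_fun_rV => i; under eq_fun do rewrite mxE; exact: measurable_coord.
- by move=> x; rewrite lee_fin; case: ifP => _ //; rewrite powR_ge0.
apply: eq_integral => y _; case: ltP => s1.
  apply: eq_integral => z _; rewrite row_mxKl; congr EFin.
  by case: (N _ =P NM y) => [->|_]; rewrite ?s1// andbF.
apply: integral0_eq => z _; rewrite row_mxKl.
by case: (N _ =P NM y) => [->|_]; rewrite ?andbF// ltNge s1.
Qed.

Let ball_integral : (\int[lam]_x (if N x < 1 then enorm x `^ p else 0)%R%:E =
  \int[lamk]_y F y)%E.
Proof.
rewrite lebesgue_integral_split//.
- apply/measurable_EFinP; apply: measurable_fun_ifT => //; last first.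
    by apply: mW; exact: measurable_id.
  by apply: measurable_fun_ltr.
- by move=> x; rewrite lee_fin; case: ifP => _ //; rewrite powR_ge0.
Qed.

Lemma ball_integral_lty :
  (\int[lam]_x (if N x < 1 then enorm x `^ p else 0)%R%:E < +oo)%E.
Proof.
have [_ _ _ _ [M M0 NMx]] := N_norm.
pose B := [set x | N x < 1].
have mB : measurable B.
  rewrite (_ : B = N @^-1` `]-oo, 1[%classic); last first.
    by apply/seteqP; split => x; rewrite /= in_itv.
  by rewrite -[X in measurable X]setTI; exact: mN.
have BM x : B x -> enorm x <= M.
  by rewrite /B /= => x1; rewrite (le_trans (NMx x))// ger_pMr// ltW.
apply: (@le_lt_trans _ _ (\int[lam]_(x in B) (M `^ p)%:E)%E).
  rewrite [leRHS]integral_mkcond; apply: ge0_le_integral => //.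
  - by move=> x _; rewrite lee_fin; case: ifP => _ //; rewrite powR_ge0.
  - apply/measurable_EFinP; apply: measurable_fun_ifT => //; last first.
      by apply: mW; exact: measurable_id.
    by apply: measurable_fun_ltr.
  - by apply/(measurable_restrictT _ mB).
  move=> x _; rewrite patchE; case: ltP => x1; last by case: ifP => // _; rewrite lee_fin powR_ge0.
  by rewrite mem_set// lee_fin ge0_ler_powR ?nnegrE ?enorm_ge0 ?(ltW p0) ?(ltW M0)// BM.
rewrite integral_cst// lte_mul_pinfty ?lee_fin ?powR_ge0//.
by apply: (lebesgue_rV_bounded (r := M)) => // x i /BM; exact: le_trans (ler_norm_coord x i).
Qed.

(* The inequality is strict because for [y] near 0 the left-hand integrand is
   [O(NM y `^ p)], whereas [F y] is bounded away from 0. *)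
Theorem slice_inequality :
  ((p + (k + l)%:R)%:E * \int[lam]_x (if (N x < 1) && (N x == NM (lsubmx x))
      then enorm x `^ p else 0)%R%:E <
   (p + k%:R)%:E * \int[lam]_x (if N x < 1 then enorm x `^ p else 0)%R%:E)%E.
Proof.
have IK := ball_integral_lty; rewrite ball_integral in IK *; rewrite diag_integral.
have [C C0 HC] := level_slice_ub N_norm p1.
have [e [eta [e0 eta0 Feta]]] := ball_slice_lb N_norm p1 l0.
have [D D0 NMD] := NM_ub.
(* [delta] makes [C * NM y <= eta / 2] where [F y >= eta], and [r] ensures [NM y < delta] on a
   Euclidean ball. *)
pose delta := Num.min 1 (eta / 2 / C); pose r := Num.min e (delta / D).
have delta0 : 0 < delta by rewrite lt_min ltr01 !divr_gt0.
have r0 : 0 < r by rewrite lt_min e0 divr_gt0.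
pose E := eball (0 : 'rV[R]_k) r.
have mE : measurable E by exact: measurable_eball.
have /andP[E0 Eoo] := lebesgue_rV_eball (0 : 'rV[R]_k) r0.
have Er y : E y -> enorm y < r by rewrite /E /eball /= subr0.
have ENM y : E y -> NM y < delta.
  move=> /Er yr; rewrite (le_lt_trans (NMD y))// -ltr_pdivlMl// mulrC.
  by rewrite (lt_le_trans yr)// ge_min lexx orbT.
pose H y := (f y * (cutpow NM b y)%:E)%E.
have b0 : 0 < b by rewrite (lt_le_trans ltr01).
have e20 : 0 < eta / 2 by rewrite divr_gt0.
have HF y : (H y + (b * (eta / 2))%:E * (\1_E y)%:E <= b%:E * F y)%E.
  have [Q HQ [Q0 QF QC]] := f_cutpow_b y; rewrite /H HQ indicE.
  case: (boolP (y \in E)) => [/set_mem Ey|_]; last first.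
    by rewrite mule0 adde0 lee_pmul2l.
  rewrite mule1 EFinM -muleDr//; last by rewrite ge0_adde_def// inE ?lee_fin ltW.
  rewrite lee_pmul2l//; apply: le_trans (Feta y _); last first.
    by rewrite (lt_le_trans (Er y Ey))// ge_min lexx.
  have sd := ENM y Ey; have s0 := gauge_like_ge0 y NM_gauge.
  have s1 : NM y < 1 by rewrite (lt_le_trans sd)// ge_min lexx.
  rewrite [leRHS](_ : _ = ((eta / 2)%:E + (eta / 2)%:E)%E); last first.
    by rewrite -EFinD -splitr.
  apply: leeD => //; apply: (le_trans (QC C HC (ltW C0) s1)); rewrite lee_fin.
  (* The power [p >= 1] of a number below 1 does not exceed that number. *)
  rewrite -ler_pdivlMr// (@le_trans _ _ (NM y))//.
    have [->|sn] := eqVneq (NM y) 0; first by rewrite powR0// gt_eqF.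
    have sp : 0 < NM y by rewrite lt_def sn s0.
    by rewrite -[leRHS]powRr1// ger_powR// sp ltW.
  by rewrite (le_trans (ltW sd))// ge_min lexx orbT.
have mf : measurable_fun setT f.
  apply: emeasurable_funM => //; apply/measurable_EFinP.
  exact: (measurableT_comp (measurable_powR (- a)) mNM).
have f0 y : (0 <= f y)%E by rewrite mule_ge0// lee_fin powR_ge0.
have mH : measurable_fun setT H.
  apply: emeasurable_funM => //; apply/measurable_EFinP.
  by apply: measurable_cutpow => //; exact: measurable_id.
have H0 y : (0 <= H y)%E.
  by apply: mule_ge0; [exact: f0|rewrite lee_fin cutpow_ge0 ?(ltW b0)].
have mG1 : measurable_fun setT (fun y => if (NM y < 1)%R then G y else 0%E).
  by apply: measurable_fun_ifT => //; apply: measurable_fun_ltr.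
have a0 : 0 <= a by rewrite (le_trans ler01).
(* Here the exchange keeps the gauge [NM] and only replaces the exponent [a] by [b]. *)
have -> : ((p + (k + l)%:R)%:E * \int[lamk]_y (if (NM y < 1)%R then G y else 0) =
    \int[lamk]_y H y)%E.
  rewrite -ge0_integralZl//; last by move=> y _; case: ifP.
  rewrite -(polar_exchange NM_gauge NM_gauge a1 b1 mf f0 fZ).
  by apply: eq_integral => y _; rewrite f_cutpow_a.
have ineq : (\int[lamk]_y H y + (b * (eta / 2))%:E * lamk E <= b%:E * \int[lamk]_y F y)%E.
  have eb : (0 <= (b * (eta / 2))%:E)%E by rewrite lee_fin ltW// mulr_gt0.
  rewrite -[X in (_ * lamk X)%E]setIT -integral_indic// -!ge0_integralZl//; last 2 first.
  - by rewrite lee_fin ltW.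
  - by apply/measurable_EFinP; exact: measurable_indic.
  have mI : measurable_fun setT (fun y => ((b * (eta / 2))%:E * (\1_E y)%:E)%E).
    apply: emeasurable_funM => //; apply/measurable_EFinP; exact: measurable_indic.
  have I0 y : (0 <= (b * (eta / 2))%:E * (\1_E y)%:E)%E by rewrite mule_ge0// lee_fin.
  rewrite -ge0_integralD//; apply: ge0_le_integral => //.
  - by move=> y _; rewrite adde_ge0.
  - exact: emeasurable_funD.
  - by apply: emeasurable_funM.
(* Adding a positive term is strict only if the integral of [H] is finite; [HF] and the finiteness
   of the integral of [F] give this. *)
apply: lt_le_trans ineq; rewrite lteDl; first by rewrite mule_gt0// lte_fin mulr_gt0.
rewrite ge0_fin_numE; last exact: integral_ge0.
have bIK : (b%:E * \int[lamk]_y F y < +oo)%E.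
  by apply: lte_mul_pinfty => //; rewrite lee_fin ltW.
apply: le_lt_trans bIK.
rewrite -ge0_integralZl//; last by rewrite lee_fin ltW.
apply: ge0_le_integral => //; first by apply: emeasurable_funM.
by move=> y _; apply: le_trans (HF y); rewrite leeDl// mule_ge0// lee_fin ltW// mulr_gt0.
Qed.

End body_inequality.

(** * Dual curvature of subspaces *)

Section partial_minimum.
Context (R : realType) (k l : nat) (N : 'rV[R]_(k + l) -> R).
Hypothesis N_norm : norm_like N.
Implicit Types (y : 'rV[R]_k) (z : 'rV[R]_l).

(* If [N] is the gauge of a body, this is the gauge of its projection. *)
Definition partial_min y : R := inf [set N (row_mx y z) | z in setT].

Let N_ge0 x : 0 <= N x. Proof. by case: N_norm => G _ _ _ _; exact: gauge_like_ge0. Qed.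

Lemma partial_min_le y z : partial_min y <= N (row_mx y z).
Proof. by apply: ge_inf; [exists 0 => _ [? _ <-]; exact: N_ge0|exists z]. Qed.

Lemma partial_min_ge y c : (forall z, c <= N (row_mx y z)) -> c <= partial_min y.
Proof.
move=> cN; apply: lb_le_inf; first by exists (N (row_mx y 0)), 0.
by move=> _ [z _ <-].
Qed.

Lemma partial_min_ub : exists2 C, 0 < C & forall y, partial_min y <= C * enorm y.
Proof.
have [_ _ _ [C C0 NC] _] := N_norm; exists C => // y.
rewrite (le_trans (partial_min_le y 0))// (le_trans (NC _))// ler_pM2l//.
by rewrite /enorm dotv_row_mx dotv0l addr0.
Qed.

Lemma gauge_like_partial_min : gauge_like partial_min.
Proof.
have [[_ NZ _ N0] ND _ [C C0 NC] [M M0 NM]] := N_norm.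
split.
- apply: continuous_measurable_rV; apply: (lipschitz_continuous_rV (C := C)) => y y'.
  rewrite lerBlDr -lerBlDl; apply: partial_min_ge => z.
  rewrite lerBlDl (le_trans (partial_min_le y z))//.
  have -> : row_mx y z = row_mx (y - y') 0 + row_mx y' z by rewrite add_row_mx subrK add0r.
  rewrite (le_trans (ND _ _))// lerD2r (le_trans (NC _))// ler_pM2l//.
  by rewrite /enorm dotv_row_mx dotv0l addr0.
(* The reverse inequality is this one for the inverse factor. *)
- have le_scale t y : 0 < t -> t * partial_min y <= partial_min (t *: y).
    move=> t0; apply: partial_min_ge => z; rewrite -ler_pdivlMl//.
    rewrite (le_trans (partial_min_le y (t^-1 *: z)))//.
    have -> : row_mx y (t^-1 *: z) = t^-1 *: row_mx (t *: y) z.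
      by rewrite scale_row_mx scalerA mulVf ?scale1r// gt_eqF.
    by rewrite NZ// invr_gt0.
  move=> t y t0; apply/le_anti; rewrite le_scale// andbT -ler_pdivrMl//.
  have := le_scale t^-1 (t *: y); rewrite scalerA mulVf ?gt_eqF// scale1r.
  by apply; rewrite invr_gt0.
- move=> y y0; apply: (@lt_le_trans _ _ (enorm y / M)).
    by rewrite divr_gt0// enorm_gt0.
  apply: partial_min_ge => z; rewrite ler_pdivrMr// mulrC (le_trans _ (NM _))//.
  by rewrite /enorm ler_wsqrtr// dotv_row_mx lerDl dotv_ge0.
- apply/le_anti; rewrite partial_min_ge// andbT.
  by rewrite (le_trans (partial_min_le 0 0))// row_mx0 N0.
Qed.

End partial_minimum.

Section subspace.
Context (R : realType) (k l : nat) (K : set 'rV[R]_(k + l)) (O : 'M[R]_(k + l)).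
Hypothesis OO : O *m O^T = 1%:M.

Lemma norm_like_gauge : convex_body_e K -> norm_like (fun x => gauge K (x *m O)).
Proof.
move=> Ke; have Ko : convex_body_o K by case: Ke.
have [mg gZ g0 _] := gauge_like_gauge Ko.
split.
- split=> [|t x t0|x x0|].
  + by apply: measurableT_comp => //; apply: measurable_rV_mulmx; exact: measurable_id.
  + by rewrite -scalemxAl gZ.
  + by apply: g0; rewrite -enorm_gt0 enorm_mulmx// enorm_gt0.
  + by rewrite mul0mx gauge0.
- by move=> x y; rewrite mulmxDl gaugeD.
- by move=> x; rewrite mulNmx gaugeN.
- by have [C C0 HC] := gauge_enorm_le Ko; exists C => // x; rewrite -(enorm_mulmx _ OO).
- by have [M M0 HM] := enorm_gauge_le Ko; exists M => // x; rewrite -(enorm_mulmx _ OO).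
Qed.

(* A boundary point x with an outer normal in L minimizes the gauge on x + L^perp:
   all points of x + L^perp have the same inner product with that normal. *)
Lemma rev_radial_Gauss_subspace (eta : set 'rV[R]_(k + l)) u : convex_body_e K ->
  eta `<=` @usphere R (k + l) ->
  (forall v, eta v -> exists w : 'rV[R]_k, v = row_mx w 0 *m O) ->
  rev_radial_Gauss K eta u ->
  gauge K u = partial_min (fun x => gauge K (x *m O)) (lsubmx (u *m O^T)).
Proof.
move=> Ke etaS etaO [Su [v etav]]; rewrite /supporting_hyperplane /= => Hv.
have Ko : convex_body_o K by case: Ke.
have Nn := norm_like_gauge Ke.
have OTO : O^T *m O = 1%:M by exact: mulmx1C.
set x := u *m O^T; have xO : x *m O = u by rewrite -mulmxA OTO mulmx1.
apply/le_anti/andP; split; last first.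
  by rewrite -xO -[x in leRHS]hsubmxK; exact: (partial_min_le Nn).
apply: partial_min_ge => z; rewrite leNgt; apply/negP => Nz.
have [w vE] := etaO v etav.
have dvO (x1 x2 : 'rV[R]_(k + l)) : dotv (x1 *m O) (x2 *m O) = dotv x1 x2.
  by rewrite !dotvE trmx_mul mulmxA -(mulmxA x1) OO mulmx1.
have uv z' : dotv (row_mx (lsubmx x) z' *m O) v = dotv u v.
  by rewrite -xO vE !dvO -[x in RHS]hsubmxK !dotv_row_mx !(dotvC _ 0) !dotv0l.
have u0 : u != 0 by rewrite -enorm_eq0 Su oner_eq0.
have gu : 0 < gauge K u by exact: gauge_gt0.
have rE : radial_fun K u = (gauge K u)^-1 by rewrite /gauge invrK.
have hge y : K y -> dotv v y <= support_fun K v.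
  by move=> Ky; apply: ub_le_sup; [exact: support_fun_ubound|exists y].
(* [K] contains a ball around the origin, so its support function is positive at [v]; hence so is
   [dotv u v], by which the final comparison divides. *)
have hv : 0 < support_fun K v.
  have [r r0 rK] := convex_body_inner Ko.
  have ev : enorm v = 1 by exact: etaS.
  apply: (@lt_le_trans _ _ (dotv v (r *: v))).
    by rewrite dotvZr -sqr_enorm ev expr1n mulr1.
  by apply: hge; apply: rK; rewrite enormZ ev mulr1 gtr0_norm.
have d0 : 0 < dotv u v by move: hv; rewrite -Hv rE dotvZl pmulr_rgt0// invr_gt0.
(* A value strictly between the two gauges: dividing the better point by it gives a point of [K]
   beyond the supporting hyperplane. *)
pose c := (gauge K (row_mx (lsubmx x) z *m O) + gauge K u) / 2.
have gz := gauge_ge0 Ko (row_mx (lsubmx x) z *m O).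
have c0 : 0 < c by rewrite /c; lra.
have cu : c < gauge K u by rewrite /c; lra.
have : K (c^-1 *: (row_mx (lsubmx x) z *m O)) by apply/gauge_leP => //; rewrite /c; lra.
move=> /hge; rewrite dotvC dotvZl uv -Hv rE dotvZl ler_pM2r// lef_pV2 ?posrE//.
by rewrite leNgt cu.
Qed.

End subspace.

(** The integral is a supremum over simple functions below the restricted integrand, which is
    monotone in the domain. It serves for the reverse radial Gauss image, whose measurability is not
    established. *)
Lemma ge0_subset_integral_any d (T : measurableType d) (R : realType)
    (mu : {measure set T -> \bar R}) (D E : set T) (f : T -> \bar R) :
  D `<=` E -> (forall x, 0 <= f x)%E ->
  (\int[mu]_(x in D) f x <= \int[mu]_(x in E) f x)%E.
Proof.
move=> DE f0; rewrite !ge0_integralE//; apply: ereal_sup_le => _ [h hD <-].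
exists (h : {nnsfun T >-> R}) => // x; apply: (le_trans (hD x)); rewrite !patchE.
case: ifPn => [/set_mem/DE/mem_set ->//|_]; by case: ifP.
Qed.

Lemma lebesgue_integral_orthogonal (R : realType) n (O : 'M[R]_n) (f : 'rV[R]_n -> \bar R) :
  O *m O^T = 1%:M -> measurable_fun setT f -> (forall x, 0 <= f x)%E ->
  (\int[lebesgue_rV R n]_x f (x *m O) = \int[lebesgue_rV R n]_x f x)%E.
Proof.
move=> OO mf f0.
rewrite (ge0_integral_scaled_pushforward (mu2 := lebesgue_rV R n)
  (g := fun x : 'rV[R]_n => x *m O) (c := 1))// ?mul1e//.
  by apply: measurable_rV_mulmx; exact: measurable_id.
by move=> A mA; rewrite mul1e; exact: lebesgue_rV_orthogonal.
Qed.

(** * Dual curvature as a volume integral *)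

Section curvature.
Context (R : realType) (n : nat).
Variables (K : set 'rV[R]_n) (q : R).
Hypothesis Ko : convex_body_o K.
Hypothesis q0 : 0 < q.
Local Notation V := 'rV[R]_n.
Local Notation S := (@usphere R n).
Local Notation lam := (lebesgue_rV R n).

Lemma radial_powRE x : radial_fun K x `^ q = gauge K x `^ (- q).
Proof.
have -> : radial_fun K x = (gauge K x)^-1 by rewrite /gauge invrK.
by rewrite -powR_inv1 ?gauge_ge0// -powRrM mulN1r.
Qed.

Lemma measurable_radial_powR : measurable_fun setT (fun u : V => (radial_fun K u `^ q)%:E).
Proof.
have [mg _ _ _] := gauge_like_gauge Ko.
under eq_fun do rewrite radial_powRE.
by apply/measurable_EFinP; exact: (measurableT_comp (measurable_powR (- q)) mg).
Qed.

Lemma gauge_like_enorm : gauge_like (@enorm R n).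
Proof.
split=> [|t x t0|x|]; [exact: measurable_enorm|by rewrite enormZ gtr0_norm|
  by rewrite enorm_gt0|exact: enorm0].
Qed.

(** [polar_exchange] between the Euclidean norm with exponent [n] and the gauge with exponent [q].
    The integrand [f], homogeneous of degree [- n], is chosen so that the first weight turns it into
    [n] times the radial density at [direction x], and the second into [q] times [|x|] to the power
    [q - n]. *)
Lemma curvature_polar (P : V -> bool) : measurable_fun setT P ->
  (forall t x, 0 < t -> P (t *: x) = P x) -> (0 < n)%N -> n%:R + 1 <= q ->
  (n%:R%:E * \int[lam]_(x in cone_ball (S `&` [set u | P u]))
      (radial_fun K (direction x) `^ q)%:E =
   q%:E * \int[lam]_x (if (gauge K x < 1)%R && P x
      then enorm x `^ (q - n%:R) else 0)%R%:E)%E.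
Proof.
move=> mP PZ n0 nq; have [mg gZ gpos g0] := gauge_like_gauge Ko.
have mPset : measurable [set u | P u].
  by have := mP measurableT [set true] I; rewrite setTI.
have mcone : measurable (cone_ball (S `&` [set u | P u])).
  by apply: measurable_cone_ball; apply: measurableI => //; exact: measurable_usphere.
have mrad : measurable_fun setT (fun x : V => (radial_fun K (direction x) `^ q)%:E).
  exact: measurableT_comp measurable_radial_powR (@measurable_direction R n).
have mpow r : measurable_fun setT (fun x : V => enorm x `^ r).
  exact: (measurableT_comp (measurable_powR r) (@measurable_enorm R n)).
pose f x : \bar R := (if P x then gauge K x `^ (- q) * enorm x `^ (q - n%:R) else 0)%:E.
have mf : measurable_fun setT f.
  apply/measurable_EFinP; apply: measurable_fun_ifT => //; apply: measurable_funM => //.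
  exact: (measurableT_comp (measurable_powR (- q)) mg).
have f0 x : (0 <= f x)%E.
  by rewrite lee_fin; case: ifP => // _; rewrite mulr_ge0 ?powR_ge0.
have fZ t x : 0 < t -> f (t *: x) = ((t ^- n)%:E * f x)%E.
  move=> t0; rewrite /f PZ// -EFinM; congr EFin; case: (P x); last by rewrite mulr0.
  rewrite gZ// enormZ gtr0_norm// !powRM ?(ltW t0) ?enorm_ge0 ?gauge_ge0//.
  rewrite mulrACA; congr (_ * _); rewrite -powRD; last by rewrite (gt_eqF t0) implybT.
  by rewrite addrA addNr add0r powRN powR_mulrn// ltW.
have n1 : 1 <= n%:R :> R by rewrite ler1n.
have q1 : 1 <= q by lra.
have := polar_exchange gauge_like_enorm (gauge_like_gauge Ko) n1 q1 mf f0 fZ.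
have qn : q != 0 by rewrite gt_eqF.
have nn : n%:R != 0 :> R by rewrite gt_eqF// ltr0n.
have -> : (\int[lam]_x (f x * (cutpow (@enorm R n) n%:R x)%:E) =
    n%:R%:E * \int[lam]_(x in cone_ball (S `&` [set u | P u]))
      (radial_fun K (direction x) `^ q)%:E)%E.
  rewrite [in RHS]integral_mkcond -ge0_integralZl//; last 2 first.
  - by apply/(measurable_restrictT _ mcone); exact: measurable_funTS.
  - by move=> x _; rewrite patchE; case: ifP => // _; rewrite lee_fin powR_ge0.
  apply: eq_integral => x _; rewrite patchE.
  have [->|x0] := eqVneq x 0.
    rewrite (cutpow0 gauge_like_enorm nn).
    rewrite mule0 ifN ?mule0//; apply/negP => /set_mem[_ [+ _]].
    by rewrite /direction scaler0 /usphere /= enorm0 => /eqP; rewrite eq_sym oner_eq0.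
  have e0 : 0 < enorm x by rewrite enorm_gt0.
  have Sx := direction_usphere x0.
  have Pd : P (direction x) = P x by rewrite /direction PZ// invr_gt0.
  rewrite /cutpow /f.
  have -> : (x \in cone_ball (S `&` [set u | P u])) = (enorm x < 1) && P x.
    by apply/idP/idP; rewrite inE /cone_ball /= Pd; [move=> [-> [_ ->]]|move=> /andP[]].
  case: ltP => _ /=; last by rewrite !mule0.
  case: (P x); last by rewrite mul0e mule0.
  rewrite -!EFinM radial_powRE /direction gZ ?invr_gt0//.
  have ei0 : 0 <= (enorm x)^-1 by rewrite invr_ge0 ltW.
  rewrite (powRM _ ei0 (gauge_ge0 Ko x)).
  rewrite -[(enorm x)^-1]powR_inv1 ?(ltW e0)// -powRrM mulrNN mul1r.
  have -> : enorm x `^ q = enorm x `^ (q - n%:R) * enorm x `^ n%:R.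
    by rewrite -powRD ?subrK// (gt_eqF e0) implybT.
  congr EFin; ring.
move=> ->; rewrite -ge0_integralZl//; last 3 first.
- apply/measurable_EFinP; apply: measurable_fun_ifT => //.
  by apply: measurable_and => //; exact: measurable_fun_ltr.
- by move=> x _; rewrite lee_fin; case: ifP => // _; rewrite powR_ge0.
- by rewrite lee_fin ltW.
apply: eq_integral => x _; have [->|x0] := eqVneq x 0.
  rewrite (cutpow0 (gauge_like_gauge Ko) qn).
  have qnn : q - n%:R != 0 by rewrite gt_eqF//; lra.
  by rewrite enorm0 powR0// if_same !mule0.
have gx := gpos _ x0; rewrite /cutpow /f -!EFinM; congr EFin.
case: ltP => _ /=; last by rewrite !mulr0.
case: (P x); last by rewrite mul0r mulr0.
rewrite powRN; field; rewrite gt_eqF// powR_gt0//.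
Qed.

End curvature.

Section extreme_hausdorff.
Context (R : realType) (n d : nat).
Variables (K : set 'rV[R]_n) (q : R).
Hypothesis Ko : convex_body_o K.
Hypothesis q0 : 0 < q.
Local Notation S := (@usphere R n).
Local Notation H := (@hausdorff_measure R n d).

Let mS : measurable (S : set (caratheodory_type (@hausdorff R n d))).
Proof. exact: measurable_caratheodory_borel (@measurable_usphere R n). Qed.

Let measurable_density :
  measurable_fun (S : set (caratheodory_type (@hausdorff R n d)))
    (fun u => (radial_fun K u `^ q)%:E).
Proof.
apply: measurable_funTS.
exact: (measurableT_comp (measurable_radial_powR q Ko)
  (@measurable_caratheodory_id R n d)).
Qed.

Lemma integral_hausdorff0 : hausdorff d S = 0%E ->
  (\int[H]_(u in S) (radial_fun K u `^ q)%:E = 0)%E.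
Proof.
move=> S0; rewrite (@ge0_negligible_integral _ _ _ H S S)//; first by rewrite setDv integral_set0.
by move=> u _; rewrite lee_fin powR_ge0.
Qed.

(** On the sphere the gauge is at most [C], so the density is bounded below by a positive
    constant. *)
Lemma integral_hausdorffy : hausdorff d S = +oo%E ->
  (\int[H]_(u in S) (radial_fun K u `^ q)%:E = +oo)%E.
Proof.
move=> Soo; have [C C0 HC] := gauge_enorm_le Ko.
apply/eqP; rewrite -leye_eq -(@gt0_mulye _ (C `^ (- q))%:E); last by rewrite lte_fin powR_gt0.
rewrite muleC -Soo -[hausdorff d S]/(H S) -(integral_cst H mS).
apply: (@ge0_le_integral _ _ _ H _ mS).
- by move=> u _; rewrite lee_fin powR_ge0.
- exact: measurable_cst.
- exact: measurable_density.
move=> u Su; rewrite /cst lee_fin radial_powRE// !powRN.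
have u0 : u != 0 by rewrite -enorm_eq0 Su oner_eq0.
have g0 := gauge_gt0 Ko u0.
rewrite lef_pV2 ?posrE ?powR_gt0// ge0_ler_powR ?nnegrE ?(ltW g0) ?(ltW C0) ?(ltW q0)//.
by have := HC u; rewrite Su mulr1.
Qed.

End extreme_hausdorff.

Theorem theorem1p7 (R : realType) (n : nat) (K : set 'rV[R]_n) (q : R)
    (L : {vspace 'rV[R]_n}) :
  convex_body_e K ->
  n%:R + 1 <= q ->
  L <> fullv ->
  (dual_curvature q K (@usphere R n `&` [set` L])
     / dual_curvature q K (@usphere R n)
   < ((q - n%:R + (\dim L)%:R) / q)%:E)%E.
Proof.
move=> Ke nq LT; have Ko : convex_body_o K by case: Ke.
have [k [l [ O [kL kln OO LO]]]] := orthonormal_basis L; subst n.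
have l0 : (0 < l)%N.
  rewrite lt0n; apply/eqP => l_0; apply: LT; apply/eqP.
  by rewrite eqEdim subvf /= -kL dimvf /dim /= mul1n l_0 addn0.
have n0 : (0 < k + l)%N by rewrite addn_gt0 l0 orbT.
have q0 : 0 < q by rewrite (lt_le_trans _ nq)// ltr_wpDl.
rewrite -kL; set p := q - (k + l)%:R; have p1 : 1 <= p by rewrite /p; lra.
have pq : p + (k + l)%:R = q by rewrite subrK.
pose N (x : 'rV[R]_(k + l)) := gauge K (x *m O).
have Nn : norm_like N by exact: norm_like_gauge.
have OTO : O^T *m O = 1%:M by exact: mulmx1C.
pose P (u : 'rV[R]_(k + l)) := gauge K u == partial_min N (lsubmx (u *m O^T)).
have [mg gZ gpos g0] := gauge_like_gauge Ko.
have [mM MZ _ _] := gauge_like_partial_min Nn.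
have mP : measurable_fun setT P.
  apply: measurable_fun_eqr => //; apply: measurableT_comp => //.
  apply: measurable_fun_rV => i; under eq_fun do rewrite mxE.
  apply: measurable_rV_coord; apply: measurable_rV_mulmx; exact: measurable_id.
have PZ t x : 0 < t -> P (t *: x) = P x.
  move=> t0; have := inj_eq (mulfI (lt0r_neq0 t0)) (gauge K x).
  rewrite /P (gZ _ _ t0) -scalemxAl => <-; rewrite -(MZ _ _ t0); congr (_ == partial_min N _).
  by apply/rowP => i; rewrite !mxE.
set S := @usphere R (k + l); pose d := (k + l).-1.
pose rho (u : 'rV[R]_(k + l)) : \bar R := (radial_fun K u `^ q)%:E.
have rho0 u : (0 <= rho u)%E by rewrite lee_fin powR_ge0.
have mrho : measurable_fun setT rho by exact: measurable_radial_powR.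
pose D := rev_radial_Gauss K (S `&` [set` L]).
have DP : D `<=` S `&` [set u | P u].
  (* This inclusion in a Borel set stable under dilations of direction vectors is what bounds the
     numerator in [T1le]. *)
  move=> u Du; split; first by case: Du.
  apply/eqP; apply: (rev_radial_Gauss_subspace OO Ke _ _ Du) => [v []//|v [_ /LO//]].
set T1 := (\int[@hausdorff_measure R (k + l) d]_(u in D) rho u)%E.
set T2 := (\int[@hausdorff_measure R (k + l) d]_(u in S) rho u)%E.
have T10 : (0 <= T1)%E by exact: integral_ge0.
have T20 : (0 <= T2)%E by exact: integral_ge0.
have T12 : (T1 <= T2)%E by apply: ge0_subset_integral_any => // u [].
rewrite /dual_curvature rev_radial_Gauss_usphere// -/d -/S -/D -/T1 -/T2.
have target0 : (0 < ((p + k%:R) / q)%:E)%E.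
  by rewrite lte_fin divr_gt0// ltr_wpDr// (lt_le_trans ltr01).
have ni : 0 < (k + l)%:R^-1 :> R by rewrite invr_gt0 ltr0n.
(* If the sphere has measure 0 or [+oo], the quotient is 0, because [0 * 0^-1 =
   0 * +oo = 0] and [+oo^-1 = 0]: no estimate of the area is needed. *)
have [S0|S0] := eqVneq (hausdorff d S) 0%E.
  have T2_0 : T2 = 0%E by exact: integral_hausdorff0.
  have T1_0 : T1 = 0%E by apply/eqP; rewrite eq_le T10 -T2_0 T12.
  by rewrite T1_0 mule0 mul0e.
have [Soo|Soo] := eqVneq (hausdorff d S) +oo%E.
  have -> : T2 = +oo%E by exact: integral_hausdorffy.
  by rewrite gt0_muley ?lte_fin// invey mule0.
have HS : (0 < hausdorff d S < +oo)%E by rewrite lt_def S0 hausdorff_ge0 ltey Soo.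
have [c c0 cE] := sphere_integral HS.
have mS : measurable S by exact: measurable_usphere.
have mPset : measurable [set u | P u].
  by have := mP measurableT [set true] I; rewrite setTI.
have [mN _ _ _] : gauge_like N by case: Nn.
have mJ1 : measurable_fun setT
    (fun x => (if (gauge K x < 1) && P x then enorm x `^ p else 0)%:E).
  apply/measurable_EFinP; apply: measurable_fun_ifT => //.
    by apply: measurable_and => //; exact: measurable_fun_ltr.
  exact: (measurableT_comp (measurable_powR p) (@measurable_enorm R _)).
have mJ2 : measurable_fun setT
    (fun x => (if (gauge K x < 1) && xpredT x then enorm x `^ p else 0)%:E).
  apply/measurable_EFinP; apply: measurable_fun_ifT => //.
    by apply: measurable_and => //; exact: measurable_fun_ltr.
  exact: (measurableT_comp (measurable_powR p) (@measurable_enorm R _)).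
have slice := slice_inequality Nn (gauge_like_partial_min Nn) (partial_min_ub Nn) p1 l0.
have IKoo := ball_integral_lty Nn p1.
rewrite pq in slice; set ID := (\int[_]_x _)%E in slice; set IK := (\int[_]_x _)%E in slice IKoo.
have ID0 : (0 <= ID)%E.
  by apply: integral_ge0 => x _; rewrite lee_fin; case: ifP => // _; rewrite powR_ge0.
have IK0 : (0 <= IK)%E.
  by apply: integral_ge0 => x _; rewrite lee_fin; case: ifP => // _; rewrite powR_ge0.
have I1E := curvature_polar Ko q0 mP PZ n0 nq.
have I2E := curvature_polar Ko q0 (measurable_cst true) (fun _ _ _ => erefl) n0 nq.
(* [curvature_polar] speaks of the original coordinates and [slice_inequality] of those adapted to
   [L]; the orthogonal [O] identifies the integrals. *)
rewrite -/p (_ : (\int[_]_x _ = ID)%E) in I1E; last first.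
  rewrite -(lebesgue_integral_orthogonal OO mJ1); last first.
    by move=> x; rewrite lee_fin; case: ifP => // _; rewrite powR_ge0.
  by apply: eq_integral => x _; rewrite /P enorm_mulmx// -mulmxA OO mulmx1.
rewrite -/p (_ : (\int[_]_x _ = IK)%E) in I2E; last first.
  rewrite -(lebesgue_integral_orthogonal OO mJ2); last first.
    by move=> x; rewrite lee_fin; case: ifP => // _; rewrite powR_ge0.
  by apply: eq_integral => x _; rewrite enorm_mulmx// andbT.
have IDfin : ID \is a fin_num.
  rewrite ge0_fin_numE// ltey; apply/eqP => IDy; move: slice.
  by rewrite IDy gt0_muley ?lte_fin// ltNge leey.
have IKfin : IK \is a fin_num by rewrite ge0_fin_numE.
rewrite -(fineK IDfin) -(fineK IKfin) -!EFinM in slice I1E I2E.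
rewrite lte_fin in slice.
have solve_n (I r : \bar R) : ((k + l)%:R%:E * I = r -> I = ((k + l)%:R^-1)%:E * r)%E.
  by move=> <-; rewrite muleA -EFinM mulVf ?mul1e// gt_eqF// ltr0n.
have setSP (A : set 'rV[R]_(k + l)) : S `&` A `<=` S by move=> u [].
have T1le : (T1 <= (c * ((k + l)%:R^-1 * (q * fine ID)))%:E)%E.
  rewrite EFinM EFinM -(solve_n _ _ I1E) -(cE _ rho)//; last exact: measurableI.
  exact: ge0_subset_integral_any.
have T2E : T2 = (c * ((k + l)%:R^-1 * (q * fine IK)))%:E.
  rewrite EFinM EFinM -(solve_n _ _ I2E).
  have -> : S `&` [set u | cst true u] = S by apply/seteqP; split => u // [].
  by rewrite -(cE _ rho).
have T1fin : T1 \is a fin_num by rewrite ge0_fin_numE// (le_lt_trans T1le)// ltry.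
rewrite -(fineK T1fin) lee_fin in T1le.
(* The strict inequality [slice] has a nonnegative left-hand side, so the denominator is
   positive. *)
have iK0 : 0 < fine IK.
  have iD0 : 0 <= fine ID by exact: fine_ge0.
  have : 0 < (p + k%:R) * fine IK by rewrite (le_lt_trans _ slice)// mulr_ge0// ltW.
  by rewrite pmulr_rgt0// ltr_wpDr// (lt_le_trans ltr01).
have B0 : 0 < (k + l)%:R^-1 * (c * ((k + l)%:R^-1 * (q * fine IK))) by rewrite !mulr_gt0.
(* The factors [c] and [1 / n] are common to both integrals and cancel; what remains is [slice]. *)
rewrite T2E -(fineK T1fin) -!EFinM inver (gt_eqF B0) -EFinM lte_fin ltr_pdivrMr//.
rewrite mulrCA ltr_pM2l// (le_lt_trans T1le)//.
rewrite [ltRHS]mulrCA ltr_pM2l// [ltRHS]mulrCA ltr_pM2l// mulrA divfK ?gt_eqF//.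
Qed.
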